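(* Let $n\ge 2$, let $\Omega\subset\mathbb R^n$ be a bounded Lipschitz domain, $T>0$, $\nu>0$ and $Q_T=\Omega\times(0,T)$. Assume $b\in L_2(Q_T)$ (with values in $\mathbb R^n$) satisfies $\operatorname{div} b\le 0$ in $\mathcal D'(Q_T)$. Then for any $u_0\in L_2(\Omega)$ and $f\in L_1(Q_T)$ the problem $$\partial_t u-\nu\Delta u+b\cdot\nabla u=f \ \text{ in } Q_T,\qquad u|_{\partial\Omega\times(0,T)}=0,\qquad u|_{t=0}=u_0$$ has at most one weak solution.
   Context: $\overset{\circ}{W}{}^1_2(\Omega)$ is the closure of $C_0^\infty(\Omega)$ in the Sobolev space $W^1_2(\Omega)$. $\nabla$ is the gradient in $x$. The condition $\operatorname{div} b\le 0$ in $\mathcal D'(Q_T)$ means $\int_{Q_T} b\cdot\nabla\eta\,dxdt\ge 0$ for all $\eta\in C_0^\infty(Q_T)$ with $\eta\ge 0$. Weak solution: for $b\in L_2(Q_T)$, $u_0\in L_2(\Omega)$, $f\in L_1(Q_T)$, a scalar function $u$ on $Q_T$ is a weak solution of the problem if $u\in L_\infty(0,T;L_2(\Omega))\cap L_2(0,T;\overset{\circ}{W}{}^1_2(\Omega))$ and $$\int_{Q_T}\big(-u\,\partial_t\eta+\nu\nabla u\cdot\nabla\eta\big)\,dxdt+\int_{Q_T} b\cdot\nabla u\,\eta\,dxdt=\int_\Omega u_0(x)\eta(x,0)\,dx+\int_{Q_T} f\eta\,dxdt$$ for all $\eta\in C_0^\infty(\Omega\times[0,T))$. *)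

(* Defs.v *)
From HB Require Import structures.
From mathcomp Require Import all_boot all_order all_algebra.
From mathcomp Require Import all_classical all_reals all_analysis.
Set Implicit Arguments.
Unset Strict Implicit.
Unset Printing Implicit Defensive.
Import Order.TTheory GRing.Theory Num.Theory.
Import numFieldNormedType.Exports.
Local Open Scope classical_set_scope.
Local Open Scope ring_scope.

(* The sigma-algebra on row vectors is the one generated by the coordinates;
   over the reals it is the Borel one (open_measurable_rV). *)
Definition measure_rV_display : measure_display -> measure_display.
Proof. exact. Qed.

Section measurable_rV.
Context {d} {T : measurableType d} (n : nat).

Let coord (i : 'I_n) (x : 'rV[T]_n) : T := x ord0 i.

Let rV_set0 : g_sigma_preimage coord set0.
Proof. exact: sigma_algebra0. Qed.

Let rV_setC A : g_sigma_preimage coord A -> g_sigma_preimage coord (~` A).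
Proof. exact: sigma_algebraC. Qed.

Let rV_bigcup (F : (set 'rV[T]_n)^nat) :
  (forall i, g_sigma_preimage coord (F i)) ->
  g_sigma_preimage coord (\bigcup_i (F i)).
Proof. exact: sigma_algebra_bigcup. Qed.

HB.instance Definition _ := @isMeasurable.Build (measure_rV_display d)
  'rV[T]_n (g_sigma_preimage coord) rV_set0 rV_setC rV_bigcup.

Lemma measurable_coord (i : 'I_n) :
  measurable_fun [set: 'rV[T]_n] (fun x : 'rV[T]_n => x ord0 i).
Proof.
move=> _ Y mY; rewrite setTI; apply: sub_sigma_algebra => /=.
rewrite -bigcup_seq/=; exists i => /=; first by rewrite mem_index_enum.
by exists Y => //; rewrite setTI.
Qed.

End measurable_rV.

Section measurable_rV_fun.
Context d d' (T : measurableType d) (S : measurableType d').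

Lemma measurable_fun_rV n (f : S -> 'rV[T]_n) :
  (forall i, measurable_fun [set: S] (fun s => f s ord0 i)) ->
  measurable_fun [set: S] f.
Proof.
move=> mf; suff: preimage_set_system [set: S] f measurable `<=` measurable.
  by move=> h _ A mA; apply: h; exists A.
rewrite -[X in preimage_set_system _ _ X]/(g_sigma_preimage _).
rewrite /g_sigma_preimage -g_sigma_preimageE.
apply: smallest_sub; first exact: sigma_algebra_measurable.
move=> A [B]; rewrite -bigcup_seq => -[i _ [C mC <-]] <-.
by rewrite !setTI -(setTI (_ @^-1` _)); exact: mf.
Qed.

End measurable_rV_fun.

Section lebesgue_rV.
Context {R : realType}.
Local Open Scope ereal_scope.

Definition cons_rV n (z : R * 'rV[R]_n) : 'rV[R]_n.+1 := row_mx z.1%:M z.2.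

Let uncons_rV n (x : 'rV[R]_n.+1) : R * 'rV[R]_n :=
  (x ord0 ord0, \row_i x ord0 (lift ord0 i)).

Lemma cons_rV0 n (z : R * 'rV[R]_n) : cons_rV z ord0 ord0 = z.1.
Proof.
have := row_mxEl (z.1%:M : 'M[R]_1) z.2 ord0 ord0; rewrite [RHS]mxE mulr1n => <-.
by congr (row_mx _ _ _); exact: val_inj.
Qed.

Lemma cons_rVS n (z : R * 'rV[R]_n) (i : 'I_n) :
  cons_rV z ord0 (lift ord0 i) = z.2 ord0 i.
Proof.
have <- := row_mxEr (z.1%:M : 'M[R]_1) z.2 ord0 i; rewrite /cons_rV.
by congr (row_mx _ _ _); exact: val_inj.
Qed.

Lemma measurable_cons_rV n : measurable_fun [set: R * 'rV[R]_n] (@cons_rV n).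
Proof.
apply: measurable_fun_rV => i; case: (unliftP ord0 i) => [j ->|->].
  under eq_fun do rewrite cons_rVS.
  exact: (measurableT_comp (measurable_coord j) measurable_snd).
under eq_fun do rewrite cons_rV0.
exact: measurable_fst.
Qed.

Let measurable_uncons_rV n : measurable_fun [set: 'rV[R]_n.+1] (@uncons_rV n).
Proof.
apply/measurable_fun_pair; first exact: measurable_coord.
apply: measurable_fun_rV => i; under eq_fun do rewrite mxE.
exact: measurable_coord.
Qed.

Let cons_rVK n : cancel (@cons_rV n) (@uncons_rV n).
Proof.
move=> [a v]; rewrite /uncons_rV cons_rV0; congr (_, _).
by apply/rowP => i; rewrite mxE cons_rVS.
Qed.

Section step.
Context (n : nat) (mu : {sigma_finite_measure set 'rV[R]_n -> \bar R}).

Definition lebesgue_rVS : set 'rV[R]_n.+1 -> \bar R :=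
  pushforward (lebesgue_measure \x mu) (@cons_rV n).

Let mcons := @measurable_cons_rV n.

Let lebesgue_rVS0 : lebesgue_rVS set0 = 0.
Proof. exact: measure0. Qed.

Let lebesgue_rVS_ge0 A : 0 <= lebesgue_rVS A.
Proof. exact: measure_ge0. Qed.

Let lebesgue_rVS_sigma_additive : semi_sigma_additive lebesgue_rVS.
Proof. exact: measure_semi_sigma_additive. Qed.

HB.instance Definition _ := isMeasure.Build _ _ _ lebesgue_rVS
  lebesgue_rVS0 lebesgue_rVS_ge0 lebesgue_rVS_sigma_additive.

Let lebesgue_rVS_sigma_finite : sigma_finite setT lebesgue_rVS.
Proof.
have /sigma_finiteP[F [TF ndF Foo]] :=
  sigma_finiteT (lebesgue_measure : {sigma_finite_measure set _ -> \bar R}).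
have /sigma_finiteP[G [TG ndG Goo]] := sigma_finiteT mu.
have fg k : @cons_rV n @^-1` (@uncons_rV n @^-1` (F k `*` G k)) = F k `*` G k.
  by rewrite -comp_preimage (_ : _ \o _ = id)//; apply/funext => z; exact: cons_rVK.
exists (fun k => @uncons_rV n @^-1` (F k `*` G k)).
  apply/seteqP; split=> // x _.
  have [i _ Fi] : (\bigcup_k F k) (uncons_rV x).1 by rewrite -TF.
  have [j _ Gj] : (\bigcup_k G k) (uncons_rV x).2 by rewrite -TG.
  exists (maxn i j) => //; split.
    by move: Fi; exact/subsetPset/ndF/leq_maxl.
  by move: Gj; exact/subsetPset/ndG/leq_maxr.
move=> k; have [mF Fk] := Foo k; have [mG Gk] := Goo k; split.
  rewrite -[X in measurable X]setTI; apply: measurable_uncons_rV => //.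
  exact: measurableX.
rewrite /lebesgue_rVS /pushforward fg product_measure1E//.
by rewrite lte_mul_pinfty// ge0_fin_numE.
Qed.

HB.instance Definition _ := Measure_isSigmaFinite.Build _ _ _ lebesgue_rVS
  lebesgue_rVS_sigma_finite.

End step.

(* Lebesgue measure on 'rV[R]_n, i.e. the n-fold product of the one-dimensional
   one (lebesgue_rV_box). *)
Fixpoint lebesgue_rV (n : nat) : {sigma_finite_measure set 'rV[R]_n -> \bar R} :=
  match n with
  | 0 => \d_(0%R : 'rV[R]_0)
  | m.+1 => lebesgue_rVS (lebesgue_rV m)
  end.


Lemma lebesgue_rV_box n (A : 'I_n -> set R) : (forall i, measurable (A i)) ->
  lebesgue_rV n [set x | forall i, A i (x ord0 i)] =
  \prod_(i < n) lebesgue_measure (A i).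
Proof.
elim: n A => [|n IHn] A mA.
  rewrite big_ord0 /= diracE mem_set//; by case.
rewrite big_ord_recl -IHn//= /lebesgue_rVS /pushforward -product_measure1E//.
- congr (_ _); apply/seteqP; split=> [[a v] /= Av|[a v] /= [Aa Av] i].
    split; first by have := Av ord0; rewrite cons_rV0.
    by move=> i; have := Av (lift ord0 i); rewrite cons_rVS.
  case: (unliftP ord0 i) => [j ->|->]; first by rewrite cons_rVS; exact: Av.
  by rewrite cons_rV0.
- exact: mA.
- set D := (X in measurable X).
  have -> : D = \bigcap_(i in [set: 'I_n])
      (fun x : 'rV[R]_n => x ord0 i) @^-1` A (lift ord0 i).
    by apply/seteqP; split=> [x Ax i _|x Ax i]; exact: Ax.
  apply: fin_bigcap_measurable => // i _.
  by rewrite -[X in measurable X]setTI; exact: measurable_coord.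
Qed.

Lemma open_measurable_rV n (U : set 'rV[R]_n) : open U -> measurable U.
Proof.
move=> oU.
pose q (c : 'rV[rat]_n) : 'rV[R]_n := map_mx ratr c.
pose B (ck : 'rV[rat]_n * nat) : set 'rV[R]_n := ball (q ck.1) ck.2.+1%:R^-1%R.
have mB ck : measurable (B ck).
  rewrite (_ : B ck = \bigcap_(i in [set: 'I_n]) (fun x : 'rV[R]_n =>
      x ord0 i) @^-1` ball (q ck.1 ord0 i) ck.2.+1%:R^-1%R); last first.
    apply/seteqP; split=> [x Bx i _|x Bx]; first exact: (Bx.2 ord0 i).
    by split=> [|j i]; rewrite ?invr_gt0// (ord1 j); exact: Bx.
  apply: fin_bigcap_measurable => // i _.
  rewrite -[X in measurable X]setTI; apply: measurable_coord => //.
  by apply: measurable_realfun.open_measurable; exact: ball_open.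
rewrite (_ : U = \bigcup_(ck in [set ck | B ck `<=` U]) B ck); last first.
  apply/seteqP; split=> [x Ux|x [ck /= BU Bx]]; last exact: BU.
  have /nbhs_ballP[e /= e0 xeU] : nbhs x U by exact: open_nbhs_nbhs.
  have e20 : (0 < e / 2)%R by rewrite divr_gt0.
  have [k _ /(_ k (leqnn k)) ke] := near_infty_natSinv_lt (PosNum e20).
  pose r := (k.+1%:R^-1 : R)%R.
  have r0 : (0 < r)%R by rewrite invr_gt0.
  have /choice[c cP] (i : 'I_n) : exists p : rat, ball (ratr p : R) r (x ord0 i).
    have /rat_in_itvoo[p] : (x ord0 i - r < x ord0 i + r)%R.
      by rewrite ltrBlDr -addrA ltrDl addr_gt0.
    rewrite in_itv/= => /andP[p1 p2]; exists p.
    by rewrite /ball/= ltr_distl p1.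
  exists (\row_i c i, k); last first.
    by split=> // j i; rewrite (ord1 j) !mxE; exact: cP.
  move=> y By; apply: xeU; split=> // j i; rewrite (ord1 j).
  have := By.2 ord0 i; rewrite !mxE/= => Byi.
  rewrite (splitr e). apply: (@ball_triangle R R (ratr (c i))).
    by apply: ball_sym; apply: le_ball (cP i); exact: ltW.
  by apply: le_ball Byi; exact: ltW.
rewrite bigcup_mkcond; apply: countable_bigcupT_measurable => //.
by move=> ck; case: ifP.
Qed.

End lebesgue_rV.

Section spaces.
Context {R : realType}.

Definition smooth (V : normedModType R) (f : V -> R) : Prop :=
  forall s : seq V, let g := foldr (fun v h => 'D_v h) f s in
    continuous g /\ forall x v, derivable g x v.

(* C_0^oo(A), also for a set A that is not open, such as Omega x [0, T): the
   elements are the restrictions to A of smooth functions on the whole space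
   whose support relative to A is a compact subset of A.  The values outside A
   are irrelevant. *)
Definition test_function (V : normedModType R) (A : set V) (eta : V -> R) :
    Prop :=
  let supp := closure (A `&` [set x | eta x != 0]) in
  [/\ smooth eta, compact supp & supp `<=` A].

Definition grad n (f : 'rV[R]_n -> R) (x : 'rV[R]_n) : 'rV[R]_n :=
  \row_i 'D_(delta_mx ord0 i) f x.

Definition grad_x n (f : 'rV[R]_n * R -> R) (z : 'rV[R]_n * R) : 'rV[R]_n :=
  grad (fun x => f (x, z.2)) z.1.

Definition deriv_t n (f : 'rV[R]_n * R -> R) (z : 'rV[R]_n * R) : R :=
  derive1 (fun t => f (z.1, t)) z.2.

Definition dot n (x y : 'rV[R]_n) : R := \sum_i x ord0 i * y ord0 i.

(* Near each boundary point p, up to the isometric change of coordinates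
   x *m O, Omega is the part above the graph of a Lipschitz function gamma of
   all the coordinates but the j-th one. *)
Definition lipschitz_domain n (Omega : set 'rV[R]_n) : Prop :=
  [/\ open Omega, connected Omega, Omega !=set0 &
    forall p, (closure Omega `\` Omega) p ->
      exists (O : 'M[R]_n) (j : 'I_n) (gamma : 'rV[R]_n.-1 -> R),
        [/\ O *m O^T = 1%:M, lipschitz gamma &
          \forall x \near p,
            Omega x <-> gamma (col' j (x *m O)) < (x *m O) ord0 j]].

Definition lebesgue_xt n :
    {measure set ('rV[R]_n * measurableTypeR R) -> \bar R} :=
  (lebesgue_rV n \x lebesgue_measure)%E.

Section Lebesgue_spaces.
Context {d} {T : measurableType d} (mu : {measure set T -> \bar R}).

Definition in_Lp (D : set T) (p : \bar R) (f : T -> R) : Prop :=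
  f \_ D \in Lfun mu p.

Definition in_Lp_rV n (D : set T) (p : \bar R) (f : T -> 'rV[R]_n) : Prop :=
  forall i, in_Lp D p (fun x => f x ord0 i).

End Lebesgue_spaces.

Section sobolev.
Context {n : nat} (Omega : set 'rV[R]_n).
Let mu := @lebesgue_rV R n.

Definition is_weak_grad (v : 'rV[R]_n -> R) (g : 'rV[R]_n -> 'rV[R]_n) : Prop :=
  forall phi i, test_function Omega phi ->
    \int[mu]_(x in Omega) (v x * grad phi x ord0 i) =
    - \int[mu]_(x in Omega) (g x ord0 i * phi x).

(* Elements of W^1_2 are given together with (a version of) their weak
   gradient, which is unique up to a null set. *)
Definition in_W12 (v : 'rV[R]_n -> R) (g : 'rV[R]_n -> 'rV[R]_n) : Prop :=
  [/\ in_Lp mu Omega 2%:E v, in_Lp_rV mu Omega 2%:E g & is_weak_grad v g].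

Definition W12_norm (v : 'rV[R]_n -> R) (g : 'rV[R]_n -> 'rV[R]_n) : \bar R :=
  ((\int[mu]_(x in Omega) (v x ^+ 2 + dot (g x) (g x))%:E) `^ 2^-1)%E.

Definition in_W12_0 (v : 'rV[R]_n -> R) (g : 'rV[R]_n -> 'rV[R]_n) : Prop :=
  in_W12 v g /\
  forall e : R, 0 < e -> exists2 phi, test_function Omega phi &
    (W12_norm (fun x => v x - phi x)%R (fun x => g x - grad phi x)%R < e%:E)%E.

End sobolev.

Section parabolic.
Context {n : nat} (Omega : set 'rV[R]_n) (T : R).
Implicit Types (u f : 'rV[R]_n * R -> R) (g b : 'rV[R]_n * R -> 'rV[R]_n).

Definition QT : set ('rV[R]_n * R) := Omega `*` `]0, T[.

Definition in_Linfty_L2 u : Prop :=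
  measurable_fun QT u /\
  ('N[lebesgue_measure]_+oo
    [(fun t : R => 'N[lebesgue_rV n]_2%:E
       [EFin \o (fun x => u (x, t)) \_ Omega]) \_ `]0%R, T[] < +oo)%E.

(* u is in L_2(0, T; W^1_2 with zero boundary values) and g is its gradient in
   x.  Strong measurability in t of the vector-valued function is rendered by
   the joint measurability of u and g. *)
Definition in_L2_W12_0 u g : Prop :=
  [/\ measurable_fun QT u,
    forall i, measurable_fun QT (fun z => g z ord0 i),
    {ae lebesgue_measure, forall t, `]0, T[%classic t ->
      in_W12_0 Omega (fun x => u (x, t)) (fun x => g (x, t))} &
    ('N[lebesgue_measure]_2%:E
      [(fun t : R => W12_norm Omega (fun x => u (x, t)) (fun x => g (x, t)))
         \_ `]0%R, T[] < +oo)%E].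

Definition div_le0 b : Prop :=
  forall eta, test_function QT eta -> (forall z, QT z -> 0 <= eta z) ->
    0 <= \int[lebesgue_xt n]_(z in QT) dot (b z) (grad_x eta z).

Definition weak_solution (nu : R) b (u0 : 'rV[R]_n -> R) f u : Prop :=
  in_Linfty_L2 u /\
  exists g, in_L2_W12_0 u g /\
    forall eta, test_function (Omega `*` `[0, T[) eta ->
      \int[lebesgue_xt n]_(z in QT)
          (- u z * deriv_t eta z + nu * dot (g z) (grad_x eta z)) +
      \int[lebesgue_xt n]_(z in QT) (dot (b z) (g z) * eta z) =
      \int[lebesgue_rV n]_(x in Omega) (u0 x * eta (x, 0)) +
      \int[lebesgue_xt n]_(z in QT) (f z * eta z).

End parabolic.
End spaces.

(* Main.v *)
Require Import Defs.
From HB Require Import structures.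
From mathcomp Require Import all_boot all_order all_algebra.
From mathcomp Require Import all_classical all_reals all_analysis.
From mathcomp Require Import measurable_realfun ring lra.
Set Implicit Arguments.
Unset Strict Implicit.
Unset Printing Implicit Defensive.
Import Order.TTheory GRing.Theory Num.Theory.
Import numFieldNormedType.Exports.
Local Open Scope classical_set_scope.
Local Open Scope ring_scope.

(** Let w be the difference of two weak solutions, with gradient g, continued
    by 0 outside Q_T.  The classical energy argument tests the equation for w
    with w itself, and fails twice: w has no time derivative in a function
    space, and the product w b . g need not be integrable.

    The second difficulty is met by a bounded nonlinearity.  Let B = softabs,
    that is B(s) = sqrt(1 + s^2) - 1; it is convex, vanishes only at 0, and its
    derivative softsgn takes values in [-1, 1].  The first one is met by
    freezing the time s of one factor.  For almost every s the function w(., s)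
    is in W12_0, hence a limit of test functions phi_k almost everywhere, with
    dominated gradients (in_W12_0_approximable), and one can test with the
    limit of softsgn(phi_k(x)) psi(t).  The data cancel, and what remains is
    (difference_slice_equation)

      int - psi'(t) w(x,t) softsgn(w(x,s))
          + psi(t) (nu g(x,t) . grad_x (softsgn(w(x,s)))
                    + b(x,t) . g(x,t) softsgn(w(x,s))) dx dt = 0

    for every bounded smooth psi that vanishes for t >= s.  Likewise div b <= 0,
    tested with B(phi_k(x)) psi(t), gives (difference_slice_divergence)

      int psi(t) b(x,t) . grad_x (B(w(x,s))) dx dt >= 0

    for smooth psi >= 0 with support in (0, s].

    Now take psi(t) = (T - s) k(t - s), integrate over s in (0, T) and write
    r = t - s.  The first identity becomes

      int - k'(r) JW(r) + k(r) JN(r) dr = 0,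

    where JW(r) is the integral of w(x,s+r) softsgn(w(x,s)) (T - s) over x and
    s, and JN(r) is the corresponding integral of the viscous and convective
    terms.  These correlations are continuous in r, because translations are
    continuous in the mean (cvg_shift_L1, cvg_tcorr_sq).  With
    k = P(. + h) - P for a smooth step P that is made steeper and steeper, one
    gets

      JW(0) - JW(-h) = - int_{-h}^0 JN(r) dr.

    At r = 0 the viscous part of JN is nonnegative, and the convective part is
    int (T - s) b . grad_x (B(w)), nonnegative by the divergence condition
    averaged in the same way; so the right-hand side is at most o(h).  On the
    left, convexity of B and a translation in time yield

      JW(0) - JW(-h) >= int ((T - s)_+ - (T - s - h)_+) B(w(x,s)) dx ds
                     >= h kappa,   kappa = int ((T - s) / T) B(w(x,s)) dx ds.

    Hence kappa <= 0, so B(w) = 0 and w = 0 almost everywhere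
    (energy_uniqueness).  The zero initial value of w is present in the values
    0 of w at negative times: psi need not vanish at t = 0. *)

(** * Classes of differentiability *)

Section smooth_calculus.
Context {R : realType}.
Implicit Types V W : normedModType R.

(** Derivatives are existentially quantified functions with [is_derive], so
    that a proof exhibits the derivative in the form that is at hand instead of
    computing iterated directional derivatives. *)
Fixpoint Ck V (k : nat) (f : V -> R) : Prop :=
  match k with
  | 0 => continuous f
  | k'.+1 => continuous f /\
      forall v, exists2 df, (forall x, is_derive x v f (df x)) & Ck k' df
  end.

Lemma Ck_continuous V k (f : V -> R) : Ck k f -> continuous f.
Proof. by case: k => [//|k []]. Qed.

Lemma CkS V k (f : V -> R) : Ck k.+1 f -> Ck k f.
Proof.
elim: k f => [|k IHk] f; first by case.
by case=> cf df; split=> // v; have [g fg /IHk] := df v; exists g.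
Qed.

Lemma smooth_derive V (f : V -> R) v : smooth f -> smooth ('D_v f).
Proof. by move=> sf s /=; have := sf (rcons s v); rewrite foldr_rcons. Qed.

Lemma smoothP V (f : V -> R) : smooth f <-> forall k, Ck k f.
Proof.
split=> [sf k|Cf].
  elim: k f sf => [|k IHk] f sf; first by have [] := sf [::].
  split=> [|v]; first by have [] := sf [::].
  exists ('D_v f); last exact/IHk/smooth_derive.
  by move=> x; apply: derivableP; have [_] := sf [::]; apply.
move=> s; elim/last_ind: s f Cf => [|s v IHs] f Cf.
  split=> [|x v]; first exact: (Cf 0%N).
  by have [_ /(_ v)[df /(_ x)[]]] := Cf 1%N.
rewrite foldr_rcons; apply: IHs => k.
have [_ /(_ v)[df fdf]] := Cf k.+1; congr (Ck k _).
by apply/funext => x; case: (fdf x).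
Qed.

Lemma Ck_cst V k (c : R) : Ck k (fun _ : V => c).
Proof.
elim: k c => [|k IHk] c; first exact: cst_continuous.
split=> [|v]; first exact: cst_continuous.
by exists (fun=> 0) => // x; exact: is_derive_cst.
Qed.

Lemma CkD V k (f g : V -> R) : Ck k f -> Ck k g -> Ck k (fun x => f x + g x).
Proof.
elim: k f g => [|k IHk] f g; first by move=> cf cg x; exact: cvgD (cf x) (cg x).
move=> [cf df] [cg dg]; split=> [x|v]; first exact: cvgD (cf x) (cg x).
have [f' ff' Cf'] := df v; have [g' gg' Cg'] := dg v.
by exists (fun x => f' x + g' x); [move=> x; exact: is_deriveD|exact: IHk].
Qed.

Lemma CkM V k (f g : V -> R) : Ck k f -> Ck k g -> Ck k (fun x => f x * g x).
Proof.
elim: k f g => [|k IHk] f g; first by move=> cf cg x; exact: cvgM (cf x) (cg x).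
move=> Cf Cg; have [cf df] := Cf; have [cg dg] := Cg.
split=> [x|v]; first exact: cvgM (cf x) (cg x).
have [f' ff' Cf'] := df v; have [g' gg' Cg'] := dg v.
exists (fun x => f x * g' x + g x * f' x).
  by move=> x; exact: is_deriveM.
by apply: CkD; apply: IHk => //; exact: CkS.
Qed.

(** A directional derivative only sees one line; this brings the chain rule
    and the coordinate projections down to functions of one variable. *)
Lemma is_derive_lineP V (f : V -> R) x v (d : R) :
  is_derive x v f d <-> is_derive (0 : R) 1 (fun h : R => f (h *: v + x)) d.
Proof.
have E : 'D_v f x = 'D_1 (fun h : R => f (h *: v + x)) 0.
  rewrite /derive; set g1 := fun h => h^-1 *: _; set g2 := fun h => h^-1 *: _.
  suff -> : g1 = g2 by [].
  by apply/funext => h; rewrite /g1 /g2 /= addr0 scale0r add0r [_%:A]mulr1.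
split=> -[fd <-].
  by split; [exact: (derivable1P f x v).1|rewrite E].
by split; [exact: (derivable1P f x v).2|rewrite E].
Qed.

Lemma is_derive_comp1 V (h : R -> R) (f : V -> R) x v a d :
  is_derive (f x) (1 : R) h a -> is_derive x v f d ->
  is_derive x v (fun y => h (f y)) (a * d).
Proof.
move=> ha /is_derive_lineP fd; apply/is_derive_lineP.
apply: (@is_derive1_comp _ h (fun t => f (t *: v + x))) => //.
by rewrite scale0r add0r.
Qed.

Lemma Ck_comp V k (h : R -> R) (f : V -> R) :
  Ck k h -> Ck k f -> Ck k (fun x => h (f x)).
Proof.
elim: k h f => [|k IHk] h f.
  by move=> ch cf x; apply: (@continuous_comp _ _ _ f h) => //; [exact: cf|exact: ch].
move=> Ch Cf; have [ch dh] := Ch; have [cf df] := Cf.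
split=> [x|v].
  by apply: (@continuous_comp _ _ _ f h) => //; [exact: cf|exact: ch].
have [h' hh' Ch'] := dh 1; have [f' ff' Cf'] := df v.
exists (fun x => h' (f x) * f' x); first by move=> x; exact: is_derive_comp1.
by apply: CkM => //; apply: IHk => //; exact: CkS.
Qed.

(** One derivative suffices on the line, where every direction is a multiple
    of 1. *)
Lemma Ck1 k (f f' : R -> R) :
  (forall x : R, is_derive x (1 : R) f (f' x)) -> Ck k f' -> Ck k.+1 f.
Proof.
move=> ff' Cf'; split=> [x|v].
  by apply/differentiable_continuous/derivable1_diffP; case: (ff' x).
exists (fun x => f' x * v); last by apply: CkM => //; exact: Ck_cst.
move=> x; apply/is_derive_lineP.
have -> : f' x * v = f' (0 *: v + x) * v by rewrite scale0r add0r.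
apply: (@is_derive1_comp _ f (fun h => h *: v + x)) => //.
have -> : (fun h : R => h *: v + x) = (fun h => v * h + x).
  by apply/funext => h; rewrite mulrC.
rewrite -[X in is_derive _ _ _ X]addr0; apply: is_deriveD.
by rewrite -[X in is_derive _ _ _ X]mulr1; apply: is_deriveZ.
Qed.

Lemma Ck_id k : Ck k (@id R).
Proof.
case: k => [x|k]; first exact: cvg_id.
by apply: (@Ck1 k _ (fun=> 1)); exact: Ck_cst.
Qed.

Lemma CkV k (f : R -> R) : (forall x, f x != 0) -> Ck k f ->
  Ck k (fun x => (f x)^-1).
Proof.
move=> f0; elim: k => [cf x|k IHk Cf].
  by apply: cvgV => //; exact: cf.
have [_ /(_ 1)[f' ff' Cf']] := Cf.
apply: (@Ck1 _ _ (fun x => - 1 * ((f x)^-1 * (f x)^-1) * f' x)).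
  move=> x; apply: is_derive_eq (is_deriveV (f0 x) (ff' x)) _.
  by rewrite /GRing.scale/= mulN1r expr2 invfM.
have CV : Ck k (fun x => (f x)^-1) by apply: IHk; exact: CkS.
by apply: CkM => //; apply: CkM; [exact: Ck_cst|exact: CkM].
Qed.

Lemma Ck_fst V W k (f : V -> R) : Ck k f -> Ck k (fun z : V * W => f z.1).
Proof.
have cfst (g : V -> R) : continuous g -> continuous (fun z : V * W => g z.1).
  by move=> cg z; apply: (@continuous_comp _ _ _ fst g); [exact: cvg_fst|exact: cg].
elim: k f => [|k IHk] f; first exact: cfst.
move=> [cf df]; split=> [|v]; first exact: cfst.
have [f' ff' /IHk Cf'] := df v.1; exists (fun z => f' z.1) => // x.
by apply/is_derive_lineP; have /is_derive_lineP := ff' x.1.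
Qed.

Lemma Ck_snd V W k (f : W -> R) : Ck k f -> Ck k (fun z : V * W => f z.2).
Proof.
have csnd (g : W -> R) : continuous g -> continuous (fun z : V * W => g z.2).
  by move=> cg z; apply: (@continuous_comp _ _ _ snd g); [exact: cvg_snd|exact: cg].
elim: k f => [|k IHk] f; first exact: csnd.
move=> [cf df]; split=> [|v]; first exact: csnd.
have [f' ff' /IHk Cf'] := df v.2; exists (fun z => f' z.2) => // x.
by apply/is_derive_lineP; have /is_derive_lineP := ff' x.2.
Qed.

End smooth_calculus.

(** * A smooth step *)

Section smooth_step.
Context {R : realType}.
Implicit Types x y d : R.

(** The powers of 1/x in front of exp(-1/x) make the family closed under
    differentiation, which gives smoothness at 0 by induction on the order. *)
Definition expinv (m : nat) (x : R) : R :=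
  if 0 < x then x^-1 ^+ m * expR (- x^-1) else 0.

Lemma expinv0 m x : x <= 0 -> expinv m x = 0.
Proof. by rewrite /expinv ltNge => ->. Qed.

Lemma expinv_ge0 m x : 0 <= expinv m x.
Proof.
rewrite /expinv; case: ifPn => // x0.
by rewrite mulr_ge0 ?expR_ge0// exprn_ge0// invr_ge0 ltW.
Qed.

Lemma expinv_gt0 x : 0 < x -> 0 < expinv 0 x.
Proof. by move=> x0; rewrite /expinv x0 expr0 mul1r expR_gt0. Qed.

(** The exponential series has the term y^(m+2)/(m+2)! at y = 1/x; a quadratic
    bound is what makes the derivative at 0 vanish. *)
Lemma expinv_le m x : expinv m x <= (m.+2)`!%:R * x ^+ 2.
Proof.
rewrite /expinv; case: ifPn => [x0|_]; last by rewrite mulr_ge0// sqr_ge0.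
have y0 : 0 < x^-1 by rewrite invr_gt0.
rewrite expRN ler_pdivrMr ?expR_gt0//.
have fact0 : 0 < (m.+2)`!%:R :> R by rewrite ltr0n fact_gt0.
have := @expR_ge1Dxn R x^-1 m.+1 (ltW y0); set E := expR _ => hE.
have h : x^-1 ^+ m.+2 / (m.+2)`!%:R <= E.
  by apply: le_trans hE; rewrite lerDr.
have -> : x^-1 ^+ m = (m.+2)`!%:R * x ^+ 2 * (x^-1 ^+ m.+2 / (m.+2)`!%:R).
  rewrite -[m.+2]addn2 exprD exprVn; field.
  by rewrite addn2 !gt_eqF ?exprn_gt0.
by rewrite ler_wpM2l// mulr_ge0 ?sqr_ge0// ltW.
Qed.

Lemma is_derive0_quadratic (f : R -> R) (C : R) :
  (forall x, `|f x| <= C * x ^+ 2) -> is_derive (0 : R) (1 : R) f 0.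
Proof.
move=> fC; have f0 : f 0 = 0.
  by apply/normr0_eq0/le_anti; rewrite normr_ge0 (le_trans (fC 0))// expr0n mulr0.
have C0 : 0 <= C by have := fC 1; rewrite expr1n mulr1; apply: le_trans.
have h : h^-1 *: ((f \o shift 0) (h *: (1 : R)) - f 0) @[h --> (0 : R)^'] --> (0 : R).
  apply/cvgr0Pnorm_lt => e e0; near=> h => /=.
  have h0 : h != 0 by near: h; exact: nbhs_dnbhs_neq.
  rewrite addr0 f0 subr0 /GRing.scale/= mulr1 normrM normfV.
  rewrite mulrC ltr_pdivrMr ?normr_gt0//.
  apply: (le_lt_trans (fC h)).
  rewrite -(real_normK (num_real h)) expr2 mulrA ltr_pM2r ?normr_gt0//.
  rewrite (@le_lt_trans _ _ ((C + 1) * `|h|))//.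
    by rewrite ler_wpM2r// lerDl.
  rewrite mulrC -ltr_pdivlMr; last by rewrite ltr_wpDl.
  near: h; apply: dnbhs0_lt; by rewrite divr_gt0// ltr_wpDl.
split; first by apply/cvg_ex; exists 0.
by apply/cvg_lim.
Unshelve. all: by end_near. Qed.

Lemma is_derive_expinv m x : is_derive x (1 : R) (expinv m)
  (expinv m.+2 x - m%:R * expinv m.+1 x).
Proof.
have [x0|x0|->] := ltgtP x 0.
- rewrite !expinv0 ?ltW// mulr0 subr0.
  apply: (@near_eq_is_derive _ _ _ (cst 0)).
  near=> y; rewrite expinv0// ltW//; near: y; exact: lt_nbhsl.
- apply: (@near_eq_is_derive _ _ _ (fun x => x^-1 ^+ m * expR (- x^-1))).
    near=> y; rewrite /expinv ifT//; near: y; exact: lt_nbhsr.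
  rewrite /expinv x0.
  have dV : is_derive x 1 (fun y : R => y^-1) (- x ^- 2).
    apply: is_derive_eq (is_deriveV (lt0r_neq0 x0) (is_derive_id _ _)) _.
    by rewrite /GRing.scale/= mulr1.
  have dX : is_derive x 1 (fun y : R => y^-1 ^+ m) (m%:R * x^-1 ^+ m.-1 * - x ^- 2).
    apply: (@is_derive_comp1 _ _ (fun y => y ^+ m) (fun y : R => y^-1)) => //.
    by split; [exact: exprn_derivable|rewrite exp_derive /GRing.scale/= mulr1].
  have dE : is_derive x 1 (fun y : R => expR (- y^-1)) (expR (- x^-1) * x ^- 2).
    apply: (@is_derive_comp1 _ _ expR (fun y : R => - y^-1)) => //.
    by rewrite -[X in is_derive _ _ _ X]opprK; apply: is_deriveN.
  apply: is_derive_eq (is_deriveM dX dE) _; rewrite /GRing.scale/=.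
  rewrite -exprVn; set y := x^-1; set E := expR _.
  by case: m {dX} => [|m] /=; rewrite ?expr0 ?exprS; ring.
- rewrite !expinv0// mulr0 subr0.
  apply: (@is_derive0_quadratic _ ((m.+2)`!%:R)) => y.
  by rewrite ger0_norm ?expinv_ge0// expinv_le.
Unshelve. all: by end_near. Qed.

Lemma Ck_expinv k m : Ck k (expinv m).
Proof.
elim: k m => [|k IHk] m.
  move=> x; apply/differentiable_continuous/derivable1_diffP.
  by case: (is_derive_expinv m x).
apply: (Ck1 (is_derive_expinv m)); apply: CkD => //.
under eq_fun do rewrite -mulNr; apply: CkM => //; exact: Ck_cst.
Qed.

(** The step is the quotient of exp(-1/(d+x)) by exp(-1/(d+x)) + exp(1/x),
    where each exponential is continued by 0 beyond its singularity: they never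
    vanish together. *)
Lemma smooth_step d : 0 < d -> exists P P' : R -> R,
  [/\ forall k, Ck k P', forall x, is_derive x (1 : R) P (P' x),
      forall x, [/\ 0 <= P' x, 0 <= P x & P x <= 1],
      forall x, x <= - d -> P x = 0 /\ P' x = 0 &
      forall x, 0 <= x -> P x = 1 /\ P' x = 0].
Proof.
move=> d0.
pose D x := expinv 0 (d + x) + expinv 0 (- x).
have D0 x : 0 < D x.
  have [x0|x0] := ltP x 0.
    by rewrite ltr_wpDl ?expinv_ge0// expinv_gt0// oppr_gt0.
  by rewrite ltr_wpDr ?expinv_ge0// expinv_gt0// ltr_wpDr.
(* The numerator u' v - u v' of the derivative of u / (u + v). *)
pose N x := expinv 2 (d + x) * expinv 0 (- x) + expinv 0 (d + x) * expinv 2 (- x).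
exists (fun x => expinv 0 (d + x) / D x), (fun x => N x * ((D x)^-1 * (D x)^-1)).
have Cl k m : Ck k (fun x => expinv m (d + x)).
  apply: (@Ck_comp _ _ _ (expinv m) (fun x => d + x)); first exact: Ck_expinv.
  by apply: CkD; [exact: Ck_cst|exact: Ck_id].
have Cr k m : Ck k (fun x => expinv m (- x)).
  apply: (@Ck_comp _ _ _ (expinv m) (fun x => - x)); first exact: Ck_expinv.
  under eq_fun do rewrite -mulN1r.
  by apply: CkM; [exact: Ck_cst|exact: Ck_id].
have dl m x : is_derive x (1 : R) (fun x => expinv m (d + x))
    (expinv m.+2 (d + x) - m%:R * expinv m.+1 (d + x)).
  rewrite -[X in is_derive _ _ _ X]mulr1.
  apply: (@is_derive_comp1 _ _ (expinv m) (fun x => d + x)).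
    exact: is_derive_expinv.
  rewrite -[X in is_derive _ _ _ X]add0r; exact: is_deriveD.
have dr m x : is_derive x (1 : R) (fun x => expinv m (- x))
    (- (expinv m.+2 (- x) - m%:R * expinv m.+1 (- x))).
  rewrite -[X in is_derive _ _ _ X]mulrN1.
  apply: (@is_derive_comp1 _ _ (expinv m) (fun x => - x)).
    exact: is_derive_expinv.
split.
- move=> k; apply: CkM; first by apply: CkD; exact: CkM.
  have : Ck k (fun x => (D x)^-1).
    by apply: CkV => [x|]; [rewrite gt_eqF|exact: CkD].
  by move=> ?; exact: CkM.
- move=> x.
  have dD := is_deriveD (dl 0%N x) (dr 0%N x).
  have dV := is_deriveV (lt0r_neq0 (D0 x)) dD.
  apply: is_derive_eq (is_deriveM (dl 0%N x) dV) _.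
  rewrite /GRing.scale/= !mul0r !subr0 /N.
  have := lt0r_neq0 (D0 x); rewrite /D => Dn0; field; exact: Dn0.
- move=> x; split.
  + rewrite mulr_ge0// ?mulr_ge0 ?invr_ge0 ?(ltW (D0 x))//.
    by rewrite /N addr_ge0// mulr_ge0// expinv_ge0.
  + by rewrite divr_ge0// ?expinv_ge0// ltW.
  + by rewrite ler_pdivrMr// mul1r lerDl expinv_ge0.
- move=> x xd; have dx0 : d + x <= 0 by rewrite addrC -lerBrDr sub0r.
  by rewrite /N !(expinv0 _ dx0) !mul0r addr0 mul0r.
- move=> x x0; have nx0 : - x <= 0 by rewrite oppr_le0.
  rewrite /N !(expinv0 _ nx0) !mulr0 addr0 mul0r; split=> //.
  by have := lt0r_neq0 (D0 x); rewrite /D (expinv0 _ nx0) addr0 => /divff.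
Qed.

End smooth_step.

(** * A smooth convex function with bounded derivative *)

(** The function softabs is convex, vanishes only at 0, and has the bounded
    derivative softsgn.  Boundedness is the point: the product of b, the
    gradient and softsgn of a solution is integrable, whereas it need not be
    when softsgn is replaced by the identity, as b is only square integrable. *)

Section softabs.
Context {R : realType}.
Implicit Types s t : R.

Definition japan s : R := Num.sqrt (1 + s ^+ 2).
Definition softabs s : R := japan s - 1.
Definition softsgn s : R := s / japan s.
Definition softsgn' s : R := (japan s)^-1 ^+ 3.

Let arg_gt0 s : 0 < 1 + s ^+ 2.
Proof. by rewrite ltr_wpDr ?sqr_ge0. Qed.

Lemma japan_gt0 s : 0 < japan s.
Proof. by rewrite sqrtr_gt0. Qed.

Lemma japan_sqr s : japan s ^+ 2 = 1 + s ^+ 2.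
Proof. by rewrite sqr_sqrtr// ltW. Qed.

Let japan_neq0 s : japan s != 0.
Proof. exact/lt0r_neq0/japan_gt0. Qed.

Lemma japan_ge1 s : 1 <= japan s.
Proof. by rewrite -[leLHS]sqrtr1 ler_wsqrtr// lerDl sqr_ge0. Qed.

Lemma is_derive_japan s : is_derive s (1 : R) japan (softsgn s).
Proof.
have d1 : is_derive s (1 : R) (fun s : R => 1 + s ^+ 2) (s *+ 2).
  rewrite -[X in is_derive _ _ _ X]add0r; apply: is_deriveD.
  split; [exact: exprn_derivable|].
  by rewrite exp_derive /GRing.scale/= expr1 mulr1 mulr_natl.
have := @is_derive_comp1 _ _ Num.sqrt (fun s => 1 + s ^+ 2) s _ _ _
  (is_derive1_sqrt (arg_gt0 s)) d1.
rewrite -/(japan s) => /is_derive_eq; apply.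
by rewrite /softsgn -mulr_natl; have := japan_neq0 s; move: (japan s) => j j0; field.
Qed.

Lemma is_derive_softabs s : is_derive s (1 : R) softabs (softsgn s).
Proof.
rewrite -[X in is_derive _ _ _ X]addr0; apply: is_deriveD.
exact: is_derive_japan.
Qed.

Lemma is_derive_softsgn s : is_derive s (1 : R) softsgn (softsgn' s).
Proof.
have dV := is_deriveV (japan_neq0 s) (is_derive_japan s).
apply: is_derive_eq (is_deriveM (is_derive_id s 1) dV) _.
rewrite /GRing.scale/= mulr1 /softsgn' /softsgn exprVn.
apply: (mulIf (expf_neq0 3 (japan_neq0 s))); rewrite mulVf ?expf_neq0//.
transitivity (japan s ^+ 2 - s ^+ 2); last by rewrite japan_sqr addrK.
by have := japan_neq0 s; move: (japan s) => j j0; field.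
Qed.

Lemma Ck_japan k : Ck k japan.
Proof.
elim: k => [|k IHk].
  move=> x; apply/differentiable_continuous/derivable1_diffP.
  by case: (is_derive_japan x).
apply: (Ck1 is_derive_japan); apply: CkM; first exact: Ck_id.
by apply: CkV => // x; exact: japan_neq0.
Qed.

Lemma Ck_softabs k : Ck k softabs.
Proof. by apply: CkD; [exact: Ck_japan|exact: Ck_cst]. Qed.

Lemma Ck_softsgn k : Ck k softsgn.
Proof.
apply: CkM; first exact: Ck_id.
by apply: CkV; [move=> x; exact: japan_neq0|exact: Ck_japan].
Qed.

Lemma Ck_softsgn' k : Ck k softsgn'.
Proof.
have CV : Ck k (fun s => (japan s)^-1).
  by apply: CkV; [move=> x; exact: japan_neq0|exact: Ck_japan].
rewrite /softsgn'; under eq_fun do rewrite exprS expr2.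
by apply: CkM => //; exact: CkM.
Qed.

Lemma softabs0 : softabs 0 = 0.
Proof. by rewrite /softabs /japan expr0n addr0 sqrtr1 subrr. Qed.

Lemma softsgn0 : softsgn 0 = 0.
Proof. by rewrite /softsgn mul0r. Qed.

Lemma softabs_ge0 s : 0 <= softabs s.
Proof. by rewrite subr_ge0 japan_ge1. Qed.

Lemma softabs_eq0 s : softabs s = 0 -> s = 0.
Proof.
move/eqP; rewrite subr_eq0 => /eqP js; have := japan_sqr s.
by rewrite js expr1n => /esym/eqP; rewrite eq_sym addrC -subr_eq subrr eq_sym sqrf_eq0 => /eqP.
Qed.

Lemma softabs_le s : softabs s <= s ^+ 2.
Proof.
rewrite /softabs lerBlDl -japan_sqr expr2 -[leLHS]mulr1.
by rewrite ler_wpM2l ?japan_ge1// ltW// japan_gt0.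
Qed.

Lemma softsgn_le1 s : `|softsgn s| <= 1.
Proof.
rewrite /softsgn normrM normfV (gtr0_norm (japan_gt0 s)) ler_pdivrMr ?japan_gt0//.
by rewrite mul1r -(sqrtr_sqr s) ler_wsqrtr// lerDr.
Qed.

Lemma softsgn'_ge0 s : 0 <= softsgn' s.
Proof. by rewrite exprn_ge0// invr_ge0 ltW// japan_gt0. Qed.

Lemma softsgn'_le1 s : softsgn' s <= 1.
Proof.
by rewrite exprn_ile1 ?invr_ge0 ?invf_le1 ?japan_gt0 ?japan_ge1// ltW// japan_gt0.
Qed.

(** The graph lies above its tangents; here this is the Cauchy-Schwarz
    inequality for (1, s) and (1, t). *)
Lemma softabs_convex s t : softabs s - softabs t <= softsgn s * (s - t).
Proof.
have CS : 1 + s * t <= japan s * japan t.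
  rewrite /japan -sqrtrM ?(ltW (arg_gt0 s))//.
  apply: le_trans (ler_norm _) _; rewrite -sqrtr_sqr ler_wsqrtr//.
  by have := sqr_ge0 (s - t); nra.
rewrite /softsgn mulrAC ler_pdivlMr ?japan_gt0// /softabs.
have -> : (japan s - 1 - (japan t - 1)) * japan s = japan s ^+ 2 - japan s * japan t.
  by ring.
by rewrite japan_sqr; lra.
Qed.

End softabs.

(** * Measure-preserving maps and shears of space-time *)

Section measure_preserving.
Context {d} {T : measurableType d} {R : realType}.
Variable mu : {measure set T -> \bar R}.
Local Open Scope ereal_scope.

Definition measure_preserving (phi : T -> T) : Prop :=
  measurable_fun [set: T] phi /\
  forall A, measurable A -> mu (phi @^-1` A) = mu A.

Lemma ge0_integral_preserved (phi : T -> T) (f : T -> \bar R) :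
  measure_preserving phi -> measurable_fun [set: T] f -> (forall x, 0 <= f x) ->
  \int[mu]_x f (phi x) = \int[mu]_x f x.
Proof.
move=> [mphi pphi] mf f0.
rewrite -[LHS]/(\int[mu]_(x in phi @^-1` setT) (f \o phi) x).
rewrite -(@ge0_integral_pushforward _ _ _ _ _ _ mphi mu _ _ measurableT mf)//.
by apply: eq_measure_integral => A mA _; exact: pphi.
Qed.

Lemma integrable_preserved (phi : T -> T) (f : T -> \bar R) :
  measure_preserving phi -> mu.-integrable [set: T] f ->
  mu.-integrable [set: T] (f \o phi).
Proof.
move=> pphi /integrableP[mf foo]; apply/integrableP; split.
  exact: measurableT_comp pphi.1.
rewrite (ge0_integral_preserved (f := abse \o f) pphi)//.
exact: measurableT_comp.
by move=> x; exact: abse_ge0.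
Qed.

Lemma integral_preserved (phi : T -> T) (f : T -> \bar R) :
  measure_preserving phi -> mu.-integrable [set: T] f ->
  \int[mu]_x f (phi x) = \int[mu]_x f x.
Proof.
move=> pphi intf; have intfp := integrable_preserved pphi intf.
have [mphi _] := pphi; have mf := measurable_int _ intf.
rewrite -[LHS]/(\int[mu]_(x in phi @^-1` setT) (f \o phi) x).
rewrite -(@integral_pushforward _ _ _ _ _ _ mphi mu _ _ mf intfp)//.
by apply: eq_measure_integral => A mA _; exact: pphi.2.
Qed.

(** The criterion through integrals lets Fubini's theorem prove that a map of
    a product preserves the measure. *)
Lemma preserving_of_integral (phi : T -> T) : measurable_fun [set: T] phi ->
  (forall f : T -> \bar R, measurable_fun [set: T] f -> (forall x, 0 <= f x) ->
    \int[mu]_x f (phi x) = \int[mu]_x f x) ->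
  measure_preserving phi.
Proof.
move=> mphi H; split=> // A mA.
have mphiA : measurable (phi @^-1` A) by rewrite -[X in measurable X]setTI; exact: mphi.
have <- : \int[mu]_x (\1_A x)%:E = mu A by rewrite integral_indic// setIT.
have <- : \int[mu]_x (\1_(phi @^-1` A) x)%:E = mu (phi @^-1` A).
  by rewrite integral_indic// setIT.
apply: (H (fun x => (\1_A x)%:E)).
  by apply/measurable_EFinP; exact: measurable_indic.
by move=> x; rewrite lee_fin.
Qed.

End measure_preserving.

Section time_shift.
Context {R : realType}.
Local Notation leb := (@lebesgue_measure R).
Local Notation RR := (measurableTypeR R).

Lemma lebesgue_shift_preserving (c : R) :
  measure_preserving leb (fun t : RR => (t + c : RR)).
Proof.
have mshift : measurable_fun [set: RR] (fun t : RR => (t + c : RR)).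
  by apply: measurable_funD.
split=> // A mA.
rewrite -[LHS]/(pushforward leb (fun t : RR => (t + c : RR)) A).
apply/esym; apply: (lebesgue_measure_unique _ mA).
move=> I /ocitvP[->|[[a b] /= ab ->]]; first by rewrite !measure0.
rewrite [RHS]/= /pushforward.
have -> : (fun t : R => t + c) @^-1` `]a, b]%classic = `](a - c), (b - c)]%classic.
  by apply/seteqP; split=> t /=; rewrite !in_itv/= ltrBlDr lerBrDr.
rewrite !lebesgue_measure_itv/= !lte_fin ab ltrD2r ab.
by rewrite -!EFinB; congr EFin; ring.
Qed.

End time_shift.

Section product_shift.
Context {d} {X : measurableType d} {R : realType}.
Variable mu : {sigma_finite_measure set X -> \bar R}.
Local Notation leb := (@lebesgue_measure R).
Local Notation RR := (measurableTypeR R).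
Local Open Scope ereal_scope.

(** A name for the product measure, to which sigma-finiteness is attached, so
    that it can itself be a factor of a product with a third variable. *)
Definition spacetime : set (X * RR)%type -> \bar R := mu \x leb.

HB.instance Definition _ := Measure.on spacetime.

Let spacetime_sigma_finite : sigma_finite setT spacetime.
Proof.
have [F FT mF] := sigma_finiteT mu.
have [G GT mG] := sigma_finiteT (leb : {sigma_finite_measure set RR -> \bar R}).
pose ij k : nat * nat := odflt (0%N, 0%N) (unpickle k).
exists (fun k => F (ij k).1 `*` G (ij k).2).
  apply/seteqP; split=> // -[x t] _.
  have [i _ Fi] : (\bigcup_k F k) x by rewrite -FT.
  have [j _ Gj] : (\bigcup_k G k) t by rewrite -GT.
  by exists (pickle (i, j)) => //; rewrite /ij pickleK.
move=> k; have [mFk Fk] := mF (ij k).1; have [mGk Gk] := mG (ij k).2.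
split; first exact: measurableX.
by rewrite /spacetime product_measure1E// lte_mul_pinfty// ge0_fin_numE.
Qed.

HB.instance Definition _ := Measure_isSigmaFinite.Build _ _ _ spacetime
  spacetime_sigma_finite.

Local Notation m := spacetime.

Definition tshift (c : R) (z : X * RR) : X * RR := (z.1, (z.2 + c)%R).

(** A triple (x, s, r) of a point, a time and a lag goes to (x, s + r, s): a
    point with two times.  Integrating over a pair of times is integrating
    over one time and a lag. *)
Definition tshear (w : (X * RR) * RR) : (X * RR) * RR :=
  ((w.1.1, (w.1.2 + w.2)%R), w.1.2).

Lemma tshift_preserving (c : R) : measure_preserving m (tshift c).
Proof.
have mshift : measurable_fun [set: X * RR] (tshift c).
  apply/measurable_fun_pair; first exact: measurable_fst.
  by apply: measurable_funD => //; exact: measurable_snd.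
apply: preserving_of_integral => // f mf f0.
have mfs : measurable_fun setT (f \o tshift c) by exact: measurableT_comp.
rewrite (fubini_tonelli1 _ mfs (fun z => f0 _)).
rewrite (fubini_tonelli1 _ mf f0); apply: eq_integral => x _.
rewrite /fubini_F.
rewrite -(ge0_integral_preserved (f := fun t => f (x, t)) (lebesgue_shift_preserving c))//.
exact: measurableT_comp.
Qed.

(** For fixed s the map translates the lag by s; the rest is an exchange of the
    two time variables. *)
Lemma tshear_preserving : measure_preserving (m \x leb) tshear.
Proof.
have mshear : measurable_fun [set: (X * RR) * RR] tshear.
  have m1 : measurable_fun [set: (X * RR) * RR] (fun w => w.1.1 : X).
    by apply: (measurableT_comp measurable_fst); exact: measurable_fst.
  have m2 : measurable_fun [set: (X * RR) * RR] (fun w => w.1.2 : RR).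
    by apply: (measurableT_comp measurable_snd); exact: measurable_fst.
  apply/measurable_fun_pair => //; apply/measurable_fun_pair => //.
  by apply: measurable_funD => //; exact: measurable_snd.
apply: preserving_of_integral => // f mf f0.
have mfs : measurable_fun setT (f \o tshear) by exact: measurableT_comp.
rewrite (fubini_tonelli1 _ mfs (fun z => f0 _)).
pose g (z : X * RR) := \int[leb]_t f ((z.1, t), z.2).
transitivity (\int[m]_z g z).
  apply: eq_integral => -[x s] _; rewrite /fubini_F/= /g /tshear/=.
  rewrite -(ge0_integral_preserved (f := fun t => f ((x, t), s)) (lebesgue_shift_preserving s))//.
    by apply: eq_integral => t _; rewrite addrC.
  apply: (measurableT_comp mf); apply/measurable_fun_pair => //.
pose h (w : (X * RR) * RR) := f ((w.1.1, w.2), w.1.2).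
have mh : measurable_fun setT h.
  apply: (measurableT_comp mf).
  have m1 : measurable_fun [set: (X * RR) * RR] (fun w => w.1.1 : X).
    by apply: (measurableT_comp measurable_fst); exact: measurable_fst.
  have m2 : measurable_fun [set: (X * RR) * RR] (fun w => w.1.2 : RR).
    by apply: (measurableT_comp measurable_snd); exact: measurable_fst.
  apply/measurable_fun_pair; last exact: m2.
  by apply/measurable_fun_pair; [exact: m1|exact: measurable_snd].
have h0 w : 0 <= h w by exact: f0.
have mg : measurable_fun setT g by exact: (measurable_fun_fubini_tonelli_F h).
have g0 z : 0 <= g z by apply: integral_ge0 => t _; exact: f0.
have mF : measurable_fun setT (fubini_F leb f).
  exact: measurable_fun_fubini_tonelli_F.
have F0 z : 0 <= fubini_F leb f z by apply: integral_ge0 => t _; exact: f0.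
rewrite (fubini_tonelli1 _ mf f0).
rewrite (fubini_tonelli1 _ mg g0) (fubini_tonelli1 _ mF F0).
apply: eq_integral => x _; rewrite /fubini_F /g /=.
rewrite (fubini_tonelli (fun st : RR * RR => f ((x, st.2), st.1)))//.
apply: (measurableT_comp mf); apply/measurable_fun_pair; last exact: measurable_fst.
by apply/measurable_fun_pair => //; exact: measurable_snd.
Qed.

End product_shift.

Section real_fubini.
Context {d1 d2} {T1 : measurableType d1} {T2 : measurableType d2} {R : realType}.
Variables (m1 : {sigma_finite_measure set T1 -> \bar R}).
Variables (m2 : {sigma_finite_measure set T2 -> \bar R}).

(** Sections are integrable only almost everywhere; there the real-valued inner
    integral agrees with the extended one. *)
Lemma Rintegral_fubini2 (f : T1 * T2 -> R) :
  (m1 \x m2)%E.-integrable setT (EFin \o f) ->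
  m2.-integrable setT (EFin \o (fun y => \int[m1]_x f (x, y))) /\
  \int[(m1 \x m2)%E]_z f z = \int[m2]_y (\int[m1]_x f (x, y)).
Proof.
move=> intf.
have mf := measurable_int _ intf; have mG := measurable_fubini_G intf.
have intG : m2.-integrable setT (fubini_G m1 (EFin \o f)).
  apply/integrableP; split => //.
  apply: le_lt_trans ((integrable21ltyP _ _ mf).1 intf).
  apply: ge0_le_integral => //; first exact: measurableT_comp.
    apply: (measurable_fun_fubini_tonelli_G (abse \o (EFin \o f))).
      exact: measurableT_comp.
    by move=> z; exact: abse_ge0.
  by move=> y _; apply: le_abse_integral => //; exact: measurableT_comp.
have mR : measurable_fun setT (EFin \o (fun y => \int[m1]_x f (x, y))).
  by apply/measurable_EFinP; exact: (measurableT_comp (@fine_measurable R setT measurableT) mG).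
have intR : m2.-integrable setT (EFin \o (fun y => \int[m1]_x f (x, y))).
  apply: le_integrable intG => // y _ /=.
  rewrite /Rintegral /fubini_G/=.
  by case: (integral _ _ _) => [r||] //=; rewrite ?normr0 ?leey.
split=> //; rewrite /Rintegral -(integral21_prod_meas1 intf); congr fine.
apply: ae_eq_integral => //.
apply: filterS (ae_integrable2 intf) => y iy _ /=.
rewrite /fubini_G/= /Rintegral fineK//.
exact: integrable_fin_num.
Qed.

End real_fubini.

Section shear_fubini.
Context {d} {X : measurableType d} {R : realType}.
Variable mu : {sigma_finite_measure set X -> \bar R}.
Local Notation leb := (@lebesgue_measure R).
Local Notation RR := (measurableTypeR R).
Local Notation m := (spacetime mu).

Lemma Rintegral_tshear (K : (X * RR) * RR -> R) :
  (m \x leb)%E.-integrable setT (EFin \o K) ->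
  [/\ leb.-integrable setT (EFin \o (fun r : RR => \int[m]_z K (tshear (z, r)))),
      leb.-integrable setT (EFin \o (fun s : RR => \int[m]_z K (z, s))) &
      \int[leb]_r (\int[m]_z K (tshear (z, r))) =
      \int[leb]_s (\int[m]_z K (z, s))].
Proof.
move=> iK; have pK := @tshear_preserving _ _ _ mu.
have iKs := integrable_preserved pK iK.
have [i1 e1] := Rintegral_fubini2 iK; have [i2 e2] := Rintegral_fubini2 iKs.
have E := congr1 fine (integral_preserved pK iK).
by split; [exact: i2|exact: i1|exact: etrans (esym e2) (etrans E e1)].
Qed.

End shear_fubini.

(** * Continuity of translations in the mean *)

Section translation_continuity.
Context {R : realType}.
Local Notation leb := (@lebesgue_measure R).
Local Notation RR := (measurableTypeR R).
Implicit Types (u : nat -> R).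

Lemma ge0_cvge0P (I : nat -> \bar R) : (forall n, 0 <= I n)%E ->
  I @ \oo --> 0%E <-> forall e : R, 0 < e -> \forall n \near \oo, (I n <= e%:E)%E.
Proof.
move=> I0; split=> [/fine_cvgP[If /cvgrPdist_le cI] e e0|H].
  have := cI _ e0; apply: filterS2 If => n fI /=.
  by rewrite sub0r normrN ger0_norm ?fine_ge0// -lee_fin fineK.
apply/fine_cvgP; split.
  apply: filterS (H _ ltr01) => n I1.
  by rewrite ge0_fin_numE// (le_lt_trans I1)// ltry.
apply/cvgrPdist_le => e e0; apply: filterS (H _ e0) => n Ie.
rewrite sub0r normrN ger0_norm ?fine_ge0// -lee_fin fineK//.
by rewrite ge0_fin_numE// (le_lt_trans Ie)// ltry.
Qed.

Lemma measurable_shift (f : RR -> R) (c : R) : measurable_fun [set: RR] f ->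
  measurable_fun [set: RR] (fun t : RR => f (t + c)).
Proof. by move=> mf; apply: (measurableT_comp mf); exact: measurable_funD. Qed.

(** For a continuous function cut off outside [a, b] the translates converge
    pointwise except at the two ends, and the dominated convergence theorem
    applies. *)
Lemma cvg_shift_L1_cut (g : R -> R) (a b : R) u : continuous g ->
  u @ \oo --> (0 : R) ->
  let h : RR -> R := g \_ `[a, b] in
  (\int[leb]_t `|h (t + u n)%R - h t|%:E)%E @[n --> \oo] --> 0%E.
Proof.
move=> cg u0 h.
have mg : measurable_fun [set: RR] (g : RR -> R) by exact: continuous_measurable_fun.
have mh : measurable_fun [set: RR] h.
  by apply/(measurable_restrictT _ _).1 => //; exact: measurable_funTS.
have [M gM] : exists M : R, forall t, `|h t| <= M.
  have [ab|ba] := leP a b; last first.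
    by exists 0 => t; rewrite /h set_itv_ge ?bnd_simp -?ltNge// patch_set0 normr0.
  have cng : continuous (fun x => `|g x|).
    by move=> x; apply: cvg_norm; exact: cg.
  have [c _ cM] := EVT_max ab (continuous_subspaceT cng).
  exists `|g c| => t; rewrite /h patchE; case: ifPn => [|_]; last by rewrite normr0.
  by rewrite inE/= => /cM.
have [K uK] : exists K : R, forall n, `|u n| <= K.
  have cu : cvgn u by apply/cvg_ex; exists 0.
  have /ex_bound[|K uK] := cvg_seq_bounded cu.
    exact: (@globally_properfilter _ _ 0%N).
  by exists K => n; exact: uK.
pose dom (t : RR) : R := (2 * M) * \1_(`[a - K, b + K]%classic : set R) t.
have hout t : h t != 0 -> a <= t <= b.
  by rewrite /h patchE; case: ifPn => [|_]; rewrite ?eqxx// inE/= in_itv.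
have M0 : 0 <= M by apply: le_trans (gM 0).
have tu t : t + u n @[n --> \oo] --> t.
  by rewrite -[X in _ --> X]addr0; apply: cvgD => //; exact: cvg_cst.
have hc t : t != a -> t != b -> h (t + u n) @[n --> \oo] --> h t.
  move=> ta tb; have [/andP[at_ bt]|tab] := boolP (a < t < b).
    have hE s : a < s -> s < b -> h s = g s.
      by move=> as_ sb; rewrite /h patchE ifT// inE/= in_itv/= !ltW.
    rewrite hE//; apply: (@cvg_trans _ (g (t + u n) @[n --> \oo])).
      apply: near_eq_cvg; near=> n; rewrite hE//; near: n.
        exact: cvgr_gt _ (tu t) _ at_.
      exact: cvgr_lt _ (tu t) _ bt.
    by apply: continuous_cvg => //; exact: cg.
  have h0 s : (s < a) || (b < s) -> h s = 0.
    move=> sab; rewrite /h patchE ifF//; apply/negP; rewrite inE/= in_itv/=.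
    by move=> /andP[as_ sb]; move: sab; rewrite !ltNge as_ sb.
  have : (t < a) || (b < t).
    by move: tab; rewrite negb_and -!leNgt !le_eqVlt (negPf ta) eq_sym (negPf tb).
  move=> tab'; rewrite h0//; apply: (@cvg_trans _ (0 @[n --> \oo])); last exact: cvg_cst.
  apply: near_eq_cvg; near=> n; rewrite h0//; near: n.
  case/orP: tab' => [ta'|bt'].
    by apply: filterS (cvgr_lt _ (tu t) _ ta') => n ->.
  by apply: filterS (cvgr_gt _ (tu t) _ bt') => n ->; rewrite orbT.
have mD n : measurable_fun setT (fun t : RR => `|h (t + u n) - h t|%:E).
  apply/measurable_EFinP; apply: measurableT_comp => //.
  by apply: measurable_funB => //; exact: measurable_shift.
have intdom : leb.-integrable setT (EFin \o dom).
  exact: (integrableZl measurableT _ (integrable_indic_itv _ _ true false)).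
have [|||||_ _] := @dominated_convergence _ _ _ leb setT measurableT
  (fun n t => `|h (t + u n)%R - h t|%:E) (cst 0%E) (EFin \o dom).
- exact: mD.
- by [].
- exists [set a; b]; split; first by apply: measurableU; exact: measurable_set1.
    have n1 (c : R) : leb [set c] = 0%E by exact: lebesgue_measure_set1.
    by apply: null_set_setU; [exact: measurable_set1|exact: measurable_set1|exact: n1|exact: n1].
  move=> t /= nt; apply: contrapT => /not_orP[/eqP ta /eqP tb]; apply: nt => _.
  apply: cvg_EFin; first exact: nearW.
  rewrite -[X in _ --> X](normr0 R) -[X in `|X|](subrr (h t)).
  by apply: cvg_norm; apply: cvgB; [exact: hc|exact: cvg_cst].
- exact: intdom.
- apply: aeW => t n _ /=; rewrite lee_fin normr_id /dom indicE.
  have tn := uK n; have K0 : 0 <= K := le_trans (normr_ge0 _) tn.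
  case: (boolP (t \in _)) => /= [_|].
    rewrite mulr1 (le_trans (ler_normB _ _))// mulr_natl mulr2n lerD//.
  rewrite mulr0 normr_le0 notin_setE/= in_itv/= => /negP tout.
  have h0 s : ~~ (a <= s <= b) -> h s = 0.
    by move=> sab; apply/eqP/negPn/negP => /hout; exact/negP.
  move: tn; rewrite ler_norml => /andP[un1 un2].
  rewrite !h0 ?subrr//; apply: contraNN tout => /andP[t1 t2];
    apply/andP; split; lra.
by move=> /=; rewrite integral0.
Unshelve. all: by end_near. Qed.

(** Continuous functions are dense in L1([a, b]), and translation is an
    isometry: this reduces the claim to the previous case. *)
Lemma cvg_shift_L1 (f : RR -> R) (a b : R) u :
  leb.-integrable setT (EFin \o f) -> (forall t, ~~ (a <= t <= b) -> f t = 0) ->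
  u @ \oo --> (0 : R) ->
  (\int[leb]_t `|f (t + u n)%R - f t|%:E)%E @[n --> \oo] --> 0%E.
Proof.
move=> intf f0 u0; apply/ge0_cvge0P; first by move=> n; apply: integral_ge0.
move=> e e0; pose e4 := e / 4; have e40 : 0 < e4 by rewrite divr_gt0.
have mE : measurable (`[a, b]%classic : set RR) by exact: measurable_itv.
have [|||gs [cg ig /ge0_cvge0P gf]] := @approximation_continuous_integrable R `[a, b]%classic f.
- exact: mE.
- have : (leb `[a, b]%classic < +oo)%E by rewrite lebesgue_measure_itv/=; case: ifP => _; rewrite ltry.
  by [].
- exact: integrableS intf.
have [k _ /(_ _ (leqnn k)) gfk] := gf (fun n => integral_ge0 _ (fun _ _ => abse_ge0 _)) e4 e40.
pose h : RR -> R := gs k \_ `[a, b].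
have mf : measurable_fun [set: RR] f by apply/measurable_EFinP; exact: measurable_int intf.
have mh : measurable_fun [set: RR] h.
  apply/(measurable_restrictT _ _).1 => //; apply: measurable_funTS.
  exact: continuous_measurable_fun.
have hf : (\int[leb]_t `|f t - h t|%:E <= e4%:E)%E.
  apply: le_trans gfk; rewrite [leRHS]integral_mkcond le_eqVlt; apply/orP; left.
  apply/eqP; apply: eq_integral => t _; rewrite /h !patchE.
  case: ifPn => //; rewrite notin_setE/= in_itv/= => /negP tab.
  by rewrite f0// subrr normr0.
have cut : (\int[leb]_t `|h (t + u n)%R - h t|%:E)%E @[n --> \oo] --> 0%E.
  exact: cvg_shift_L1_cut.
have [|N _ hN] := (ge0_cvge0P _).1 cut _ e40; first by move=> n; exact: integral_ge0.
exists N => // n Nn; have hun := hN n Nn.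
have hfu : (\int[leb]_t `|f (t + u n)%R - h (t + u n)%R|%:E <= e4%:E)%E.
  apply: le_trans hf.
  rewrite (ge0_integral_preserved (f := fun t : RR => `|f t - h t|%:E) (lebesgue_shift_preserving (u n)))//.
  by apply/measurable_EFinP; apply: measurableT_comp => //; exact: measurable_funB.
have mfu := measurable_shift (u n) mf; have mhu := measurable_shift (u n) mh.
pose A (t : RR) := `|f (t + u n) - h (t + u n)|%:E.
pose B (t : RR) := `|h (t + u n) - h t|%:E.
pose C (t : RR) := `|f t - h t|%:E.
have mA : measurable_fun setT A.
  by apply/measurable_EFinP; apply: measurableT_comp => //; exact: measurable_funB.
have mB : measurable_fun setT B.
  by apply/measurable_EFinP; apply: measurableT_comp => //; exact: measurable_funB.
have mC : measurable_fun setT C.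
  by apply/measurable_EFinP; apply: measurableT_comp => //; exact: measurable_funB.
apply: (@le_trans _ _ (\int[leb]_t (A t + B t + C t)%E)%E).
  apply: ge0_le_integral => //.
  - by apply/measurable_EFinP; apply: measurableT_comp => //; exact: measurable_funB.
  - by do 2 apply: emeasurable_funD => //.
  - move=> t _; rewrite /A /B /C -!EFinD lee_fin.
    rewrite [`|f t - h t|]distrC.
    have -> : f (t + u n) - f t = (f (t + u n) - h (t + u n)) + (h (t + u n) - h t)
       + (h t - f t) by ring.
    by rewrite (le_trans (ler_normD _ _))// lerD2r ler_normD.
have A0 t : (0 <= A t)%E by rewrite lee_fin.
have B0 t : (0 <= B t)%E by rewrite lee_fin.
have C0 t : (0 <= C t)%E by rewrite lee_fin.
rewrite (ge0_integralD _ measurableT (fun t _ => adde_ge0 (A0 t) (B0 t))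
  (emeasurable_funD mA mB) (fun t _ => C0 t) mC).
rewrite (ge0_integralD _ measurableT (fun t _ => A0 t) mA (fun t _ => B0 t) mB).
apply: (@le_trans _ _ (e4%:E + e4%:E + e4%:E)%E); first by rewrite !leeD.
by rewrite -!EFinD lee_fin /e4; lra.
Qed.

End translation_continuity.

(** * Correlations in time *)

Section time_correlation.
Context {d} {X : measurableType d} {R : realType}.
Variable mu : {sigma_finite_measure set X -> \bar R}.
Local Notation leb := (@lebesgue_measure R).
Local Notation RR := (measurableTypeR R).
Local Notation m := (spacetime mu).
Implicit Types (u : nat -> R) (F G : X * RR -> R).

Lemma measurable_tshift F c : measurable_fun [set: X * RR] F ->
  measurable_fun [set: X * RR] (fun z => F (tshift c z)).
Proof. by move=> mF; apply: (measurableT_comp mF); case: (tshift_preserving mu c). Qed.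

Let cvg_tshift_L1_0 F (a b : R) u :
  m.-integrable setT (EFin \o F) -> (forall z, ~~ (a <= z.2 <= b) -> F z = 0) ->
  u @ \oo --> (0 : R) ->
  (\int[m]_z `|F (tshift (u n) z) - F z|%:E)%E @[n --> \oo] --> 0%E.
Proof.
move=> iF F0 u0.
have mF : measurable_fun [set: X * RR] F.
  by apply/measurable_EFinP; exact: measurable_int iF.
pose D n (z : X * RR) := `|F (tshift (u n) z) - F z|%:E.
have mD n : measurable_fun setT (D n).
  apply/measurable_EFinP; apply: measurableT_comp => //.
  by apply: measurable_funB => //; exact: measurable_tshift.
have D0 n z : (0 <= D n z)%E by rewrite lee_fin.
pose I n x := fubini_F leb (D n) x.
have mI n : measurable_fun setT (I n) by exact: measurable_fun_fubini_tonelli_F.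
have I0 n x : (0 <= I n x)%E by apply: integral_ge0 => t _; exact: D0.
pose aF (z : X * RR) : \bar R := (2 * `|F z|)%:E.
have maF : measurable_fun setT aF.
  apply/measurable_EFinP; apply: measurable_funM => //.
  by apply: measurableT_comp.
have iaF : m.-integrable setT aF.
  exact: (@integrableZl _ _ _ m setT measurableT 2 _ (integrable_abse iF)).
have iG := @integrable_fubini_F _ _ _ _ _ mu leb _ iaF.
have F1 x : measurable_fun [set: RR] (fun t : RR => F (x, t)).
  exact: measurableT_comp.
have Ile n x : (`|I n x| <= fubini_F leb aF x)%E.
  rewrite gee0_abs// /I /fubini_F.
  have mn : measurable_fun setT (fun t : RR => `|F (x, t)|%:E).
    by apply/measurable_EFinP; exact: measurableT_comp.
  have mns : measurable_fun setT (fun t : RR => `|F (x, t + u n)|%:E).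
    apply/measurable_EFinP; apply: measurableT_comp => //.
    exact: (measurable_shift (f := fun t => F (x, t))).
  apply: (@le_trans _ _ (\int[leb]_t (`|F (x, t + u n)|%:E + `|F (x, t)|%:E))%E).
    apply: ge0_le_integral => //.
    - exact: (measurableT_comp (mD n)).
    - exact: emeasurable_funD.
    - by move=> t _; rewrite /D -EFinD lee_fin ler_normB.
  rewrite ge0_integralD//.
  rewrite (ge0_integral_preserved (f := fun t : RR => `|F (x, t)|%:E)
    (lebesgue_shift_preserving (u n)))//.
  rewrite -ge0_integralD// le_eqVlt; apply/orP; left; apply/eqP.
  by apply: eq_integral => t _; rewrite /aF mulr_natl mulr2n.
have [|||||_ _] := @dominated_convergence _ _ _ mu setT measurableT I (cst 0%E) (fubini_F leb aF).
- exact: mI.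
- by [].
- apply: filterS (@ae_integrable1 _ _ _ _ _ mu leb _ iF) => x iFx _.
  exact: (@cvg_shift_L1 R (fun t => F (x, t)) a b u iFx (fun t => F0 (x, t)) u0).
- exact: iG.
- by apply: aeW => x n _; exact: Ile.
rewrite /= integral0.
rewrite (_ : (fun n => \int[m]_z _)%E = (fun n => \int[mu]_x I n x)%E)//.
apply/funext => n; exact: (@fubini_tonelli1 _ _ _ _ _ mu leb _ (mD n) (D0 n)).
Qed.

(** Almost every time section of F is integrable, so that the one-dimensional
    result applies to it; twice the integral of |F(x, .)| dominates. *)
Lemma cvg_tshift_L1 F (a b : R) u (r : R) :
  m.-integrable setT (EFin \o F) -> (forall z, ~~ (a <= z.2 <= b) -> F z = 0) ->
  u @ \oo --> r ->
  (\int[m]_z `|F (tshift (u n) z) - F (tshift r z)|%:E)%E @[n --> \oo] --> 0%E.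
Proof.
move=> iF F0 ur; have mF : measurable_fun [set: X * RR] F.
  by apply/measurable_EFinP; exact: measurable_int iF.
have ur0 : (fun n => u n - r) @ \oo --> (0 : R).
  by rewrite -[X in _ --> X](subrr r); apply: cvgB => //; exact: cvg_cst.
rewrite (_ : (fun n => _) = (fun n => \int[m]_z `|F (tshift (u n - r) z) - F z|%:E)%E).
  exact: (cvg_tshift_L1_0 iF F0 ur0).
apply/funext => n.
rewrite -(ge0_integral_preserved (tshift_preserving mu r)
  (f := fun z => `|F (tshift (u n - r) z) - F z|%:E))//.
  apply: eq_integral => z _; rewrite /tshift/= -addrA.
  by rewrite [r + _]addrC subrK.
apply/measurable_EFinP; apply: measurableT_comp => //.
by apply: measurable_funB => //; exact: measurable_tshift.
Qed.

(** The limit of these correlations at zero lag replaces the traces in time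
    that a weak solution does not have. *)
Definition tcorr F G (r : R) : R := \int[m]_z (F (tshift r z) * G z).

Lemma integrable_tcorr_bounded F G (C r : R) :
  m.-integrable setT (EFin \o F) -> measurable_fun setT G ->
  (forall z, `|G z| <= C) ->
  m.-integrable setT (fun z => (F (tshift r z) * G z)%:E).
Proof.
move=> iF mG GC; have mF : measurable_fun [set: X * RR] F.
  by apply/measurable_EFinP; exact: measurable_int iF.
have iFs := integrable_preserved (tshift_preserving mu r) iF.
apply: (le_integrable _ _ _ (@integrableZl _ _ _ m setT measurableT C _ (integrable_abse iFs))) => //.
  by apply/measurable_EFinP; apply: measurable_funM => //; exact: measurable_tshift.
move=> z _; rewrite /= lee_fin !normrM normr_id mulrC ler_wpM2r//.
by rewrite (le_trans (GC z))// ler_norm.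
Qed.

Lemma cvg_tcorr_bounded F G (C a b r : R) u :
  m.-integrable setT (EFin \o F) -> (forall z, ~~ (a <= z.2 <= b) -> F z = 0) ->
  measurable_fun setT G -> (forall z, `|G z| <= C) ->
  u @ \oo --> r -> tcorr F G (u n) @[n --> \oo] --> tcorr F G r.
Proof.
move=> iF F0 mG GC ur; have mF : measurable_fun [set: X * RR] F.
  by apply/measurable_EFinP; exact: measurable_int iF.
apply/cvgrPdist_le => e e0.
have C10 : 0 < `|C| + 1 by rewrite ltr_wpDl.
have := (ge0_cvge0P _).1 (cvg_tshift_L1 iF F0 ur) (e / (`|C| + 1)) (divr_gt0 e0 C10).
move=> /(_ _)-[|N _ hN]; first by move=> n; apply: integral_ge0 => z _; rewrite lee_fin.
exists N => // n Nn; have {hN} := hN n Nn.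
have iu := integrable_tcorr_bounded (u n) iF mG GC.
have ir := integrable_tcorr_bounded r iF mG GC.
rewrite distrC /tcorr -RintegralB// => h.
have iB : m.-integrable setT (EFin \o (fun z => F (tshift (u n) z) * G z - F (tshift r z) * G z)).
  exact: (integrableB measurableT iu ir).
rewrite -lee_fin EFin_normr_Rintegral//.
apply: (le_trans (le_abse_integral _ measurableT (measurable_int _ iB))).
have mD : measurable_fun setT (fun z => `|F (tshift (u n) z) - F (tshift r z)|%:E).
  apply/measurable_EFinP; apply: measurableT_comp => //.
  by apply: measurable_funB; exact: measurable_tshift.
apply: (@le_trans _ _ (\int[m]_z ((`|C| + 1) * `|F (tshift (u n) z) - F (tshift r z)|)%:E)%E).
  apply: ge0_le_integral => //.
  - by apply: measurableT_comp => //; exact: measurable_int iB.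
  - apply/measurable_EFinP; apply: measurable_funM => //.
    exact/measurable_EFinP.
  - move=> z _; have : `|F (tshift (u n) z) * G z - F (tshift r z) * G z| <=
        (`|C| + 1) * `|F (tshift (u n) z) - F (tshift r z)|.
      rewrite -mulrBl normrM mulrC ler_wpM2r//.
      by rewrite (le_trans (GC z))// (le_trans (ler_norm _))// lerDl.
    by [].
under eq_integral do rewrite EFinM.
have C1 : (0 <= (`|C| + 1)%:E)%E by rewrite lee_fin ltW.
rewrite (ge0_integralZl _ _ mD _ C1)//.
have -> : e%:E = ((`|C| + 1)%:E * (e / (`|C| + 1))%:E)%E.
  by rewrite -EFinM mulrC divfK ?gt_eqF.
by apply: lee_wpmul2l; [rewrite lee_fin ltW|exact: h].
Qed.

Lemma integrable_mul_sq F G : measurable_fun setT F -> measurable_fun setT G ->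
  m.-integrable setT (EFin \o (fun z => F z ^+ 2)) ->
  m.-integrable setT (EFin \o (fun z => G z ^+ 2)) ->
  m.-integrable setT (EFin \o (fun z => F z * G z)).
Proof.
move=> mF mG iF iG; apply: (le_integrable _ _ _ (integrableD measurableT iF iG)) => //.
  by apply/measurable_EFinP; exact: measurable_funM.
move=> z _ /=; rewrite lee_fin normrM.
rewrite (ger0_norm (addr_ge0 (sqr_ge0 (F z)) (sqr_ge0 (G z)))).
rewrite -(real_normK (num_real (F z))) -(real_normK (num_real (G z))).
by have := sqr_ge0 (`|F z| - `|G z|); have := mulr_ge0 (normr_ge0 (F z)) (normr_ge0 (G z)); nra.
Qed.

Lemma integrable_tcorr_sq F G (r : R) : measurable_fun setT F -> measurable_fun setT G ->
  m.-integrable setT (EFin \o (fun z => F z ^+ 2)) ->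
  m.-integrable setT (EFin \o (fun z => G z ^+ 2)) ->
  m.-integrable setT (EFin \o (fun z => F (tshift r z) * G z)).
Proof.
move=> mF mG iF iG; apply: integrable_mul_sq => //; first exact: measurable_tshift.
exact: (integrable_preserved (tshift_preserving mu r) iF).
Qed.

End time_correlation.

Section time_correlation_sq.
Context {d} {X : measurableType d} {R : realType}.
Variable mu : {sigma_finite_measure set X -> \bar R}.
Local Notation leb := (@lebesgue_measure R).
Local Notation RR := (measurableTypeR R).
Local Notation m := (spacetime mu).
Implicit Types (u : nat -> R) (F G H : X * RR -> R).

(** Young's inequality; translation leaves the norm of F unchanged, so that
    the bound is uniform in the lag. *)
Lemma normr_tcorr_young F H (r dl : R) : 0 < dl ->
  measurable_fun setT F -> measurable_fun setT H ->
  m.-integrable setT (EFin \o (fun z => F z ^+ 2)) ->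
  m.-integrable setT (EFin \o (fun z => H z ^+ 2)) ->
  `|tcorr mu F H r| <= dl * \int[m]_z (F z ^+ 2) + dl^-1 * \int[m]_z (H z ^+ 2).
Proof.
move=> dl0 mF mH iF iH.
have iFs := integrable_preserved (tshift_preserving mu r) iF.
have iFH := integrable_tcorr_sq r mF mH iF iH.
have iFH' : m.-integrable setT (EFin \o (fun z => `|F (tshift r z) * H z|)).
  exact: integrable_abse iFH.
have i1 : m.-integrable setT (EFin \o (fun z => dl * (F (tshift r z)) ^+ 2)).
  exact: (@integrableZl _ _ _ m setT measurableT dl _ iFs).
have i2 : m.-integrable setT (EFin \o (fun z => dl^-1 * H z ^+ 2)).
  exact: (@integrableZl _ _ _ m setT measurableT dl^-1 _ iH).
apply: (le_trans (le_normr_Rintegral measurableT iFH)).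
apply: (@le_trans _ _ (\int[m]_z (dl * (F (tshift r z)) ^+ 2 + dl^-1 * H z ^+ 2))).
  apply: le_Rintegral => //; first exact: (integrableD measurableT i1 i2).
  move=> z _; rewrite normrM.
  rewrite -(real_normK (num_real (F _))) -(real_normK (num_real (H z))).
  set x := `|F _|; set y := `|H z|.
  have x0 : 0 <= x by exact: normr_ge0.
  have y0 : 0 <= y by exact: normr_ge0.
  rewrite -(ler_pM2r dl0) mulrDl.
  have -> : dl^-1 * y ^+ 2 * dl = y ^+ 2 by field; rewrite gt_eqF.
  by have := sqr_ge0 (dl * x - y); have := mulr_ge0 (ltW dl0) (mulr_ge0 x0 y0); nra.
rewrite RintegralD// RintegralZl// RintegralZl//.
have -> : \int[m]_z (F (tshift r z) ^+ 2) = \int[m]_z (F z ^+ 2).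
  have E := congr1 fine (integral_preserved (tshift_preserving mu r) iF).
  exact: E.
by [].
Qed.

Lemma tcorrD F G H r : 
  m.-integrable setT (EFin \o (fun z => F (tshift r z) * G z)) ->
  m.-integrable setT (EFin \o (fun z => F (tshift r z) * H z)) ->
  tcorr mu F (fun z => G z + H z) r = tcorr mu F G r + tcorr mu F H r.
Proof.
move=> i1 i2; rewrite /tcorr -RintegralD//.
by apply: eq_Rintegral => z _; rewrite mulrDr.
Qed.

(** G is truncated at height N: the truncated part is bounded, and the
    remainder is small in L2, hence contributes little uniformly in the lag. *)
Lemma cvg_tcorr_sq F G (a b r : R) u :
  m.-integrable setT (EFin \o F) -> (forall z, ~~ (a <= z.2 <= b) -> F z = 0) ->
  m.-integrable setT (EFin \o (fun z => F z ^+ 2)) ->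
  measurable_fun setT G -> m.-integrable setT (EFin \o (fun z => G z ^+ 2)) ->
  u @ \oo --> r -> tcorr mu F G (u n) @[n --> \oo] --> tcorr mu F G r.
Proof.
move=> iF F0 iF2 mG iG2 ur; have mF : measurable_fun [set: X * RR] F.
  by apply/measurable_EFinP; exact: measurable_int iF.
pose bd (N : nat) : set (X * RR) := [set z | `|G z| <= N%:R].
have mbd N : measurable (bd N).
  rewrite (_ : bd N = setT `&` (fun z => `|G z|) @^-1` `]-oo, N%:R]%classic).
    by apply: (measurableT_comp (@normr_measurable R setT) mG) => //; exact: measurable_itv.
  by apply/seteqP; split=> z /=; rewrite in_itv/=; [split|case].
pose GN N z := G z * \1_(bd N) z; pose HN N z := G z - GN N z.
have mGN N : measurable_fun setT (GN N).
  by apply: measurable_funM => //; exact: measurable_indic.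
have mHN N : measurable_fun setT (HN N) by exact: measurable_funB.
have GNb N z : `|GN N z| <= N%:R.
  rewrite /GN indicE; case: (boolP (z \in _)); rewrite ?mulr1 ?mulr0 ?normr0//.
  by rewrite inE.
have GN1 N z : `|\1_(bd N) z : R| <= 1.
  by rewrite indicE; case: (z \in _); rewrite ?normr1 ?normr0.
have GNle N z : GN N z ^+ 2 <= G z ^+ 2.
  rewrite /GN indicE; case: (z \in _); rewrite ?mulr1 ?mulr0// expr0n; exact: sqr_ge0.
have HNle N z : HN N z ^+ 2 <= G z ^+ 2.
  rewrite /HN /GN indicE; case: (z \in _); rewrite ?mulr1 ?mulr0 ?subr0 ?subrr// expr0n; exact: sqr_ge0.
have idom (H : X * RR -> R) : measurable_fun setT H -> (forall z, H z ^+ 2 <= G z ^+ 2) ->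
    m.-integrable setT (EFin \o (fun z => H z ^+ 2)).
  move=> mH HG; apply: (le_integrable _ _ _ iG2) => //.
    by apply/measurable_EFinP; exact: measurable_funX.
  by move=> z _ /=; rewrite lee_fin !ger0_norm ?sqr_ge0.
have iGN N := idom _ (mGN N) (GNle N); have iHN N := idom _ (mHN N) (HNle N).
have HN0 : \int[m]_z (HN n z ^+ 2) @[n --> \oo] --> (0 : R).
  have [|||||_ _] := @dominated_convergence _ _ _ m setT measurableT
    (fun n z => (HN n z ^+ 2)%:E) (cst 0%E) (EFin \o (fun z => G z ^+ 2)).
  - by move=> n; exact: measurable_int (iHN n).
  - by [].
  - apply: aeW => z _; apply: cvg_near_cst.
    have [k Gk] : exists k : nat, `|G z| <= k%:R.
      by exists (Num.trunc `|G z|).+1; rewrite ltW// truncnS_gt.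
    exists k => // n kn /=.
    have -> : HN n z = 0.
      rewrite /HN /GN indicE mem_set ?mulr1 ?subrr//.
      by rewrite /bd/= (le_trans Gk)// ler_nat.
    by rewrite expr0n.
  - exact: iG2.
  - by apply: aeW => z n _ /=; rewrite lee_fin ger0_norm ?sqr_ge0.
  rewrite integral0; move=> h; have := fine_cvg h; rewrite /=; apply.
apply/cvgrPdist_le => e e0.
set A := \int[m]_z (F z ^+ 2).
have A0 : 0 <= A by apply: Rintegral_ge0 => z _; exact: sqr_ge0.
have A10 : 0 < A + 1 by rewrite ltr_wpDl.
pose dl := e / 8 / (A + 1); have dl0 : 0 < dl by rewrite !divr_gt0.
have e80 : 0 < e / 8 by rewrite divr_gt0.
have dlA : dl * A <= e / 8.
  by rewrite /dl mulrAC ler_pdivrMr// ler_wpM2l ?divr_ge0 ?(ltW e0)// lerDl.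
have [k _ /(_ _ (leqnn k))] := (cvgrPdist_le _ _).1 HN0 (dl * (e / 8)) (mulr_gt0 dl0 e80).
rewrite /= sub0r normrN ger0_norm; last by apply: Rintegral_ge0 => z _; exact: sqr_ge0.
move=> HNk.
have small s : `|tcorr mu F (HN k) s| <= e / 4.
  apply: (le_trans (normr_tcorr_young s dl0 mF (mHN k) iF2 (iHN k))).
  have HNe : dl^-1 * \int[m]_z (HN k z ^+ 2) <= e / 8 by rewrite ler_pdivrMl.
  apply: (le_trans (lerD dlA HNe)).
  by rewrite le_eqVlt; apply/orP; left; apply/eqP; field.
have split s : tcorr mu F G s = tcorr mu F (GN k) s + tcorr mu F (HN k) s.
  rewrite -tcorrD; [|exact: integrable_tcorr_sq..].
  by congr tcorr; apply/funext => z; rewrite /HN addrC subrK.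
have e40 : 0 < e / 4 by rewrite divr_gt0.
have [N _ hN] := (cvgrPdist_le _ _).1 (cvg_tcorr_bounded iF F0 (mGN k) (GNb k) ur) _ e40.
exists N => // n Nn /=; have h := hN n Nn; rewrite !split.
have := small (u n); have := small r.
move: h; rewrite !ler_norml => /andP[? ?] /andP[? ?] /andP[? ?].
by apply/andP; split; lra.
Qed.

End time_correlation_sq.

(** * Kernels in two times *)

Section time_kernel.
Context {d} {X : measurableType d} {R : realType}.
Variable mu : {sigma_finite_measure set X -> \bar R}.
Local Notation leb := (@lebesgue_measure R).
Local Notation RR := (measurableTypeR R).
Local Notation m := (spacetime mu).
Implicit Types (K : (X * RR) * RR -> R) (F G : X * RR -> R).

Lemma measurable_tshear K (r : R) : measurable_fun setT K ->
  measurable_fun setT (fun z : X * RR => K (tshear (z, r))).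
Proof.
move=> mK; have [ms _] := tshear_preserving mu.
exact: (measurableT_comp (measurableT_comp mK ms) (pair2_measurable r)).
Qed.

Definition kcorr K (r : R) : R := \int[m]_z K (tshear (z, r)).

(** What the energy argument requires of a function of (x, t, s): the
    domination by a function of (x, t) and one of (x, s) gives integrability,
    the support keeps both times in (0, T), and the correlation is continuous
    in the lag.  The class is closed under sums, and contains the products
    F(x, t) G(x, s) of an integrable and a bounded function, or of two square
    integrable ones. *)
Record time_kernel (T : R) K : Prop := TimeKernel {
  tk_measurable : measurable_fun setT K ;
  tk_dominated : exists P Q : X * RR -> R,
    [/\ m.-integrable setT (EFin \o P), m.-integrable setT (EFin \o Q) &
        forall x s t, `|K ((x, t), s)| <= P (x, t) + Q (x, s)] ;
  tk_support : forall x s t, K ((x, t), s) != 0 -> (0 < t < T) && (0 < s < T) ;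
  tk_cvg : forall (u : nat -> R) r, u @ \oo --> r -> kcorr K (u n) @[n --> \oo] --> kcorr K r
}.

Lemma integrable_kcorr T K (r : R) : time_kernel T K ->
  m.-integrable setT (EFin \o (fun z => K (tshear (z, r)))).
Proof.
move=> [mK [P [Q [iP iQ KPQ]]] _ _].
have iPs := integrable_preserved (tshift_preserving mu r) iP.
apply: (le_integrable _ _ _ (integrableD measurableT (integrable_abse iPs) (integrable_abse iQ))) => //.
  by apply/measurable_EFinP; exact: measurable_tshear.
move=> [x s] _ /=; rewrite lee_fin.
apply: (le_trans (KPQ _ _ _)); apply: le_trans (ler_norm _).
by apply: lerD; exact: ler_norm.
Qed.

Lemma time_kernelD T K1 K2 : time_kernel T K1 -> time_kernel T K2 ->
  time_kernel T (fun w => K1 w + K2 w).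
Proof.
move=> k1 k2; have [mK1 [P1 [Q1 [iP1 iQ1 KPQ1]]] s1 c1] := k1.
have [mK2 [P2 [Q2 [iP2 iQ2 KPQ2]]] s2 c2] := k2; split.
- exact: measurable_funD.
- exists (fun z => P1 z + P2 z), (fun z => Q1 z + Q2 z); split.
  + exact: (integrableD measurableT iP1 iP2).
  + exact: (integrableD measurableT iQ1 iQ2).
  + move=> x s t; apply: (le_trans (ler_normD _ _)).
    by rewrite addrACA; apply: lerD; [exact: KPQ1|exact: KPQ2].
- move=> x s t; have [K10|/s1//] := eqVneq (K1 ((x, t), s)) 0.
  by rewrite K10 add0r => /s2.
- move=> u r ur.
  have E q : kcorr (fun w => K1 w + K2 w) q = kcorr K1 q + kcorr K2 q.
    by rewrite /kcorr RintegralD//; [exact: integrable_kcorr k1|exact: integrable_kcorr k2].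
  by rewrite E; under eq_fun do rewrite E; apply: cvgD; [exact: c1|exact: c2].
Qed.

Lemma time_kernel0 T : time_kernel T (fun _ => 0).
Proof.
split.
- exact: measurable_cst.
- exists (fun=> 0), (fun=> 0); split; [exact: integrable0|exact: integrable0|].
  by move=> *; rewrite normr0 addr0.
- by move=> x s t; rewrite eqxx.
- by move=> u r _; rewrite /kcorr; apply: cvg_cst.
Qed.

Lemma time_kernel_sum T n (K : 'I_n -> (X * RR) * RR -> R) :
  (forall i, time_kernel T (K i)) -> time_kernel T (fun w => \sum_i K i w).
Proof.
elim: n K => [|n IHn] K kK.
  by under eq_fun do rewrite big_ord0; exact: time_kernel0.
under eq_fun do rewrite big_ord_recr/=; apply: time_kernelD => //.
exact: IHn.
Qed.

Let kprod F G (w : (X * RR) * RR) : R := F w.1 * G (w.1.1, w.2).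

Let measurable_kprod F G : measurable_fun setT F -> measurable_fun setT G ->
  measurable_fun setT (kprod F G).
Proof.
move=> mF mG; apply: measurable_funM.
  by apply: (measurableT_comp mF); exact: measurable_fst.
apply: (measurableT_comp mG); apply/measurable_fun_pair; last exact: measurable_snd.
by apply: (measurableT_comp measurable_fst); exact: measurable_fst.
Qed.

Let kprod_support T F G :
  (forall z, F z != 0 -> 0 < z.2 < T) -> (forall z, G z != 0 -> 0 < z.2 < T) ->
  forall x s t, kprod F G ((x, t), s) != 0 -> (0 < t < T) && (0 < s < T).
Proof.
move=> F0 G0 x s t; rewrite /kprod/= mulf_eq0 negb_or => /andP[/F0 /= -> /G0 /= ->].
by [].
Qed.

Lemma time_kernel_bounded T F G (C : R) :
  m.-integrable setT (EFin \o F) -> measurable_fun setT G -> (forall z, `|G z| <= C) ->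
  (forall z, F z != 0 -> 0 < z.2 < T) -> (forall z, G z != 0 -> 0 < z.2 < T) ->
  time_kernel T (fun w => F w.1 * G (w.1.1, w.2)).
Proof.
move=> iF mG GC F0 G0; have mF : measurable_fun setT F.
  by apply/measurable_EFinP; exact: measurable_int iF.
split.
- exact: (measurable_kprod mF mG).
- exists (fun z => C * `|F z|), (fun=> 0); split; last first.
  + by move=> x s t; rewrite addr0 normrM mulrC ler_wpM2r.
  + exact: integrable0.
  + exact: (@integrableZl _ _ _ m setT measurableT C _ (integrable_abse iF)).
- exact: (kprod_support F0 G0).
- move=> u r ur; have F00 z : ~~ (0 <= z.2 <= T) -> F z = 0.
    move=> zT; apply/eqP/negPn/negP => /F0 /andP[z0 z1].
    by move: zT; rewrite !ltW.
  have := cvg_tcorr_bounded iF F00 mG GC ur.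
  rewrite /tcorr /kcorr /tshear /tshift/=.
  have E (q : R) : (fun z : X * RR => F (z.1, z.2 + q) * G (z.1, z.2)) =
     (fun z : X * RR => F (z.1, z.2 + q) * G z) by apply/funext => -[].
  by rewrite E; under [X in _ -> X @ _ --> _]eq_fun do rewrite E.
Qed.

Lemma time_kernel_sq T F G :
  m.-integrable setT (EFin \o F) -> m.-integrable setT (EFin \o (fun z => F z ^+ 2)) ->
  measurable_fun setT G -> m.-integrable setT (EFin \o (fun z => G z ^+ 2)) ->
  (forall z, F z != 0 -> 0 < z.2 < T) -> (forall z, G z != 0 -> 0 < z.2 < T) ->
  time_kernel T (fun w => F w.1 * G (w.1.1, w.2)).
Proof.
move=> iF iF2 mG iG F0 G0; have mF : measurable_fun setT F.
  by apply/measurable_EFinP; exact: measurable_int iF.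
split.
- exact: (measurable_kprod mF mG).
- exists (fun z => F z ^+ 2), (fun z => G z ^+ 2); split => // x s t.
  rewrite normrM -(real_normK (num_real (F _))) -(real_normK (num_real (G _))).
  set a := `|F _|; set b := `|G _|.
  have := sqr_ge0 (a - b); have : 0 <= a * b by rewrite mulr_ge0 ?normr_ge0.
  by nra.
- exact: (kprod_support F0 G0).
- move=> u r ur; have F00 z : ~~ (0 <= z.2 <= T) -> F z = 0.
    move=> zT; apply/eqP/negPn/negP => /F0 /andP[z0 z1].
    by move: zT; rewrite !ltW.
  have := cvg_tcorr_sq iF F00 iF2 mG iG ur.
  rewrite /tcorr /kcorr /tshear /tshift/=.
  have E (q : R) : (fun z : X * RR => F (z.1, z.2 + q) * G (z.1, z.2)) =
     (fun z : X * RR => F (z.1, z.2 + q) * G z) by apply/funext => -[].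
  by rewrite E; under [X in _ -> X @ _ --> _]eq_fun do rewrite E.
Qed.

(** On the line, sequential continuity gives the epsilon-delta form. *)
Lemma kcorr_near T K (r e : R) : time_kernel T K -> 0 < e ->
  exists2 dl, 0 < dl & forall q, `|q - r| <= dl -> `|kcorr K q - kcorr K r| <= e.
Proof.
move=> kK e0.
have cK : kcorr K x @[x --> (r : R^o)] --> (kcorr K r : R^o).
  by apply/(@cvg_nbhsP R R^o) => u ur; exact: tk_cvg kK u r ur.
have /cvgrPdist_le/(_ e e0)/nbhs_ballP[dl /= dl0 H] := cK.
exists (dl / 2); first by rewrite divr_gt0.
move=> q qr; rewrite distrC; apply: H; rewrite /ball/= distrC.
by apply: (le_lt_trans qr); rewrite gtr_pMr// invf_lt1// ltr1n.
Qed.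

(** The bounds P(x, t) and Q(x, s) each miss one time variable, which the
    support confines to the bounded interval (0, T). *)
Lemma integrable_time_kernel T K (k : R -> R) (C : R) : time_kernel T K ->
  measurable_fun [set: RR] (k : RR -> R) -> (forall t, `|k t| <= C) ->
  (m \x leb)%E.-integrable setT (EFin \o (fun w => k (w.1.2 - w.2) * K w)).
Proof.
move=> [mK [P [Q [iP iQ KPQ]]] Ks _] mk kC.
have m2 : measurable_fun [set: (X * RR) * RR] (fun w => w.1.2 : RR).
  by apply: (measurableT_comp measurable_snd); exact: measurable_fst.
have m1 : measurable_fun [set: (X * RR) * RR] (fun w => w.1.1 : X).
  by apply: (measurableT_comp measurable_fst); exact: measurable_fst.
have mkK : measurable_fun setT (fun w : (X * RR) * RR => k (w.1.2 - w.2) * K w).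
  apply: measurable_funM => //; apply: (measurableT_comp mk).
  by apply: measurable_funB => //; exact: measurable_snd.
have mP : measurable_fun setT P by apply/measurable_EFinP; exact: measurable_int iP.
have mQ : measurable_fun setT Q by apply/measurable_EFinP; exact: measurable_int iQ.
pose I : RR -> R := \1_(`]0, T[%classic : set RR).
have mI : measurable_fun [set: RR] I by exact: measurable_indic.
have iI : leb.-integrable setT (EFin \o I) by exact: (integrable_indic_itv 0 T false true).
have I0 t : 0 <= I t by rewrite /I indicE.
pose A (w : (X * RR) * RR) : R := `|P w.1| * I w.2.
pose B (w : (X * RR) * RR) : R := `|Q (w.1.1, w.2)| * I w.1.2.
have intI : (\int[leb]_t (I t)%:E < +oo)%E.
  have /integrableP[_] := iI.
  by under eq_integral do rewrite /= ger0_norm//.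
have mIE : measurable_fun setT (fun t : RR => (I t)%:E) by exact/measurable_EFinP.
have IE0 (t : RR) : setT t -> (0 <= (I t)%:E)%E by rewrite lee_fin.
have intI0 : (0 <= \int[leb]_t (I t)%:E)%E by apply: integral_ge0 => t _; rewrite lee_fin.
have absP (F : X * RR -> R) : m.-integrable setT (EFin \o F) ->
    (\int[m]_z (`|F z|)%:E < +oo)%E by move=> /integrableP[].
have maQ : measurable_fun setT (fun z => (`|Q z|)%:E).
  by apply/measurable_EFinP; exact: measurableT_comp.
have maP : measurable_fun setT (fun z => (`|P z|)%:E).
  by apply/measurable_EFinP; exact: measurableT_comp.
have mA : measurable_fun setT A.
  apply: measurable_funM; last by apply: (measurableT_comp mI); exact: measurable_snd.
  by apply: measurableT_comp => //; apply: (measurableT_comp mP); exact: measurable_fst.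
have mB : measurable_fun setT B.
  apply: measurable_funM; last by apply: (measurableT_comp mI).
  apply: measurableT_comp => //; apply: (measurableT_comp mQ).
  by apply/measurable_fun_pair => //; exact: measurable_snd.
have iA : (m \x leb)%E.-integrable setT (EFin \o A).
  apply/(@integrable12ltyP _ _ _ _ _ m leb (EFin \o A)); first exact/measurable_EFinP.
  rewrite (_ : (\int[m]_x _)%E = (\int[m]_z (`|P z|%:E * \int[leb]_t (I t)%:E))%E); last first.
    apply: eq_integral => z _ /=.
    under eq_integral do rewrite normrM normr_id (ger0_norm (I0 _)) EFinM.
    by rewrite /= (ge0_integralZl _ _ mIE IE0).
  by rewrite ge0_integralZr// lte_mul_pinfty ?integral_ge0// ge0_fin_numE ?absP// integral_ge0.
have iB : (m \x leb)%E.-integrable setT (EFin \o B).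
  apply/(@integrable12ltyP _ _ _ _ _ m leb (EFin \o B)); first exact/measurable_EFinP.
  pose q x := (\int[leb]_s `|Q (x, s)|%:E)%E.
  have mq : measurable_fun setT q.
    exact: (measurable_fun_fubini_tonelli_F (fun z => (`|Q z|)%:E)).
  have q0 x : (0 <= q x)%E by apply: integral_ge0.
  rewrite (_ : (\int[m]_x _)%E = (\int[m]_z (q z.1 * (I z.2)%:E))%E); last first.
    apply: eq_integral => -[x t] _ /=.
    under eq_integral do rewrite normrM normr_id (ger0_norm (I0 _)) EFinM.
    rewrite /= ge0_integralZr//; last by rewrite lee_fin.
    by apply/measurable_EFinP; apply: measurableT_comp => //; exact: measurableT_comp.
  have mqI : measurable_fun setT (fun z : X * RR => (q z.1 * (I z.2)%:E)%E).
    apply: emeasurable_funM; first by apply: (measurableT_comp mq); exact: measurable_fst.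
    by apply/measurable_EFinP; apply: (measurableT_comp mI); exact: measurable_snd.
  have qI0 (z : X * RR) : (0 <= q z.1 * (I z.2)%:E)%E by rewrite mule_ge0// lee_fin.
  rewrite (_ : (\int[_]_z _)%E = (\int[mu]_x \int[leb]_t (q x * (I t)%:E))%E); last first.
    exact: (@fubini_tonelli1 _ _ _ _ _ mu leb _ mqI qI0).
  rewrite (_ : (\int[mu]_x _)%E = (\int[mu]_x (q x * \int[leb]_t (I t)%:E))%E); last first.
    by apply: eq_integral => x _; rewrite /= (ge0_integralZl _ _ mIE IE0).
  rewrite ge0_integralZr//.
  have -> : (\int[mu]_x q x)%E = (\int[m]_z `|Q z|%:E)%E.
    by apply/esym; exact: (@fubini_tonelli1 _ _ _ _ _ mu leb _ maQ).
  by rewrite lte_mul_pinfty ?integral_ge0// ge0_fin_numE ?absP// integral_ge0.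
apply: (le_integrable _ _ _ (@integrableZl _ _ _ _ setT measurableT C _ (integrableD measurableT iA iB))) => //.
  exact/measurable_EFinP.
move=> [[x t] s] _ /=; rewrite lee_fin.
have [->|/Ks /andP[/= tT sT]] := eqVneq (K ((x, t), s)) 0.
  by rewrite mulr0 normr0.
have I1 y : 0 < y < T -> I y = 1.
  by move=> yT; rewrite /I indicE mem_set//= in_itv.
rewrite /A /B/= !I1// !mulr1 normrM [leRHS]ger0_norm; last first.
  by rewrite mulr_ge0 ?addr_ge0// (le_trans _ (kC 0)).
apply: ler_pM => //; apply: (le_trans (KPQ _ _ _)).
by apply: lerD; exact: ler_norm.
Qed.

End time_kernel.

(** * Averages over the time lag *)

Section time_cutoff.
Context {R : realType}.
Local Notation leb := (@lebesgue_measure R).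
Local Notation RR := (measurableTypeR R).

Lemma smooth_cutoff (d : R) : 0 < d -> exists (P P' : R -> R) (C : R),
  [/\ [/\ forall k, Ck k P', forall x, is_derive x (1 : R) P (P' x) &
      {homo P : x y / x <= y}],
      forall x, [/\ 0 <= P' x, P' x <= C, 0 <= P x & P x <= 1],
      forall x, x <= - d -> P x = 0 /\ P' x = 0,
      forall x, 0 <= x -> P x = 1 /\ P' x = 0 &
      leb.-integrable setT (EFin \o (P' : RR -> R)) /\ \int[leb]_t P' t = 1].
Proof.
move=> d0; have [P [P' [CP' dP bP lP rP]]] := smooth_step d0.
have cP' : continuous P' := Ck_continuous (CP' 0%N).
have dPx x : derivable P x 1 by case: (dP x).
have cP : continuous P.
  by move=> x; apply/differentiable_continuous/derivable1_diffP.
have P'out x : x \notin `[- d, 0]%R -> P' x = 0.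
  rewrite in_itv/= negb_and -!ltNge => /orP[xd|x0].
    by case: (lP _ (ltW xd)).
  by case: (rP _ (ltW x0)).
have dd : - d < 0 by rewrite oppr_lt0.
have [c _ cmax] := EVT_max (ltW dd) (continuous_subspaceT cP').
have Pc x : P' x <= P' c.
  have [/cmax//|/P'out ->] := boolP (x \in `[- d, 0]%R).
  by case: (bP c).
have mP' : measurable_fun [set: RR] (P' : RR -> R) by exact: continuous_measurable_fun.
have FTC : (\int[leb]_(x in `[(- d)%R, 0%R]) (P' x)%:E = 1%:E)%E.
  rewrite (continuous_FTC2 (F := P) dd)//.
  - by rewrite (rP 0 (lexx _)).1 (lP (- d) (lexx _)).1 sube0.
  - exact: continuous_subspaceT.
  - split; first by move=> x _.
      by apply: cvg_at_right_filter; exact: cP.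
    by apply: cvg_at_left_filter; exact: cP.
  - by move=> x _; rewrite derive1E; case: (dP x).
have E : (\int[leb]_x (P' x)%:E = 1%:E)%E.
  rewrite -FTC [RHS]integral_mkcond; apply: eq_integral => x _.
  rewrite patchE; case: ifPn => //; rewrite notin_setE/= => /negP xd.
  by rewrite P'out.
exists P, P', (P' c); split => //.
- split=> // x y xy.
  apply: (@ger0_derive1_ndecr _ P x y) => //.
  + by move=> z _; rewrite derive1E; case: (dP z) => _ ->; case: (bP z).
  + exact: continuous_subspaceT.
- by move=> x; have [? ? ?] := bP x; split.
- split; last by rewrite /Rintegral E.
  apply/integrableP; split; first exact/measurable_EFinP.
  apply: (@le_lt_trans _ _ (\int[leb]_x (P' x)%:E)%E); last by rewrite E ltry.
  rewrite le_eqVlt; apply/orP; left; apply/eqP; apply: eq_integral => x _ /=.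
  by rewrite ger0_norm//; case: (bP x).
Qed.

End time_cutoff.

Section kernel_average.
Context {d} {X : measurableType d} {R : realType}.
Variable mu : {sigma_finite_measure set X -> \bar R}.
Local Notation leb := (@lebesgue_measure R).
Local Notation RR := (measurableTypeR R).
Local Notation m := (spacetime mu).

(** Both sides integrate k1 (t - s) K1 + k2 (t - s) K2 over the triples
    (x, t, s), on the left after the shear that makes the lag a variable. *)
Lemma kernel_average (T C : R) K1 K2 (k1 k2 : R -> R) :
  time_kernel mu T K1 -> time_kernel mu T K2 ->
  measurable_fun [set: RR] (k1 : RR -> R) -> measurable_fun [set: RR] (k2 : RR -> R) ->
  (forall t, `|k1 t| <= C) -> (forall t, `|k2 t| <= C) ->
  let I (s : R) := \int[m]_z (k1 (z.2 - s) * K1 (z, s) + k2 (z.2 - s) * K2 (z, s)) in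
  [/\ leb.-integrable setT (EFin \o (fun r : RR => k1 r * kcorr mu K1 r + k2 r * kcorr mu K2 r)),
      leb.-integrable setT (EFin \o (I : RR -> R)) &
      \int[leb]_r (k1 r * kcorr mu K1 r + k2 r * kcorr mu K2 r) = \int[leb]_s I s].
Proof.
move=> tk1 tk2 mk1 mk2 kC1 kC2 I.
have i1 := integrable_time_kernel tk1 mk1 kC1.
have i2 := integrable_time_kernel tk2 mk2 kC2.
have i12 := integrableD measurableT i1 i2.
have [I1 I2 E] := @Rintegral_tshear _ _ _ mu
  (fun w => k1 (w.1.2 - w.2) * K1 w + k2 (w.1.2 - w.2) * K2 w) i12.
have J r : \int[m]_z (k1 ((tshear (z, r)).1.2 - (tshear (z, r)).2) * K1 (tshear (z, r)) +
    k2 ((tshear (z, r)).1.2 - (tshear (z, r)).2) * K2 (tshear (z, r))) =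
    k1 r * kcorr mu K1 r + k2 r * kcorr mu K2 r.
  rewrite /kcorr -!RintegralZl//; [|exact: integrable_kcorr tk2|exact: integrable_kcorr tk1].
  rewrite -RintegralD//; first last.
  - exact: (@integrableZl _ _ _ m setT measurableT (k2 r) _ (integrable_kcorr r tk2)).
  - exact: (@integrableZl _ _ _ m setT measurableT (k1 r) _ (integrable_kcorr r tk1)).
  by apply: eq_Rintegral => -[x s] _; rewrite /tshear/= [s + r]addrC addrK.
move: I1 E; under [X in _.-integrable _ (_ \o X) -> _]eq_fun do rewrite J.
move=> I1; under eq_Rintegral do rewrite J.
by move=> E; split; [exact: I1|exact: I2|exact: E].
Qed.

End kernel_average.

(** * The energy argument *)

Section energy.
Context {d} {X : measurableType d} {R : realType}.
Variable mu : {sigma_finite_measure set X -> \bar R}.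
Local Notation leb := (@lebesgue_measure R).
Local Notation RR := (measurableTypeR R).
Local Notation m := (spacetime mu).

Variables (T nu : R) (n : nat) (W : X * RR -> R) (Gr Bf : 'I_n -> X * RR -> R).
Hypotheses (T0 : 0 < T) (nu0 : 0 < nu).

(** Functions continued by 0 outside the time interval (0, T). *)
Definition L12 (F : X * RR -> R) : Prop :=
  [/\ m.-integrable setT (EFin \o F),
      m.-integrable setT (EFin \o (fun z => F z ^+ 2)) &
      forall z, F z != 0 -> 0 < z.2 < T].

Hypotheses (hW : L12 W) (hG : forall i, L12 (Gr i)) (hB : forall i, L12 (Bf i)).

(** The convection term b . grad w. *)
Definition flux (z : X * RR) : R := \sum_i Bf i z * Gr i z.

(** The equation for W with zero initial value, tested with the product of
    softsgn (W(x, s)) and psi(t) for a frozen time s.  Here psi need not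
    vanish at t = 0: this is how the initial value enters. *)
Hypothesis eqn : {ae leb, forall s : RR, 0 < s < T ->
  forall (psi psi' : R -> R) (C : R), (forall k, Ck k psi') ->
    (forall x, is_derive x (1 : R) psi (psi' x)) ->
    (forall t, `|psi t| <= C /\ `|psi' t| <= C) -> (forall t, s <= t -> psi t = 0) ->
  \int[m]_z (- psi' z.2 * (W z * softsgn (W (z.1, s))) +
     psi z.2 * (\sum_i Gr i z * (nu * (softsgn' (W (z.1, s)) * Gr i (z.1, s))) +
       flux z * softsgn (W (z.1, s)))) = 0}.

(** The sign of the divergence, tested with the product of softabs (W(x, s))
    and psi(t). *)
Hypothesis div : {ae leb, forall s : RR, 0 < s < T ->
  forall (psi : R -> R) (a C : R), (forall k, Ck k psi) ->
    (forall t, 0 <= psi t <= C) -> 0 < a -> (forall t, t <= a \/ s <= t -> psi t = 0) ->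
  0 <= \int[m]_z (psi z.2 * \sum_i Bf i z * (softsgn (W (z.1, s)) * Gr i (z.1, s)))}.

Let mes F : L12 F -> measurable_fun setT F.
Proof. by case=> iF _ _; apply/measurable_EFinP; exact: measurable_int iF. Qed.

(** The weight T - s decreases in time, which makes the energy identity
    produce a positive multiple of the energy itself, without Gronwall's
    inequality.  The cut at a keeps test functions for the divergence away
    from the time 0. *)
Let weight (a s : R) : R := if (a < s) && (s < T) then T - s else 0.

Let weight_ge0 a s : 0 <= weight a s.
Proof. by rewrite /weight; case: ifPn => // /andP[_ sT]; rewrite subr_ge0 ltW. Qed.

Let weight_le a s : 0 <= a -> weight a s <= T.
Proof.
move=> a0; rewrite /weight; case: ifPn => [/andP[as_ sT]|_]; last exact: ltW.
by rewrite gerBl (le_trans a0)// ltW.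
Qed.

Let measurable_weight a : measurable_fun [set: RR] (weight a : RR -> R).
Proof.
apply: measurable_fun_if => //.
- by apply: measurable_and; apply: measurable_fun_ltr => //; exact: measurable_cst.
- by apply: measurable_funTS; apply: measurable_funB => //; exact: measurable_cst.
Qed.

Let measurable_softsgn : measurable_fun [set: RR] (softsgn : RR -> R).
Proof. by apply: continuous_measurable_fun; exact: Ck_continuous (Ck_softsgn 0%N). Qed.

Let measurable_softsgn' : measurable_fun [set: RR] (softsgn' : RR -> R).
Proof. by apply: continuous_measurable_fun; exact: Ck_continuous (Ck_softsgn' 0%N). Qed.

Let measurable_softabs : measurable_fun [set: RR] (softabs : RR -> R).
Proof. by apply: continuous_measurable_fun; exact: Ck_continuous (Ck_softabs 0%N). Qed.

Let gW z := weight 0 z.2 * softsgn (W z).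
Let gN i z := weight 0 z.2 * (nu * (softsgn' (W z) * Gr i z)).
Let gB a i z := weight a z.2 * (softsgn (W z) * Gr i z).

Let mw a : measurable_fun setT (fun z : X * RR => weight a z.2).
Proof. by apply: (measurableT_comp (measurable_weight a)); exact: measurable_snd. Qed.

Let mgW : measurable_fun setT gW.
Proof.
apply: measurable_funM; first exact: mw.
by apply: (measurableT_comp measurable_softsgn); exact: mes.
Qed.

Let gW_le z : `|gW z| <= T.
Proof.
rewrite /gW normrM -[leRHS]mulr1 ler_pM ?softsgn_le1//.
by rewrite ger0_norm ?weight_ge0 ?weight_le.
Qed.

Let gW_supp z : gW z != 0 -> 0 < z.2 < T.
Proof.
rewrite /gW; have [->|W0 _] := eqVneq (W z) 0; first by rewrite softsgn0 mulr0 eqxx.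
by case: hW => _ _; apply.
Qed.

Let sq_dom (F G : X * RR -> R) (C : R) : L12 F -> measurable_fun setT G ->
  (forall z, `|G z| <= C * `|F z|) -> m.-integrable setT (EFin \o (fun z => G z ^+ 2)).
Proof.
move=> [_ iF _] mG GF.
apply: (le_integrable _ _ _ (@integrableZl _ _ _ m setT measurableT (C ^+ 2) _ iF)) => //.
  by apply/measurable_EFinP; exact: measurable_funX.
move=> z _ /=; rewrite lee_fin ger0_norm ?sqr_ge0// -exprMn ger0_norm ?sqr_ge0//.
rewrite -[leLHS](real_normK (num_real _)) -[leRHS](real_normK (num_real _)).
rewrite ler_sqr ?nnegrE ?normr_ge0// (le_trans (GF z))// normrM ler_wpM2r//.
exact: ler_norm.
Qed.

Let mgN i : measurable_fun setT (gN i).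
Proof.
apply: measurable_funM; first exact: mw.
apply: measurable_funM; first exact: measurable_cst.
by apply: measurable_funM; [apply: (measurableT_comp measurable_softsgn')|]; exact: mes.
Qed.

Let gN_le i z : `|gN i z| <= (T * nu) * `|Gr i z|.
Proof.
have : `|softsgn' (W z)| <= 1 by rewrite ger0_norm ?softsgn'_le1 ?softsgn'_ge0.
rewrite /gN; move: (softsgn' _) => g' g'1.
rewrite !normrM mulrA ler_pM ?mulr_ge0//.
  by rewrite ler_pM// ?ger0_norm ?weight_ge0 ?weight_le ?(ltW nu0).
by rewrite ler_piMl.
Qed.

Let mgB a i : measurable_fun setT (gB a i).
Proof.
apply: measurable_funM; first exact: mw.
by apply: measurable_funM; [apply: (measurableT_comp measurable_softsgn)|]; exact: mes.
Qed.

Let gB_le a i z : 0 <= a -> `|gB a i z| <= T * `|Gr i z|.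
Proof.
move=> a0; have := softsgn_le1 (W z); rewrite /gB; move: (softsgn _) => g g1.
rewrite !normrM ler_pM ?mulr_ge0//; last by rewrite ler_piMl.
by rewrite ger0_norm ?weight_ge0 ?weight_le.
Qed.

Let supp_mul (F : X * RR -> R) i (c : X * RR -> R) :
  (forall z, F z = c z * Gr i z) -> forall z, F z != 0 -> 0 < z.2 < T.
Proof.
move=> E z; rewrite E; have [->|G0 _] := eqVneq (Gr i z) 0; first by rewrite mulr0 eqxx.
by case: (hG i) => _ _; apply.
Qed.

Let tkW : time_kernel mu T (fun w => W w.1 * gW (w.1.1, w.2)).
Proof. by case: hW => iW _ sW; exact: (time_kernel_bounded iW mgW gW_le sW gW_supp). Qed.

Let tkG i : time_kernel mu T (fun w => Gr i w.1 * gN i (w.1.1, w.2)).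
Proof.
case: (hG i) => iG iG2 sG; apply: time_kernel_sq => //.
- exact: mgN.
- exact: (sq_dom (hG i) (mgN i) (gN_le i)).
- apply: (supp_mul (i := i) (c := fun z => weight 0 z.2 * (nu * softsgn' (W z)))).
  by move=> z; rewrite /gN !mulrA.
Qed.

Let tkB a i : 0 <= a -> time_kernel mu T (fun w => Bf i w.1 * gB a i (w.1.1, w.2)).
Proof.
move=> a0; case: (hB i) => iB iB2 sB; apply: time_kernel_sq => //.
- exact: mgB.
- by apply: (sq_dom (hG i) (mgB a i)) => z; exact: gB_le.
- apply: (supp_mul (i := i) (c := fun z => weight a z.2 * softsgn (W z))).
  by move=> z; rewrite /gB !mulrA.
Qed.

Let iflux : m.-integrable setT (EFin \o flux).
Proof.
have : m.-integrable setT (fun z => \sum_(i < n) (Bf i z * Gr i z)%:E)%E.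
  apply: integrable_sum => // i _.
  have [_ iB _] := hB i; have [_ iG _] := hG i.
  by apply: integrable_mul_sq iB iG; exact: mes.
by apply: eq_integrable => // z _; rewrite /= /flux sumEFin.
Qed.

Let tkF : time_kernel mu T (fun w => flux w.1 * gW (w.1.1, w.2)).
Proof.
apply: (time_kernel_bounded iflux mgW gW_le _ gW_supp) => z f0.
have [i Gi] : exists i, Gr i z != 0.
  apply/existsP; apply: contraNT f0; rewrite negb_exists => /forallP G0.
  by rewrite /flux big1// => i _; have := G0 i; rewrite negbK => /eqP ->; rewrite mulr0.
by case: (hG i) => _ _; apply.
Qed.

(** The kernels of the time derivative, of viscosity plus convection, and of
    the convection in the form in which the divergence condition controls it. *)
Let KW (w : (X * RR) * RR) : R := W w.1 * gW (w.1.1, w.2).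
Let KN (w : (X * RR) * RR) : R :=
  \sum_i Gr i w.1 * gN i (w.1.1, w.2) + flux w.1 * gW (w.1.1, w.2).
Let KB a (w : (X * RR) * RR) : R := \sum_i Bf i w.1 * gB a i (w.1.1, w.2).

Let tkN : time_kernel mu T KN.
Proof. by apply: time_kernelD tkF; apply: time_kernel_sum. Qed.

Let tkBs a : 0 <= a -> time_kernel mu T (KB a).
Proof. by move=> a0; apply: time_kernel_sum => i; exact: tkB. Qed.

Let JW := kcorr mu KW.
Let JN := kcorr mu KN.
Let JB a := kcorr mu (KB a).

Let tshear0 (z : X * RR) : tshear (z, 0) = (z, z.2).
Proof. by case: z => x s; rewrite /tshear/= addr0. Qed.

(** At zero lag the viscous term is nu softsgn'(W) |grad W|^2, up to the
    weight, and the convection terms of the two kernels agree. *)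
Let JN_ge : JB 0 0 <= JN 0.
Proof.
have z0 : 0 <= (0 : R) by [].
apply: le_Rintegral => //.
- exact: integrable_kcorr (tkBs z0).
- exact: integrable_kcorr tkN.
move=> z _; rewrite tshear0 /KB /KN/=.
rewrite -[leLHS]add0r; apply: lerD.
  apply: sumr_ge0 => i _; case: z => x s /=; rewrite /gN/=.
  rewrite mulrCA mulr_ge0// mulrCA mulr_ge0 ?(ltW nu0)// mulrCA mulr_ge0 ?softsgn'_ge0//.
  by rewrite -expr2 sqr_ge0.
case: z => x s /=; rewrite /flux mulr_suml le_eqVlt; apply/orP; left; apply/eqP.
by apply: eq_bigr => i _; rewrite /gB /gW/=; ring.
Qed.

Let ge0_Rintegral_ae (I : RR -> R) : leb.-integrable setT (EFin \o I) ->
  {ae leb, forall s, 0 <= I s} -> 0 <= \int[leb]_s I s.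
Proof.
move=> iI I0; rewrite (_ : \int[leb]_s I s = \int[leb]_s `|I s|).
  by apply: Rintegral_ge0 => s _.
rewrite /Rintegral; congr fine; apply: ae_eq_integral => //.
- exact: measurable_int iI.
- exact: measurable_int (integrable_abse iI).
by apply: filterS I0 => s I0 _ /=; rewrite ger0_norm.
Qed.

Let Ck_shift k (f : R -> R) c : Ck k f -> Ck k (fun t => f (t + c)).
Proof.
move=> Cf; apply: (@Ck_comp _ _ _ f (fun t => t + c)) => //.
by apply: CkD; [exact: Ck_id|exact: Ck_cst].
Qed.

Let is_derive_shift (f f' : R -> R) c : (forall x, is_derive x (1 : R) f (f' x)) ->
  forall x, is_derive x (1 : R) (fun t => f (t + c)) (f' (x + c)).
Proof.
move=> ff' x; rewrite -[X in is_derive _ _ _ X]mulr1.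
apply: (@is_derive_comp1 _ _ f (fun t => t + c)) => //.
by rewrite -[X in is_derive _ _ _ X]addr0; apply: is_deriveD.
Qed.

(** The divergence condition for psi(t) = weight(s) P'(t - s), integrated over s,
    says that a mean of JB a over the lags in [-de, 0] is nonnegative; by
    continuity so is the value at 0.  The weight vanishes for s <= a and
    de < a, so that psi is supported in positive times. *)
Let JB_ge0 a : 0 < a -> 0 <= JB a 0.
Proof.
move=> a0; rewrite leNgt; apply/negP => J0.
pose c := - JB a 0 / 2; have c0 : 0 < c by rewrite divr_gt0// oppr_gt0.
have tk := tkBs (ltW a0).
have [dl dl0 dlP] := kcorr_near 0 tk c0.
pose de : R := Num.min dl (a / 2).
have de0 : 0 < de by rewrite lt_min dl0 divr_gt0.
have dea : de <= a / 2 by rewrite ge_min lexx orbT.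
have dedl : de <= dl by rewrite ge_min lexx.
have [P [P' [C [[CP' dP _] bP lP rP [iP' P'1]]]]] := smooth_cutoff de0.
have mP' : measurable_fun [set: RR] (P' : RR -> R) by apply/measurable_EFinP; exact: measurable_int iP'.
have C0 : 0 <= C by have [p0 pC _ _] := bP 0; exact: le_trans p0 pC.
have P'C t : `|P' t| <= C by have [p0 pC _ _] := bP t; rewrite ger0_norm.
have zC (t : R) : `|0 : R| <= C by rewrite normr0.
have m0 : measurable_fun [set: RR] ((fun=> 0) : RR -> R) by exact: measurable_cst.
have [i1 i2 E] := kernel_average tk (time_kernel0 mu T) mP' m0 P'C zC.
have Ige0 : 0 <= \int[leb]_s (\int[m]_z (P' (z.2 - s) * KB a (z, s) + 0 * 0)).
  apply: ge0_Rintegral_ae; first exact: i2.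
  apply: filterS div => s sdiv.
  have KBE z : KB a (z, s) = weight a s * \sum_i Bf i z * (softsgn (W (z.1, s)) * Gr i (z.1, s)).
    by rewrite /KB /gB/= mulr_sumr; apply: eq_bigr => i _; ring.
  have [asT|asT] := boolP ((a < s) && (s < T)); last first.
    by apply: Rintegral_ge0 => z _; rewrite KBE /weight (negPf asT) mul0r !mulr0 addr0.
  have /andP[as_ sT] := asT.
  have s0 : 0 < s < T by rewrite sT (lt_trans a0).
  have := sdiv s0 (fun t => weight a s * P' (t + - s)) (a - de) (T * C).
  have h1 k : Ck k (fun t => weight a s * P' (t + - s)).
    by apply: CkM; [exact: Ck_cst|exact: Ck_shift].
  have h2 t : 0 <= weight a s * P' (t + - s) <= T * C.
    have [p0 pC _ _] := bP (t - s).
    by rewrite mulr_ge0//= ler_pM// weight_le// ltW.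
  have h3 : 0 < a - de.
    by rewrite subr_gt0 (le_lt_trans dea)// gtr_pMr// invf_lt1// ltr1n.
  have h4 t : t <= a - de \/ s <= t -> weight a s * P' (t + - s) = 0.
    case=> [ta|st].
      rewrite (lP (t - s) _).2 ?mulr0//.
      by rewrite lerBlDr (le_trans ta)// [leRHS]addrC lerD2r ltW.
    by rewrite (rP (t - s) _).2 ?mulr0// subr_ge0.
  move=> /(_ h1 h2 h3 h4); congr (0 <= _); apply: eq_Rintegral => z _.
  by rewrite KBE mul0r addr0; ring.
move: Ige0; rewrite -E => Ige0.
have : \int[leb]_r (P' r * kcorr mu (KB a) r + 0 * kcorr mu (fun=> 0) r) <= \int[leb]_r (- c * P' r).
  apply: le_Rintegral => //.
    exact: (@integrableZl _ _ _ leb setT measurableT (- c) _ iP').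
  move=> r _; rewrite mul0r addr0.
  have [rde|rde] := ltP r (- de); first by rewrite (lP r (ltW rde)).2 mul0r mulr0.
  have [r0|r0] := ltP 0 r; first by rewrite (rP r (ltW r0)).2 mul0r mulr0.
  rewrite [leRHS]mulrC ler_wpM2l//; first by have [] := bP r.
  have rd : `|r - 0| <= dl by rewrite subr0 ler0_norm// lerNl (le_trans _ rde)// lerN2.
  have := dlP r rd; rewrite ler_norml => /andP[_]; rewrite lerBlDr => /le_trans; apply.
  by rewrite le_eqVlt; apply/orP; left; apply/eqP; rewrite -/(JB a) /c; field.
rewrite RintegralZl// P'1 mulr1 => h.
by have := le_trans Ige0 h; rewrite oppr_ge0 leNgt c0.
Qed.

(** The divergence condition only concerns positive times; a tends to 0. *)
Let JB0_ge0 : 0 <= JB 0 0.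
Proof.
have z0 : 0 <= (0 : R) by [].
have i0 := integrable_kcorr 0 (tkBs z0).
pose a k : R := k.+1%:R^-1.
have a_gt0 k : 0 < a k by rewrite invr_gt0.
have ia k := integrable_kcorr 0 (tkBs (ltW (a_gt0 k))).
have KBa k z : KB (a k) (tshear (z, 0)) = (a k < z.2)%R%:R * KB 0 (tshear (z, 0)).
  rewrite tshear0; case: z => x s; rewrite /KB/= mulr_sumr; apply: eq_bigr => i _.
  rewrite /gB/= /weight; case: ltP => [as_|_] /=; last by rewrite !mul0r mulr0.
  by rewrite mul1r (lt_trans (a_gt0 k)).
have cJ : JB (a k) 0 @[k --> \oo] --> JB 0 0.
  have [|||||_ _] := @dominated_convergence _ _ _ m setT measurableT
    (fun k z => (KB (a k) (tshear (z, 0)))%:E) (EFin \o (fun z => KB 0 (tshear (z, 0))))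
    (abse \o (EFin \o (fun z => KB 0 (tshear (z, 0))))).
  - by move=> k; exact: measurable_int (ia k).
  - exact: measurable_int i0.
  - apply: aeW => z _; apply: cvg_near_cst.
    have [z2|z2] := ltP 0 z.2; last first.
      apply: nearW => k; rewrite KBa ltNge (le_trans z2) ?(ltW (a_gt0 k))//= mul0r.
      congr EFin; rewrite tshear0 /KB big1// => i _; rewrite /gB/= /weight.
      by rewrite ltNge z2/= mul0r mulr0.
    have [N _ HN] := near_infty_natSinv_lt (PosNum z2).
    by exists N => // k /HN /= h; rewrite KBa h mul1r.
  - exact: integrable_abse.
  - apply: aeW => z k _ /=; rewrite lee_fin KBa normrM ler_piMl//.
    by case: ltP => _; rewrite ?normr0 ?normr1.
  have -> : (\int[m]_z (EFin \o (fun z => KB 0%R (tshear (z, 0%R)))) z)%E = (JB 0 0)%:E.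
    by rewrite /JB /kcorr /Rintegral fineK//; exact: integrable_fin_num.
  by move/fine_cvg.
rewrite -(cvg_lim _ cJ)//; apply: limr_ge.
  by apply/cvg_ex; exists (JB 0 0).
by apply: nearW => k; exact: JB_ge0.
Qed.

(** The equation for psi(t) = k(t - s) weight(s) with k = P(. + h) - P,
    integrated over s.  Since P = 1 on positive numbers, k vanishes there, as
    the hypothesis on psi requires. *)
Let eqn_average (P P' : R -> R) (C h : R) : 0 <= h ->
  (forall k, Ck k P') -> (forall x, is_derive x (1 : R) P (P' x)) ->
  measurable_fun [set: RR] (P : RR -> R) -> measurable_fun [set: RR] (P' : RR -> R) ->
  (forall t, [/\ 0 <= P' t, P' t <= C, 0 <= P t & P t <= 1]) ->
  (forall t, 0 <= t -> P t = 1) ->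
  leb.-integrable setT (EFin \o (fun r : RR =>
    - (P' (r + h) - P' r) * JW r + (P (r + h) - P r) * JN r)) /\
  \int[leb]_r (- (P' (r + h) - P' r) * JW r + (P (r + h) - P r) * JN r) = 0.
Proof.
move=> h0 CP' dP mP mP' bP P1.
pose k1 (t : R) := - (P' (t + h) - P' t); pose k2 (t : R) := P (t + h) - P t.
have mk1 : measurable_fun [set: RR] (k1 : RR -> R).
  apply: measurableT_comp => //; apply: measurable_funB => //.
  exact: (measurable_shift (f := P')).
have mk2 : measurable_fun [set: RR] (k2 : RR -> R).
  by apply: measurable_funB => //; exact: (measurable_shift (f := P)).
have C0 : 0 <= C by have [p0 pC _ _] := bP 0; exact: le_trans p0 pC.
have k1C t : `|k1 t| <= C + 1.
  have [p0 pC _ _] := bP t; have [q0 qC _ _] := bP (t + h).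
  rewrite /k1 normrN ler_norml lerBlDr lerBrDr; apply/andP; split.
    by rewrite (le_trans _ q0)// addrC subr_le0 (le_trans pC)// lerDl.
  by rewrite (le_trans qC)// -[leLHS]addr0 lerD// lerDl.
have k2C t : `|k2 t| <= C + 1.
  have [_ _ p0 p1] := bP t; have [_ _ q0 q1] := bP (t + h).
  rewrite /k2 ler_norml lerBlDr lerBrDr; apply/andP; split.
    by rewrite (le_trans _ q0)// addrC subr_le0 (le_trans p1)// lerDr.
  by rewrite (le_trans q1)// -[leLHS]addr0 lerD// lerDr.
have [i1 i2 E] := kernel_average tkW tkN mk1 mk2 k1C k2C.
split; first exact: i1.
rewrite [LHS]E; rewrite /Rintegral (ae_eq_integral (cst 0%E))//.
- by rewrite integral0.
- exact: measurable_int i2.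
apply: filterS eqn => s seqn _.
suff I0 : \int[m]_z (k1 (z.2 - s) * KW (z, s) + k2 (z.2 - s) * KN (z, s)) = 0.
  by have := congr1 (@EFin R) I0.
have [sT|sT] := boolP ((0 < s) && (s < T)); last first.
  rewrite (_ : (fun z : X * RR => _) = (fun=> 0)).
    by rewrite Rintegral_cst// mul0r.
  apply/funext => z; rewrite /KW /KN /gN /gW /= /weight (negPf sT).
  by rewrite !mul0r !mulr0 big1 ?addr0 ?mulr0 ?addr0// => i _; rewrite mul0r mulr0.
have w0 := weight_ge0 0 s; have wT := weight_le s (lexx 0).
have h1 k : Ck k (fun t => weight 0 s * (P' (t + (- s + h)) - P' (t + - s))).
  apply: CkM; first exact: Ck_cst.
  under eq_fun do rewrite -[- _ as X in _ + X]mulN1r.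
  apply: CkD; first exact: Ck_shift.
  by apply: CkM; [exact: Ck_cst|exact: Ck_shift].
have h2 x : is_derive x (1 : R) (fun t => weight 0 s * (P (t + (- s + h)) - P (t + - s)))
    (weight 0 s * (P' (x + (- s + h)) - P' (x + - s))).
  apply: is_deriveZ; apply: is_deriveB; exact: is_derive_shift.
have e1 t : weight 0 s * (P (t + (- s + h)) - P (t + - s)) = weight 0 s * k2 (t - s).
  by rewrite /k2 addrA.
have e2 t : weight 0 s * (P' (t + (- s + h)) - P' (t + - s)) = weight 0 s * - k1 (t - s).
  by rewrite /k1 opprK addrA.
have h3 t : `|weight 0 s * (P (t + (- s + h)) - P (t + - s))| <= T * (C + 1) /\
    `|weight 0 s * (P' (t + (- s + h)) - P' (t + - s))| <= T * (C + 1).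
  rewrite e1 e2 !normrM normrN (ger0_norm w0).
  by split; rewrite ler_pM.
have h4 t : s <= t -> weight 0 s * (P (t + (- s + h)) - P (t + - s)) = 0.
  move=> st; rewrite addrA !P1 ?subrr ?mulr0// ?subr_ge0//.
  by rewrite addr_ge0// subr_ge0.
have := seqn sT _ _ _ h1 h2 h3 h4 => <-.
apply: eq_Rintegral => -[x t] _; rewrite e1 e2 /KW /KN /gN /gW/=.
rewrite [in RHS]mulrN opprK.
have -> : \sum_(i < n) Gr i (x, t) * (weight 0 s * (nu * (softsgn' (W (x, s)) * Gr i (x, s)))) =
   weight 0 s * \sum_(i < n) Gr i (x, t) * (nu * (softsgn' (W (x, s)) * Gr i (x, s))).
  by rewrite mulr_sumr; apply: eq_bigr => i _; rewrite mulrCA.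
by ring.
Qed.

(** Up to errors that vanish as the step P steepens, the averaged equation
    reads JW 0 - JW (-h) = - (integral of JN over [-h, 0]): P' is close to a
    unit mass at 0, and P(. + h) - P to the indicator of [-h, 0].  The cruder
    interval [-2h, 0] leaves room for the width of the step. *)
Let JW_increment (h e eta : R) : 0 < h -> 0 < e -> 0 <= eta ->
  (forall r, - (h + h) <= r <= 0 -> - eta <= JN r) ->
  JW 0 - JW (- h) <= e + eta * (h + h).
Proof.
move=> h0 e0 eta0 JNeta.
have e20 : 0 < e / 2 by rewrite divr_gt0.
have [d1 d10 Hd1] := kcorr_near 0 tkW e20.
have [d2 d20 Hd2] := kcorr_near (- h) tkW e20.
pose de : R := Num.min h (Num.min d1 d2).
have de0 : 0 < de by rewrite !lt_min h0 d10.
have deh : de <= h by rewrite ge_min lexx.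
have ded1 : de <= d1 by rewrite !ge_min lexx orbT.
have ded2 : de <= d2 by rewrite !ge_min lexx !orbT.
have [P [P' [C [[CP' dP homP] bP lP rP [iP' P'1]]]]] := smooth_cutoff de0.
have mP' : measurable_fun [set: RR] (P' : RR -> R) by apply/measurable_EFinP; exact: measurable_int iP'.
have mP : measurable_fun [set: RR] (P : RR -> R).
  by apply: continuous_measurable_fun => x; apply/differentiable_continuous/derivable1_diffP; case: (dP x).
have [i0 E0] := eqn_average (ltW h0) CP' dP mP mP' bP (fun t t0 => (rP t t0).1).
have iP'h : leb.-integrable setT (EFin \o (fun r : RR => P' (r + h))).
  exact: (integrable_preserved (lebesgue_shift_preserving h) iP').
have P'h1 : \int[leb]_r P' (r + h) = 1.
  rewrite -P'1; have E := congr1 fine (integral_preserved (lebesgue_shift_preserving h) iP').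
  exact: E.
pose A := JW 0 - e / 2; pose B := JW (- h) + e / 2.
pose I : RR -> R := \1_(`[- (h + h), 0]%classic : set RR).
have iI : leb.-integrable setT (EFin \o I).
  exact: (integrable_indic_itv (- (h + h)) 0 true false).
have I1 : \int[leb]_r I r = h + h.
  rewrite /Rintegral (_ : (\int[leb]_r (I r)%:E)%E = leb (`[- (h + h), 0]%classic : set RR)).
    rewrite lebesgue_measure_itv/= lte_fin oppr_lt0 addr_gt0//.
    by rewrite -EFinB/= sub0r opprK.
  by rewrite integral_indic// setIT.
have i1 : leb.-integrable setT (EFin \o (fun r : RR => A * P' r)).
  exact: (@integrableZl _ _ _ leb setT measurableT A _ iP').
have i2 : leb.-integrable setT (EFin \o (fun r : RR => - B * P' (r + h))).
  exact: (@integrableZl _ _ _ leb setT measurableT (- B) _ iP'h).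
have i3 : leb.-integrable setT (EFin \o (fun r : RR => - eta * I r)).
  exact: (@integrableZl _ _ _ leb setT measurableT (- eta) _ iI).
have i12 : leb.-integrable setT (EFin \o (fun r : RR => A * P' r + - B * P' (r + h))).
  exact: (integrableD measurableT i1 i2).
have : \int[leb]_r (A * P' r + - B * P' (r + h) + - eta * I r) <= 0.
  rewrite -E0; apply: le_Rintegral => //; first exact: (integrableD measurableT i12 i3).
  move=> r _.
  have t1 : A * P' r <= P' r * JW r.
    rewrite mulrC.
    have [rde|rde] := ltP r (- de); first by rewrite (lP r (ltW rde)).2 !mul0r.
    have [r0|r0] := ltP 0 r; first by rewrite (rP r (ltW r0)).2 !mul0r.
    apply: ler_wpM2l; first by have [] := bP r.
    have rd : `|r - 0| <= d1.
      by rewrite subr0 ler0_norm// lerNl (le_trans _ rde)// lerN2.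
    have := Hd1 r rd; rewrite ler_norml => /andP[+ _].
    by rewrite lerBrDr addrC.
  have t2 : P' (r + h) * JW r <= B * P' (r + h).
    rewrite [leRHS]mulrC.
    have [rde|rde] := ltP (r + h) (- de); first by rewrite (lP _ (ltW rde)).2 !mul0r.
    have [r0|r0] := ltP 0 (r + h); first by rewrite (rP _ (ltW r0)).2 !mul0r.
    apply: ler_wpM2l; first by have [] := bP (r + h).
    have rd : `|r - (- h)| <= d2.
      by rewrite opprK ler0_norm// lerNl (le_trans _ rde)// lerN2.
    have := Hd2 r rd; rewrite ler_norml => /andP[_].
    by rewrite lerBlDr addrC.
  have t3 : - eta * I r <= (P (r + h) - P r) * JN r.
    have k0 : 0 <= P (r + h) - P r by rewrite subr_ge0 homP// lerDl ltW.
    have k1 : P (r + h) - P r <= 1.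
      by have [_ _ _ p1] := bP (r + h); have [_ _ p0 _] := bP r; rewrite lerBlDr (le_trans p1)// lerDl.
    rewrite /I indicE; case: (boolP (r \in _)) => [|].
      rewrite inE/= in_itv/= mulr1 => /JNeta rN.
      apply: (@le_trans _ _ ((P (r + h) - P r) * - eta)); last exact: ler_wpM2l.
      by rewrite mulrN lerN2 ler_piMl.
    rewrite notin_setE/= in_itv/= mulr0 => /negP; rewrite negb_and -!ltNge => /orP[rh|r0].
      have rhd : r + h <= - de.
        by rewrite -lerBrDr (le_trans (ltW rh))// opprD lerD2r lerN2.
      have rd : r <= - de by apply: le_trans rhd; rewrite lerDl ltW.
      by rewrite (lP _ rhd).1 (lP _ rd).1 subrr mul0r.
    by rewrite (rP _ (ltW r0)).1 (rP (r + h) _).1 ?subrr ?mul0r// addr_ge0// ltW.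
  apply: lerD t3.
  have -> : - (P' (r + h) - P' r) * JW r = P' r * JW r - P' (r + h) * JW r by ring.
  by rewrite mulNr; apply: lerB.
rewrite RintegralD// RintegralD// !RintegralZl// P'1 P'h1 I1 !mulr1 /A /B.
move: (JW 0) (JW (- h)) => x y H.
rewrite -subr_ge0; move: H; rewrite -subr_ge0 sub0r.
by congr (0 <= _); field.
Qed.

Let chi (s : R) : R := if s < T then T - s else 0.

Let chi_ge0 s : 0 <= chi s.
Proof. by rewrite /chi; case: ifPn => // sT; rewrite subr_ge0 ltW. Qed.

Let measurable_chi : measurable_fun [set: RR] (chi : RR -> R).
Proof.
apply: measurable_fun_if => //.
- by apply: measurable_fun_ltr => //; exact: measurable_cst.
- by apply: measurable_funTS; apply: measurable_funB => //; exact: measurable_cst.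
Qed.

(** Potential energy at time s with the weight taken at time s + c. *)
Let pot c (z : X * RR) : R := softabs (W z) * chi (z.2 + c).

Let W_supp z : W z != 0 -> 0 < z.2 < T.
Proof. by case: hW => _ _; apply. Qed.

Let ipot c : 0 <= c -> m.-integrable setT (EFin \o pot c).
Proof.
move=> c0; have [_ iW2 _] := hW.
apply: (le_integrable _ _ _ (@integrableZl _ _ _ m setT measurableT T _ iW2)) => //.
  apply/measurable_EFinP; apply: measurable_funM.
    by apply: (measurableT_comp measurable_softabs); exact: mes.
  apply: (measurableT_comp (measurable_shift c measurable_chi)).
  exact: measurable_snd.
move=> z _ /=.
have p0 : 0 <= pot c z by rewrite mulr_ge0 ?softabs_ge0 ?chi_ge0.
have TW0 : 0 <= T * W z ^+ 2 by rewrite mulr_ge0 ?sqr_ge0 ?(ltW T0).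
rewrite lee_fin (ger0_norm p0) (ger0_norm TW0) /pot.
have [->|/W_supp/andP[z0 zT]] := eqVneq (W z) 0.
  by rewrite softabs0 mul0r mulr_ge0 ?sqr_ge0 ?(ltW T0).
rewrite mulrC ler_pM ?softabs_ge0 ?softabs_le ?chi_ge0//.
rewrite /chi; case: ifPn => [_|_]; last exact: ltW.
by rewrite gerBl addr_ge0// ltW.
Qed.

Let kappa : R := \int[m]_z (softabs (W z) * (weight 0 z.2 / T)).

Let kappaE : m.-integrable setT (EFin \o (fun z : X * RR => softabs (W z) * (weight 0 z.2 / T))).
Proof.
have := @integrableZl _ _ _ m setT measurableT T^-1 _ (ipot (lexx 0)).
apply: eq_integrable => // z _ /=; rewrite /pot addr0 -EFinM; congr EFin.
have [->|/W_supp zT] := eqVneq (W z) 0; first by rewrite softabs0 !mul0r mulr0.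
by rewrite /weight zT /chi; case/andP: zT => _ ->; rewrite mulrC -mulrA.
Qed.

(** Convexity gives softsgn(W(s)) (W(s) - W(s - h)) >= softabs(W(s)) -
    softabs(W(s - h)).  After a translation by h in the last term, the weights
    differ by min(h, T - s), which is at least h (T - s) / T. *)
Let JW_energy (h : R) : 0 < h -> h <= T -> h * kappa <= JW 0 - JW (- h).
Proof.
move=> h0 hT.
have i0 := integrable_kcorr 0 tkW; have ih := integrable_kcorr (- h) tkW.
have p0 := ipot (lexx 0); have ph := ipot (ltW h0).
have phs := integrable_preserved (tshift_preserving mu (- h)) ph.
rewrite /JW /kcorr -RintegralB//.
apply: (@le_trans _ _ (\int[m]_z (pot 0 z - pot h (tshift (- h) z)))); last first.
  apply: le_Rintegral => //.
  - exact: (integrableB measurableT p0 phs).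
  - exact: (integrableB measurableT i0 ih).
  move=> -[x s] _; rewrite /pot /KW /gW /tshift /tshear/= !addr0 subrK -!mulrBl.
  have [->|W0] := eqVneq (W (x, s)) 0.
    rewrite softabs0 softsgn0 !mulr0 sub0r mulNr oppr_le0.
    by rewrite mulr_ge0 ?softabs_ge0.
  have /= sT := W_supp W0.
  have -> : chi s = weight 0 s by rewrite /weight sT /chi; case/andP: sT => _ ->.
  rewrite mulrC [leRHS]mulrCA ler_wpM2l// [leRHS]mulrC.
  exact: softabs_convex.
rewrite RintegralB//.
have -> : \int[m]_z pot h (tshift (- h) z) = \int[m]_z pot h z.
  have E := congr1 fine (integral_preserved (tshift_preserving mu (- h)) ph).
  exact: E.
rewrite -RintegralB// /kappa -RintegralZl//.
apply: le_Rintegral => //.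
- exact: (@integrableZl _ _ _ m setT measurableT h _ kappaE).
- exact: (integrableB measurableT p0 ph).
move=> z _; rewrite /pot addr0 -mulrBr mulrCA.
have [->|/W_supp zT] := eqVneq (W z) 0; first by rewrite softabs0 !mul0r.
rewrite ler_wpM2l ?softabs_ge0// /weight zT /chi; case/andP: zT => z0 zT; rewrite zT.
have Tz : 0 < T - z.2 by rewrite subr_gt0.
case: ifPn => [zh|_].
  have -> : T - z.2 - (T - (z.2 + h)) = h by ring.
  rewrite ger_pMr// ler_pdivrMr// mul1r gerBl; exact: ltW.
by rewrite subr0 mulrCA ger_pMr// ler_pdivrMr// mul1r.
Qed.

(** JN 0 is nonnegative, hence JN is at least -kappa/4 at small lags if kappa
    is positive; then h kappa is at most 3/4 h kappa. *)
Let kappa_le0 : kappa <= 0.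
Proof.
rewrite leNgt; apply/negP => k0.
have k40 : 0 < kappa / 4 by rewrite divr_gt0.
have [dl dl0 Hdl] := kcorr_near 0 tkN k40.
pose h : R := Num.min T (dl / 2).
have h0 : 0 < h by rewrite lt_min T0 divr_gt0.
have hT : h <= T by rewrite ge_min lexx.
have hdl : h <= dl / 2 by rewrite ge_min lexx orbT.
have e0 : 0 < h * (kappa / 4) by rewrite mulr_gt0.
have HN r : - (h + h) <= r <= 0 -> - (kappa / 4) <= JN r.
  move=> /andP[rh r0].
  have rdl : `|r - 0| <= dl.
    rewrite subr0 ler0_norm// lerNl (le_trans _ rh)// lerN2 [leRHS](splitr dl).
    by rewrite lerD.
  have := Hdl r rdl; rewrite ler_norml => /andP[+ _].
  by rewrite lerBrDr => /(le_trans _); apply; rewrite lerDl (le_trans JB0_ge0 JN_ge).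
have := le_trans (JW_energy h0 hT) (JW_increment h0 e0 (ltW k40) HN).
have -> : h * (kappa / 4) + kappa / 4 * (h + h) = h * kappa * (3 / 4) by field.
rewrite ler_pMr ?mulr_gt0//.
by apply/negP; rewrite -ltNge ltr_pdivrMr// mul1r ltr_nat.
Qed.

(** The weighted energy kappa is the integral of a nonnegative function that
    vanishes only where W does. *)
Theorem energy_uniqueness : {ae m, forall z, W z = 0}.
Proof.
pose f z := softabs (W z) * (weight 0 z.2 / T).
have f0 z : 0 <= f z by rewrite mulr_ge0 ?softabs_ge0// divr_ge0 ?weight_ge0// ltW.
have : (\int[m]_z `|(EFin \o f) z| = 0)%E.
  rewrite (eq_integral (EFin \o f)); last by move=> z _ /=; rewrite ger0_norm.
  have fn := integrable_fin_num measurableT kappaE.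
  rewrite -(fineK fn) -[fine _]/kappa; congr EFin; apply/le_anti.
  by rewrite kappa_le0/=; apply: Rintegral_ge0 => z _; exact: f0.
move/(ae_eq_integral_abs m measurableT (measurable_int _ kappaE)).
apply: filterS => z /(_ I)/= [] fz; apply/eqP/negPn/negP => W0.
have := W_supp W0 => zT; move: fz; rewrite /f /weight zT => /eqP.
case/andP: zT => _ zT.
rewrite mulf_eq0 mulf_eq0 invr_eq0 (subr_eq0 T) (gt_eqF zT) (gt_eqF T0) !orbF => /eqP.
by move/softabs_eq0/eqP; rewrite (negPf W0).
Qed.

End energy.

(** * Square integrability on the space-time cylinder *)

Section sobolev_bounds.
Context {R : realType} {n : nat}.
Variables (Omega : set 'rV[R]_n) (T : R).
Local Notation leb := (@lebesgue_measure R).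
Local Notation RR := (measurableTypeR R).
Local Notation mu := (@lebesgue_rV R n).
Local Notation m := (spacetime mu).
Hypothesis Omega_open : open Omega.

Let mO : measurable Omega. Proof. exact: open_measurable_rV. Qed.

Lemma measurable_QT : measurable (QT Omega T : set ('rV[R]_n * RR)).
Proof. by apply: measurableX => //; exact: measurable_itv. Qed.

Lemma W12_norm_sqr v (g : 'rV[R]_n -> 'rV[R]_n) : ((W12_norm Omega v g) `^ 2 =
  \int[mu]_(x in Omega) (v x ^+ 2 + dot (g x) (g x))%:E)%E.
Proof.
have dot0 x : 0 <= dot (g x) (g x) :> R by apply: sumr_ge0 => i _; rewrite -expr2 sqr_ge0.
rewrite /W12_norm -poweRrM mulVf ?pnatr_eq0// poweRe1//.
by apply: integral_ge0 => x _; rewrite lee_fin addr_ge0 ?sqr_ge0.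
Qed.

Lemma patch_sq (F : 'rV[R]_n * RR -> R) z :
  (F \_ (QT Omega T)) z ^+ 2 = ((fun z => F z ^+ 2) \_ (QT Omega T)) z.
Proof. by rewrite !patchE; case: ifP => //; rewrite expr0n. Qed.

(** Tonelli's theorem turns the norm in L2(0, T; W12) into an integral over the
    cylinder. *)
Lemma in_L2_W12_0_finite (u : 'rV[R]_n * R -> R) (g : 'rV[R]_n * R -> 'rV[R]_n) :
  in_L2_W12_0 Omega T u g ->
  m.-integrable setT (EFin \o
    ((fun z : 'rV[R]_n * RR => u z ^+ 2 + dot (g z) (g z)) \_ (QT Omega T))).
Proof.
case=> mu_ mg _ fin; set E := (fun z : 'rV[R]_n * RR => _).
have E0 z : 0 <= E z.
  by rewrite addr_ge0 ?sqr_ge0// sumr_ge0// => i _; rewrite -expr2 sqr_ge0.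
have EQ0 z : 0 <= (E \_ (QT Omega T)) z by rewrite patchE; case: ifP.
have mE : measurable_fun (QT Omega T : set ('rV[R]_n * RR)) E.
  apply: measurable_funD; first exact: measurable_funX.
  by rewrite /dot; apply: measurable_sum => i; apply: measurable_funM; exact: mg.
have mEQ : measurable_fun setT (EFin \o (E \_ (QT Omega T))).
  by apply/measurable_EFinP/(measurable_restrictT _ _).1 => //; exact: measurable_QT.
apply/integrableP; split => //.
have EQ0' z : (0 <= (EFin \o (E \_ (QT Omega T))) z)%E by rewrite lee_fin.
under eq_integral do rewrite gee0_abs//.
apply: (@le_lt_trans _ _ (\int[leb]_t \int[mu]_x ((E \_ (QT Omega T)) (x, t))%:E)%E).
  by rewrite le_eqVlt; apply/orP; left; apply/eqP; exact: (@fubini_tonelli2 _ _ _ _ _ mu leb _ mEQ EQ0').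
have : ('N[leb]_2%:E [(fun t : R => W12_norm Omega (fun x => u (x, t)) (fun x => g (x, t)))
         \_ `]0%R, T[] `^ 2 < +oo)%E by rewrite poweR_lty.
rewrite poweR_Lnorm// => fin2; apply: le_lt_trans fin2.
rewrite le_eqVlt; apply/orP; left; apply/eqP; apply: eq_integral => t _.
rewrite [in RHS]patchE; case: ifPn => [|]; rewrite ?inE ?notin_setE/= => tT.
  rewrite gee0_abs; last exact: poweR_ge0.
  rewrite W12_norm_sqr [RHS]integral_mkcond; apply: eq_integral => x _.
  rewrite !patchE /QT; case: (boolP (x \in Omega)) => [xO|xO].
    by rewrite mem_set//; split => //; exact: set_mem.
  by rewrite memNset//; case=> /= Ox _; rewrite mem_set in xO.
rewrite normr0 powR0//; apply: integral0_eq => x _.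
by rewrite patchE memNset//; case=> _ /= tT'; apply: tT.
Qed.

Let sq_of_finite (F E : 'rV[R]_n * RR -> R) :
  measurable_fun (QT Omega T : set ('rV[R]_n * RR)) F ->
  m.-integrable setT (EFin \o (E \_ (QT Omega T))) -> (forall z, F z ^+ 2 <= E z) ->
  measurable_fun setT (F \_ (QT Omega T)) /\
  m.-integrable setT (EFin \o (fun z => (F \_ (QT Omega T)) z ^+ 2)).
Proof.
move=> mF iE FE.
have mFQ : measurable_fun setT (F \_ (QT Omega T)).
  by apply/(measurable_restrictT _ _).1 => //; exact: measurable_QT.
split=> //; apply: (le_integrable _ _ _ iE) => //.
  by apply/measurable_EFinP; exact: measurable_funX.
move=> z _; rewrite /= lee_fin patch_sq !patchE; case: ifP => // _.
by rewrite !ger0_norm ?sqr_ge0// (le_trans _ (FE z))// sqr_ge0.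
Qed.

Lemma in_L2_W12_0_sq (u : 'rV[R]_n * R -> R) (g : 'rV[R]_n * R -> 'rV[R]_n) :
  in_L2_W12_0 Omega T u g ->
  (measurable_fun setT (u \_ (QT Omega T) : 'rV[R]_n * RR -> R) /\
  m.-integrable setT (EFin \o (fun z => (u \_ (QT Omega T)) z ^+ 2))) /\
  forall i, measurable_fun setT ((fun z => g z ord0 i) \_ (QT Omega T) : 'rV[R]_n * RR -> R) /\
    m.-integrable setT (EFin \o (fun z => ((fun z => g z ord0 i) \_ (QT Omega T)) z ^+ 2)).
Proof.
move=> H; have iE := in_L2_W12_0_finite H; have [mu_ mg _ _] := H.
have dotE z : 0 <= dot (g z) (g z) :> R by apply: sumr_ge0 => i _; rewrite -expr2 sqr_ge0.
split=> [|i].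
  by apply: (sq_of_finite mu_ iE) => z; rewrite lerDl.
apply: (sq_of_finite (mg i) iE) => z.
apply: (@le_trans _ _ (dot (g z) (g z))); last by rewrite lerDr sqr_ge0.
rewrite /dot (bigD1 i)//= -expr2 lerDl; apply: sumr_ge0 => j _.
by rewrite -expr2 sqr_ge0.
Qed.

Lemma Lfun2_sq (F : 'rV[R]_n * RR -> R) : in_Lp (lebesgue_xt n) (QT Omega T) 2%:E F ->
  measurable_fun setT (F \_ (QT Omega T)) /\
  m.-integrable setT (EFin \o (fun z => (F \_ (QT Omega T)) z ^+ 2)).
Proof.
move=> H; split; last exact: Lfun2_integrable_sqr H.
by have := sub_Lfun_mfun H; rewrite inE.
Qed.

Hypothesis Omega_bounded : bounded_set Omega.

(** A bounded set lies in a cube, whose measure is a product of lengths. *)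
Lemma lebesgue_rV_bounded : (mu Omega < +oo)%E.
Proof.
have [M [Mr MO]] := Omega_bounded.
pose A : set R := `[- (M + 1), M + 1]%classic.
have OA : Omega `<=` [set x | forall i : 'I_n, A (x ord0 i)].
  move=> x Ox i;   have M1 : M < M + 1 by rewrite ltrDl.
  have xM := MO _ M1 x Ox; rewrite /A/= in_itv/= -ler_norml; apply: le_trans xM.
  have /mapP[j Hj ->] : `|x ord0 i| \in [seq `|x y.1 y.2| | y : 'I_1 * 'I_n].
    by apply/mapP; exists (ord0, i) => //=; rewrite mem_enum.
  by rewrite [leRHS]/Num.norm /= mx_normrE; apply/bigmax_geP; right => /=; exists j.
have mA (i : 'I_n) : measurable (A : set RR) by exact: measurable_itv.
pose Bx : set 'rV[R]_n := [set x | forall i, A (x ord0 i)].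
have mB : (mu Bx = \prod_(i < n) leb A)%E := lebesgue_rV_box mA.
have mBx : measurable Bx.
  rewrite (_ : Bx = \bigcap_(i in [set: 'I_n]) (fun x : 'rV[R]_n => x ord0 i) @^-1` A).
    apply: fin_bigcap_measurable => // i _.
    by rewrite -[X in measurable X]setTI; apply: measurable_coord => //; exact: mA.
  by apply/seteqP; split=> [x Ax i _|x Ax i]; exact: Ax.
apply: (@le_lt_trans _ _ (mu Bx)); first by apply: le_measure; rewrite ?inE; [exact: mO|exact: mBx|exact: OA].
have leA : (leb A \is a fin_num)%E.
  by rewrite /A lebesgue_measure_itv/=; case: ifP.
suff : ((\prod_(i < n) leb A)%E \is a fin_num) by rewrite mB ltey_eq => ->.
elim/big_ind : _ => [//|x y x0 y0|i _]; first exact: fin_numM.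
exact: leA.
Qed.

Let QT_finite : (m (QT Omega T) < +oo)%E.
Proof.
have mT : measurable (`]0, T[%classic : set RR) by exact: measurable_itv.
pose J : set RR := `]0, T[%classic.
have -> : (m (QT Omega T) = mu Omega * leb J)%E.
  exact: (product_measure1E mu leb mO mT).
rewrite lte_mul_pinfty ?measure_ge0//.
  by rewrite ge0_fin_numE ?measure_ge0// lebesgue_rV_bounded.
by rewrite /J lebesgue_measure_itv/=; case: ifP => _; rewrite ?ltry// -EFinB ltry.
Qed.

(** On a set of finite measure a square integrable function is integrable. *)
Lemma L12_QT (F : 'rV[R]_n * RR -> R) : measurable_fun setT F ->
  (forall z, ~ QT Omega T z -> F z = 0) ->
  m.-integrable setT (EFin \o (fun z => F z ^+ 2)) -> L12 mu T F.
Proof.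
move=> mF F0 iF2.
have i1 : m.-integrable setT (EFin \o (\1_(QT Omega T : set ('rV[R]_n * RR)) : _ -> R)).
  apply/integrableP; split.
    by apply/measurable_EFinP; apply: measurable_indic; exact: measurable_QT.
  under eq_integral do rewrite /= ger0_norm//.
  by rewrite integral_indic ?setIT//; exact: measurable_QT.
split=> //.
  apply: (le_integrable _ _ _ (integrableD measurableT i1 iF2)) => //.
    exact/measurable_EFinP.
  move=> z _; rewrite /= lee_fin indicE.
  have [zQ|zQ] := pselect (QT Omega T z); last first.
    by rewrite (F0 _ zQ) normr0.
  have p0 : 0 <= 1 + F z ^+ 2 by rewrite addr_ge0 ?sqr_ge0.
  rewrite mem_set//= (ger0_norm p0).
  rewrite -(real_normK (num_real (F z))).
  by have := sqr_ge0 (`|F z| - 1); have := normr_ge0 (F z); nra.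
move=> z Fz; have [[_ /=]|zQ] := pselect (QT Omega T z); first by rewrite in_itv.
by move: Fz; rewrite (F0 _ zQ) eqxx.
Qed.
End sobolev_bounds.

(** * Approximation by test functions *)

Section approximation.
Context {R : realType} {n : nat}.
Variable Omega : set 'rV[R]_n.
Local Notation RR := (measurableTypeR R).
Local Notation mu := (@lebesgue_rV R n).
Hypothesis Omega_open : open Omega.

Let mO : measurable Omega. Proof. exact: open_measurable_rV. Qed.

Lemma continuous_measurable_rV (f : 'rV[R]_n -> R) : continuous f ->
  measurable_fun [set: 'rV[R]_n] (f : _ -> RR).
Proof.
move=> /continuousP cf; apply: (measurability _ (RGenOpens.measurableE R)).
by move=> _ [_ [a [b ->] <-]]; apply: measurableI => //; apply: open_measurable_rV; exact: cf.
Qed.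

Lemma smooth_grad_continuous (f : 'rV[R]_n -> R) i : smooth f ->
  continuous (fun x => grad f x ord0 i).
Proof.
move=> sf; rewrite (_ : (fun x => _) = 'D_(delta_mx ord0 i) f).
  by have [] := sf [:: delta_mx ord0 i].
by apply/funext => x; rewrite mxE.
Qed.

(** Approximation of a function together with its gradient, in the form that
    the dominated convergence theorem asks for. *)
Definition ae_approximable (v : 'rV[R]_n -> R) (g : 'rV[R]_n -> 'rV[R]_n) : Prop :=
  exists (phi : nat -> 'rV[R]_n -> R) (D : 'rV[R]_n -> R),
  [/\ forall k, test_function Omega (phi k),
      mu.-integrable setT (EFin \o D),
      {ae mu, forall x, Omega x -> phi k x @[k --> \oo] --> v x /\
        forall i, grad (phi k) x ord0 i @[k --> \oo] --> g x ord0 i} &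
      {ae mu, forall x, Omega x -> forall k i, grad (phi k) x ord0 i ^+ 2 <= D x}].

Lemma summable_cvg0 (u : nat -> R) : (forall k, 0 <= u k) ->
  (\sum_(k <oo) (u k)%:E < +oo)%E ->
  u @ \oo --> (0 : R) /\ forall k, u k <= fine (\sum_(k <oo) (u k)%:E)%E.
Proof.
move=> u0 fin.
have S0 : (0 <= \sum_(k <oo) (u k)%:E)%E by apply: nneseries_ge0 => k _ _; rewrite lee_fin.
have Sfin : (\sum_(k <oo) (u k)%:E)%E \is a fin_num by rewrite ge0_fin_numE.
have ps k : \sum_(0 <= i < k) u i <= fine (\sum_(k <oo) (u k)%:E)%E.
  rewrite -lee_fin fineK// -sumEFin; apply: nneseries_lim_ge => i _ _.
  by rewrite lee_fin.
split; last first.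
  move=> k; apply: le_trans (ps k.+1); rewrite big_nat_recr//= lerDr.
  by apply: sumr_ge0.
apply: cvg_series_cvg_0; apply: nondecreasing_is_cvgn.
  apply/nondecreasing_seqP => k; rewrite /series/= big_nat_recr//= lerDl//.
by exists (fine (\sum_(k <oo) (u k)%:E)%E) => _ [k _ <-]; exact: ps.
Qed.

Lemma cvg_of_sq (a b : nat -> R) (l : R) : (forall k, (l - a k) ^+ 2 <= b k) ->
  b @ \oo --> (0 : R) -> a @ \oo --> l.
Proof.
move=> ab b0; apply/cvgrPdist_le => e e0.
have e20 : 0 < e ^+ 2 by rewrite exprn_gt0.
have [N _ HN] := (cvgrPdist_le _ _).1 b0 _ e20; exists N => // k Nk /=.
rewrite -ler_sqr ?nnegrE ?(ltW e0)// real_normK ?num_real//.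
apply: (le_trans (ab k)); apply: le_trans (HN k Nk).
by rewrite sub0r normrN ler_norm.
Qed.

(** Test functions at distance less than 2^-(k+1) in W12 have squared errors
    whose sum over k is integrable.  Where the sum is finite the errors tend to
    0, and the sum also dominates them. *)
Lemma in_W12_0_approximable v g : in_W12_0 Omega v g -> ae_approximable v g.
Proof.
move=> [[Lv Lg _] Happ].
pose e k : R := 1 / (2 ^ k.+1)%:R.
have e0 k : 0 < e k by rewrite divr_gt0// ltr0n expn_gt0.
have e1 k : e k <= 1.
  by rewrite /e ler_pdivrMr ?ltr0n ?expn_gt0// mul1r ler1n expn_gt0.
pose phi k := projT1 (cid2 (Happ (e k) (e0 k))).
have tphi k : test_function Omega (phi k) by rewrite /phi; case: cid2.
have nphi k : (W12_norm Omega (fun x => v x - phi k x)%R (fun x => g x - grad (phi k) x)%R < (e k)%:E)%E.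
  by rewrite /phi; case: cid2.
pose E k x := (v x - phi k x) ^+ 2 + dot (g x - grad (phi k) x) (g x - grad (phi k) x).
have dot0 (y : 'rV[R]_n) : 0 <= dot y y by apply: sumr_ge0 => i _; rewrite -expr2 sqr_ge0.
have E0 k x : 0 <= E k x by rewrite addr_ge0 ?sqr_ge0.
have dotge (y : 'rV[R]_n) i : y ord0 i ^+ 2 <= dot y y.
  by rewrite /dot (bigD1 i)//= -expr2 lerDl; apply: sumr_ge0 => j _; rewrite -expr2 sqr_ge0.
have mLp (F : 'rV[R]_n -> R) : in_Lp mu Omega 2%:E F -> measurable_fun Omega F.
  move=> LF; apply/(measurable_restrictT _ mO).
  by have := sub_Lfun_mfun LF; rewrite inE.
have mphi k : measurable_fun Omega (phi k).
  apply: measurable_funTS; apply: continuous_measurable_rV.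
  by have [/(_ [::])[]] := tphi k.
have mgphi k i : measurable_fun Omega (fun x => grad (phi k) x ord0 i).
  apply: measurable_funTS; apply: continuous_measurable_rV.
  by apply: smooth_grad_continuous; case: (tphi k).
have gE k x i : (g x - grad (phi k) x) ord0 i = g x ord0 i - grad (phi k) x ord0 i.
  by rewrite mxE [X in _ + X]mxE.
have mE k : measurable_fun Omega (E k).
  apply: measurable_funD; first by apply: measurable_funX; apply: measurable_funB => //; exact: mLp.
  rewrite /dot; apply: measurable_sum => i.
  have mi : measurable_fun Omega (fun x => (g x - grad (phi k) x) ord0 i).
    by under eq_fun do rewrite gE; apply: measurable_funB => //; exact: mLp.
  exact: measurable_funM.
have intE k : (\int[mu]_(x in Omega) (E k x)%:E <= (e k)%:E)%E.
  rewrite -W12_norm_sqr; have := nphi k.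
  have : (0 <= W12_norm Omega (fun x => v x - phi k x)%R (fun x => g x - grad (phi k) x)%R)%E.
    exact: poweR_ge0.
  case: (W12_norm _ _ _) => [r||]//; rewrite poweR_EFin lee_fin lte_fin => r0 re.
  rewrite powR_mulrn//.
  rewrite lee_fin (@le_trans _ _ r)//; last exact: ltW.
  by rewrite expr2 ler_piMl// (le_trans (ltW re)).
pose S x := (\sum_(k <oo) (E k x)%:E)%E.
have mS : measurable_fun Omega S.
  apply: ge0_emeasurable_sum => // k; first by move=> x _ _; rewrite lee_fin.
  by move=> _; exact/measurable_EFinP.
have S0 x : (0 <= S x)%E by apply: nneseries_ge0 => k _ _; rewrite lee_fin.
have iS : mu.-integrable Omega S.
  apply/integrableP; split=> //.
  under eq_integral do rewrite gee0_abs//.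
  rewrite integral_nneseries//; first last.
  - by move=> k x _; rewrite lee_fin.
  - by move=> k; exact/measurable_EFinP.
  apply: (@le_lt_trans _ _ (\sum_(k <oo) (e k)%:E)%E); last first.
    by apply: le_lt_trans (epsilon_trick0 xpredT ler01) _; exact: ltry.
  by apply: lee_nneseries => // k _ _; apply: integral_ge0 => x _; rewrite lee_fin.
pose V2 x := \sum_i g x ord0 i ^+ 2.
have iV2 : mu.-integrable Omega (EFin \o V2).
  have isq (F : 'rV[R]_n -> R) : in_Lp mu Omega 2%:E F ->
      mu.-integrable Omega (EFin \o (fun x => F x ^+ 2)).
    move=> LF; apply/integrable_mkcond => //.
    have := Lfun2_integrable_sqr LF; apply: eq_integrable => // x _ /=.
    by rewrite !patchE; case: ifP; rewrite /= ?expr0n.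
  have i2 : mu.-integrable Omega (fun x => \sum_(i < n) (g x ord0 i ^+ 2)%:E)%E.
    by apply: integrable_sum => // i _; exact: isq.
  by apply: eq_integrable i2 => // x _ /=; rewrite sumEFin.
pose D x := (2 * V2 x + 2 * fine (S x)).
have iD : mu.-integrable Omega (EFin \o D).
  have i1 := @integrableZl _ _ _ mu Omega mO 2 _ iV2.
  have ifS : mu.-integrable Omega (EFin \o (fine \o S)).
    apply: le_integrable iS => //.
      apply/measurable_EFinP.
      exact: (measurableT_comp (@fine_measurable R setT measurableT) mS).
    by move=> x _ /=; case: (S x) => [r||] //=; rewrite normr0 leey.
  have i2 := @integrableZl _ _ _ mu Omega mO 2 _ ifS.
  exact: (integrableD mO i1 i2).
have S_ae : {ae mu, forall x, Omega x -> (S x < +oo)%E}.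
  apply: filterS (integrable_ae mO iS) => x fx Ox.
  by rewrite -ge0_fin_numE// fx.
exists phi, (D \_ Omega); split=> //.
- have /integrable_mkcond := iD => /(_ mO).
  by apply: eq_integrable => // x _ /=; rewrite !patchE; case: ifP.
- apply: filterS S_ae => x Sx Ox; have [Ec _] := summable_cvg0 (fun k => E0 k x) (Sx Ox).
  split=> [|i].
    by apply: cvg_of_sq Ec => k; rewrite lerDl.
  apply: cvg_of_sq Ec => k; rewrite -gE; apply: (le_trans (dotge _ _)).
  by rewrite lerDr sqr_ge0.
- apply: filterS S_ae => x Sx Ox k i; have [_ Eb] := summable_cvg0 (fun k => E0 k x) (Sx Ox).
  have Dx : (D \_ Omega) x = D x by rewrite patchE mem_set.
  have young (a b : R) : a ^+ 2 <= 2 * b ^+ 2 + 2 * (b - a) ^+ 2.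
    by have := sqr_ge0 (2 * b - a); nra.
  rewrite Dx /D; apply: (le_trans (young _ (g x ord0 i))); apply: lerD; rewrite ler_wpM2l//.
  apply: le_trans (Eb k); rewrite -gE; apply: (le_trans (dotge _ _)).
  by rewrite lerDr sqr_ge0.
Qed.

Lemma smooth_derivable (V : normedModType R) (f : V -> R) x w : smooth f -> derivable f x w.
Proof. by move=> sf; have [_] := sf [::]; apply. Qed.

(** The support relative to A need only be enclosed in a compact subset of A. *)
Lemma closure_supp_sub (V : normedModType R) (A : set V) (f : V -> R) (B : set V) :
  closed B -> compact B -> B `<=` A ->
  (forall x, A x -> f x != 0 -> B x) ->
  let supp := closure (A `&` [set x | f x != 0]) in compact supp /\ supp `<=` A.
Proof.
move=> cB kB BA fB supp.
have sB : supp `<=` B.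
  rewrite /supp [X in _ `<=` X]((closure_id B).1 cB); apply: closure_subset => x [Ax fx].
  exact: fB.
split; last exact: subset_trans BA.
by apply: subclosed_compact kB sB; exact: closed_closure.
Qed.

Lemma test_functionB (f g : 'rV[R]_n -> R) : test_function Omega f ->
  test_function Omega g -> test_function Omega (fun x => f x - g x).
Proof.
move=> [sf kf fO] [sg kg gO].
have [] := @closure_supp_sub _ Omega (fun x => f x - g x)
  (closure (Omega `&` [set x | f x != 0]) `|` closure (Omega `&` [set x | g x != 0])).
- by apply: closedU; exact: closed_closure.
- exact: compactU.
- by move=> x [/fO|/gO].
- move=> x Ox; have [f0|f0 _] := eqVneq (f x) 0; last by left; apply: subset_closure.
  by rewrite f0 sub0r oppr_eq0 => g0; right; apply: subset_closure.
move=> k1 k2; split => //; apply/smoothP => k.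
under eq_fun do rewrite -mulN1r.
apply: CkD; first exact: (smoothP _).1 sf k.
by apply: CkM; [exact: Ck_cst|exact: (smoothP _).1 sg k].
Qed.

Lemma ae_approximableB v1 v2 g1 g2 : ae_approximable v1 g1 -> ae_approximable v2 g2 ->
  ae_approximable (fun x => v1 x - v2 x) (fun x => g1 x - g2 x).
Proof.
move=> [p1 [D1 [t1 i1 c1 b1]]] [p2 [D2 [t2 i2 c2 b2]]].
have gB k x i : grad (fun y => p1 k y - p2 k y) x ord0 i =
    grad (p1 k) x ord0 i - grad (p2 k) x ord0 i.
  rewrite !mxE -[fun y => _]/((p1 k) - (p2 k)) deriveB//.
    by apply: smooth_derivable; case: (t1 k).
  by apply: smooth_derivable; case: (t2 k).
exists (fun k x => p1 k x - p2 k x), (fun x => 2 * (D1 x + D2 x)); split.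
- by move=> k; exact: test_functionB.
- exact: (@integrableZl _ _ _ mu setT measurableT 2 _ (integrableD measurableT i1 i2)).
- apply: filterS2 c1 c2 => x c1 c2 Ox.
  have [c1v c1g] := c1 Ox; have [c2v c2g] := c2 Ox; split=> [|i].
    exact: cvgB.
  under eq_fun do rewrite gB; rewrite mxE [X in _ + X]mxE.
  by apply: cvgB; [exact: c1g|exact: c2g].
- have young (a b A B : R) : a ^+ 2 <= A -> b ^+ 2 <= B -> (a - b) ^+ 2 <= 2 * (A + B).
    by have := sqr_ge0 (a + b); nra.
  apply: filterS2 b1 b2 => x b1 b2 Ox k i; rewrite gB.
  by apply: young; [exact: b1|exact: b2].
Qed.

End approximation.

(** * Products of a function of x and a function of t *)

Section tensor_test_functions.
Context {R : realType} {n : nat}.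
Variable Omega : set 'rV[R]_n.

(** As gamma vanishes at 0, composing with it does not enlarge the support of
    phi. *)
Lemma test_function_tensor (gamma psi : R -> R) (phi : 'rV[R]_n -> R) (I J : set R) :
  (forall k, Ck k gamma) -> gamma 0 = 0 -> test_function Omega phi ->
  (forall k, Ck k psi) -> compact J -> J `<=` I -> (forall t, I t -> psi t != 0 -> J t) ->
  test_function (Omega `*` I) (fun z => gamma (phi z.1) * psi z.2).
Proof.
move=> Cg g0 [sphi kphi phiO] Cpsi kJ JI psiJ.
have kB := compact_setX kphi kJ.
have cB : closed (closure (Omega `&` [set x | phi x != 0]) `*` J).
  apply: compact_closed kB; exact: norm_hausdorff.
have [] := @closure_supp_sub _ _ (Omega `*` I) (fun z => gamma (phi z.1) * psi z.2) _ cB kB.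
- by move=> z [/phiO ? /JI].
- move=> z [Oz Iz]; rewrite mulf_eq0 negb_or => /andP[gz psz]; split; last exact: psiJ.
  apply: subset_closure; split => //=; apply: contra_neq gz => ->; exact: g0.
move=> k1 k2; split => //; apply/smoothP => k.
apply: CkM; last exact: Ck_snd.
by apply: Ck_comp => //; apply: Ck_fst; exact: (smoothP _).1 sphi k.
Qed.

Lemma grad_x_tensor (gamma gamma' psi : R -> R) (phi : 'rV[R]_n -> R) z i :
  (forall s, is_derive s (1 : R) gamma (gamma' s)) -> smooth phi ->
  grad_x (fun z => gamma (phi z.1) * psi z.2) z ord0 i =
  psi z.2 * (gamma' (phi z.1) * grad phi z.1 ord0 i).
Proof.
move=> dg sphi; rewrite /grad_x /grad !mxE/=.
have df : is_derive z.1 (delta_mx ord0 i) phi ('D_(delta_mx ord0 i) phi z.1).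
  by split => //; exact: smooth_derivable.
have dgf := is_derive_comp1 (dg (phi z.1)) df.
have -> : (fun x => gamma (phi x) * psi z.2) = psi z.2 \*: (fun x => gamma (phi x)).
  by apply/funext => x; rewrite /= mulrC.
by have /@derive_val := is_deriveZ (psi z.2) dgf.
Qed.

Lemma deriv_t_tensor (gamma psi psi' : R -> R) (phi : 'rV[R]_n -> R) z :
  (forall t, is_derive t (1 : R) psi (psi' t)) ->
  deriv_t (fun z => gamma (phi z.1) * psi z.2) z = gamma (phi z.1) * psi' z.2.
Proof.
move=> dpsi; rewrite /deriv_t derive1E /=.
by have /@derive_val := is_deriveZ (gamma (phi z.1)) (dpsi z.2).
Qed.

End tensor_test_functions.

(** * Passing to the limit in the weak form *)

Section weak_form.
Context {d} {X : measurableType d} {R : realType}.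
Variable mu : {sigma_finite_measure set X -> \bar R}.
Local Notation leb := (@lebesgue_measure R).
Local Notation RR := (measurableTypeR R).
Local Notation m := (spacetime mu).

(** The integrand of the weak formulation for the test function c(x) psi(t),
    where c has the gradient dc, the unknown w has the gradient g, and h is the
    convection term.  It is linear in (w, g, h) for fixed (c, dc), and also
    expresses the divergence condition, with w = h = 0 and g = b. *)
Definition weak_form n (psi psi' : R -> R) (nu : R) (c : X -> R) (dc : 'I_n -> X -> R)
    (w : X * RR -> R) (g : 'I_n -> X * RR -> R) (h : X * RR -> R) (z : X * RR) : R :=
  - psi' z.2 * (w z * c z.1) +
  psi z.2 * (\sum_i g i z * (nu * dc i z.1) + h z * c z.1).

Lemma ae_spacetime_fst (P : X -> Prop) : {ae mu, forall x, P x} ->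
  {ae m, forall z, P z.1}.
Proof.
move=> [N [mN N0 NP]]; exists (N `*` setT); split.
- exact: measurableX.
- apply: etrans (product_measure1E mu leb mN measurableT) _.
  by rewrite [X in (X * _)%E](N0 : _ = _); exact: mul0e.
- by move=> z Pz; split => //; exact: NP.
Qed.

Lemma integrable_fst (T : R) (D : X -> R) : mu.-integrable setT (EFin \o D) ->
  m.-integrable setT (EFin \o (fun z : X * RR => D z.1 * \1_(`]0, T[ : set RR) z.2)).
Proof.
move=> /integrableP[mD iD].
have mE : measurable_fun setT (fun z : X * RR => D z.1 * \1_(`]0, T[ : set RR) z.2).
  apply: measurable_funM.
    by apply: (measurableT_comp _ measurable_fst); exact/measurable_EFinP.
  by apply: (measurableT_comp _ measurable_snd); apply: measurable_indic; exact: measurable_itv.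
apply/integrableP; split; first exact/measurable_EFinP.
have mN : measurable_fun setT (fun z : X * RR => (`|D z.1 * \1_(`]0, T[ : set RR) z.2|%R)%:E).
  by apply/measurable_EFinP; exact: measurableT_comp.
have N0 (z : X * RR) : (0 <= (`|D z.1 * \1_(`]0, T[ : set RR) z.2|%R)%:E)%E by rewrite lee_fin.
apply: (@le_lt_trans _ _ (\int[mu]_x \int[leb]_t (`|D x * \1_(`]0, T[ : set RR) t|%R)%:E)%E).
  by rewrite le_eqVlt; apply/orP; left; apply/eqP; exact: (@fubini_tonelli1 _ _ _ _ _ mu leb _ mN N0).
under eq_integral => x _.
  under eq_integral => t _ do rewrite normrM EFinM [X in (_ * X%:E)%E]ger0_norm//.
  rewrite ge0_integralZl//; last first.
    by apply/measurable_EFinP; apply: measurable_indic; exact: measurable_itv.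
  rewrite integral_indic ?setIT//.
  over.
have lT : (leb (`]0%R, T[ : set RR) < +oo)%E.
  by rewrite lebesgue_measure_itv/=; case: ifP => _; rewrite ?ltry// -EFinB ltry.
rewrite ge0_integralZr//.
- by rewrite lte_mul_pinfty// ?ge0_fin_numE//; apply: integral_ge0.
- by apply/measurable_EFinP; apply: measurableT_comp => //; exact/measurable_EFinP.
Qed.


Section dominated.
Variables (n : nat) (T nu C : R) (O : set X) (D : X -> R) (psi psi' : R -> R).
Variables (w : X * RR -> R) (g : 'I_n -> X * RR -> R) (h : X * RR -> R).
Hypotheses (nu0 : 0 <= nu) (hw : L12 mu T w) (hg : forall i, L12 mu T (g i)).
Hypotheses (ih : m.-integrable setT (EFin \o h)).
Hypothesis (hO : forall z, ~ (O z.1 /\ 0 < z.2 < T) ->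
  [/\ w z = 0, forall i, g i z = 0 & h z = 0]).
Hypothesis (iD : mu.-integrable setT (EFin \o D)).
Hypotheses (mpsi : measurable_fun [set: RR] (psi : RR -> R))
  (mpsi' : measurable_fun [set: RR] (psi' : RR -> R)).
Hypothesis (psiC : forall t, `|psi t| <= C /\ `|psi' t| <= C).

(** The term |h| is bounded by itself because |c| <= 1; the products g dc are
    bounded by Young's inequality, and D depends on x alone, so that the
    indicator of (0, T) is needed for integrability. *)
Let bound (z : X * RR) : R := C * (`|w z| +
  (\sum_i nu * (g i z ^+ 2 + `|D z.1| * \1_(`]0, T[ : set RR) z.2) + `|h z|)).

Let ibound : m.-integrable setT (EFin \o bound).
Proof.
have i1 : m.-integrable setT (EFin \o (fun z => `|w z|)) by case: hw => /integrable_abse.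
have i3 : m.-integrable setT (EFin \o (fun z => `|h z|)) by have := integrable_abse ih.
have i2 : m.-integrable setT (EFin \o (fun z : X * RR =>
    \sum_i nu * (g i z ^+ 2 + `|D z.1| * \1_(`]0, T[ : set RR) z.2))).
  rewrite (_ : _ \o _ = fun z => (\sum_i (nu * (g i z ^+ 2 + `|D z.1| * \1_(`]0, T[ : set RR) z.2))%:E)%E); last first.
    by apply/funext => z; rewrite /= sumEFin.
  apply: integrable_sum => // i _.
  have [_ ig _] := hg i.
  exact: (@integrableZl _ _ _ m setT measurableT nu _ (integrableD measurableT ig (integrable_fst T (integrable_abse iD)))).
exact: (@integrableZl _ _ _ m setT measurableT C _
  (integrableD measurableT i1 (integrableD measurableT i2 i3))).
Qed.

Let measurable_weak_form (c : X -> R) (dc : 'I_n -> X -> R) : measurable_fun setT c -> (forall i, measurable_fun setT (dc i)) ->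
  measurable_fun setT (weak_form psi psi' nu c dc w g h).
Proof.
move=> mc mdc.
have mc1 : measurable_fun setT (fun z : X * RR => c z.1) by exact: (measurableT_comp mc measurable_fst).
have mesL F : L12 mu T F -> measurable_fun setT F.
  by case=> iF _ _; apply/measurable_EFinP; exact: measurable_int iF.
apply: measurable_funD.
  apply: measurable_funM; last by apply: measurable_funM => //; exact: mesL.
  by apply: measurableT_comp => //; exact: (measurableT_comp mpsi' measurable_snd).
apply: measurable_funM; first exact: (measurableT_comp mpsi measurable_snd).
apply: measurable_funD.
  apply: measurable_sum => i; apply: measurable_funM; first exact: mesL.
  apply: measurable_funM => //.
  exact: (measurableT_comp (mdc i) measurable_fst).
apply: measurable_funM => //; apply/measurable_EFinP; exact: measurable_int ih.
Qed.

Let weak_form_le c dc z : `|c z.1| <= 1 -> (O z.1 -> forall i, dc i z.1 ^+ 2 <= D z.1) ->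
  `|weak_form psi psi' nu c dc w g h z| <= bound z.
Proof.
move=> c1 dcD; have C0 : 0 <= C by have [+ _] := psiC 0; exact: le_trans.
have [zO|/hO[w0 g0 h0]] := pselect (O z.1 /\ 0 < z.2 < T); last first.
  rewrite /weak_form w0 h0 !mul0r mulr0 add0r addr0 big1 => [|i _]; last by rewrite g0 mul0r.
  rewrite mulr0 normr0 mulr_ge0// addr_ge0// addr_ge0// sumr_ge0// => i _.
  by rewrite mulr_ge0// addr_ge0 ?sqr_ge0// mulr_ge0.
have [Oz Tz] := zO; have [psC psC'] := psiC z.2.
rewrite /bound mulrDr; apply: (le_trans (ler_normD _ _)); apply: lerD.
  rewrite normrM normrN normrM; apply: ler_pM => //.
  by rewrite ler_piMr.
rewrite normrM; apply: ler_pM => //; apply: (le_trans (ler_normD _ _)); apply: lerD.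
  apply: (le_trans (ler_norm_sum _ _ _)); apply: ler_sum => i _.
  rewrite mulrCA normrM ger0_norm// ler_wpM2l// indicE mem_set/= ?in_itv// mulr1.
  have dD := le_trans (dcD Oz i) (ler_norm _); rewrite normrM.
  rewrite -(real_normK (num_real (g i z))).
  rewrite -(real_normK (num_real (dc i z.1))) in dD.
  apply: (@le_trans _ _ (`|g i z| ^+ 2 + `|dc i z.1| ^+ 2)); last by rewrite lerD2l.
  have := sqr_ge0 (`|g i z| - `|dc i z.1|).
  by have := mulr_ge0 (normr_ge0 (g i z)) (normr_ge0 (dc i z.1)); nra.
by rewrite normrM ler_piMr.
Qed.

Lemma integrable_weak_form (c : X -> R) (dc : 'I_n -> X -> R) : measurable_fun setT c ->
  (forall i, measurable_fun setT (dc i)) -> (forall x, `|c x| <= 1) ->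
  {ae mu, forall x, O x -> forall i, dc i x ^+ 2 <= D x} ->
  m.-integrable setT (EFin \o weak_form psi psi' nu c dc w g h).
Proof.
move=> mc mdc c1 dcD; apply/integrableP; split.
  by apply/measurable_EFinP; exact: measurable_weak_form.
have /integrableP[mb] := ibound; apply: le_lt_trans.
apply: ae_ge0_le_integral => //.
- by apply: measurableT_comp => //; apply/measurable_EFinP; exact: measurable_weak_form.
- exact: measurableT_comp.
- apply: filterS (ae_spacetime_fst dcD) => z dcDz _.
  by rewrite /= lee_fin (le_trans (weak_form_le (c1 _) dcDz))// ler_norm.
Qed.

Lemma cvg_weak_form (c_ : nat -> X -> R) (dc_ : nat -> 'I_n -> X -> R)
  (c : X -> R) (dc : 'I_n -> X -> R) :
  (forall k, measurable_fun setT (c_ k)) -> (forall k i, measurable_fun setT (dc_ k i)) ->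
  measurable_fun setT c -> (forall i, measurable_fun setT (dc i)) ->
  (forall k x, `|c_ k x| <= 1) ->
  {ae mu, forall x, O x -> c_ k x @[k --> \oo] --> c x /\
    forall i, dc_ k i x @[k --> \oo] --> dc i x} ->
  {ae mu, forall x, O x -> forall k i, dc_ k i x ^+ 2 <= D x} ->
  \int[m]_z weak_form psi psi' nu (c_ k) (dc_ k) w g h z @[k --> \oo] -->
  \int[m]_z weak_form psi psi' nu c dc w g h z.
Proof.
move=> mc_ mdc_ mc mdc c1 cvc dcD.
have [] := @dominated_convergence _ _ _ m setT measurableT
  (fun k => EFin \o weak_form psi psi' nu (c_ k) (dc_ k) w g h)
  (EFin \o weak_form psi psi' nu c dc w g h) (EFin \o bound) _ _ _ ibound _.
- by move=> k; apply/measurable_EFinP; exact: measurable_weak_form.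
- by apply/measurable_EFinP; exact: measurable_weak_form.
- apply: filterS (ae_spacetime_fst cvc) => z cz _; apply: cvg_EFin; first exact: nearW.
  have [zO|/hO[w0 g0 h0]] := pselect (O z.1 /\ 0 < z.2 < T); last first.
    have E c' dc' : weak_form psi psi' nu c' dc' w g h z = 0.
      rewrite /weak_form w0 h0 !mul0r mulr0 add0r addr0 big1 => [|i _]; last by rewrite g0 mul0r.
      exact: mulr0.
    by rewrite /comp E; under eq_fun do rewrite E; exact: cvg_cst.
  have [cc dcc] := cz zO.1; rewrite /comp /weak_form.
  apply: cvgD; first by apply: cvgZr; apply: cvgZr.
  apply: cvgZr; apply: cvgD; last exact: cvgZr.
  apply: cvg_big => [|i _]; first exact: add_continuous.
  apply: cvgZr; apply: cvgZr; exact: dcc.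
- apply: filterS (ae_spacetime_fst dcD) => z dcDz k _.
  by rewrite /= lee_fin weak_form_le// => Oz i; exact: dcDz.
move=> il _ cv; apply: (fine_cvg _).
by rewrite fineK ?integrable_fin_num//.
Qed.
End dominated.
End weak_form.

(** * The difference of two weak solutions *)

Section difference_of_weak_solutions.
Context {R : realType} {n : nat}.
Variables (Omega : set 'rV[R]_n) (T nu : R) (b : 'rV[R]_n * R -> 'rV[R]_n).
Local Notation RR := (measurableTypeR R).
Local Notation leb := (@lebesgue_measure R).
Local Notation mu := (@lebesgue_rV R n).
Local Notation m := (spacetime mu).
Local Notation Q := (QT Omega T).
Hypotheses (Omega_open : open Omega) (Omega_bounded : bounded_set Omega).
Hypotheses (T0 : 0 < T) (nu0 : 0 < nu).
Hypothesis b_L2 : in_Lp_rV (lebesgue_xt n) Q 2%:E b.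

Let Bf i : 'rV[R]_n * RR -> R := (fun z => b z ord0 i) \_ Q.

Let Bf_L12 i : L12 mu T (Bf i).
Proof.
have [mB iB] := Lfun2_sq (b_L2 i); apply: (L12_QT Omega_open Omega_bounded) => // z zQ.
by rewrite /Bf patchE memNset.
Qed.

Let Q_of (z : 'rV[R]_n * RR) : ~ (Omega z.1 /\ 0 < z.2 < T) -> ~ Q z.
Proof. by move=> H [Oz]; rewrite /= in_itv/= => Tz; apply: H. Qed.

Let L12_gradient u g : in_L2_W12_0 Omega T u g ->
  L12 mu T (u \_ Q : 'rV[R]_n * RR -> R) /\
  forall i, L12 mu T ((fun z => g z ord0 i) \_ Q : 'rV[R]_n * RR -> R).
Proof.
move=> /(in_L2_W12_0_sq Omega_open)[[mu_ iu] Hg]; split=> [|i].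
  by apply: (L12_QT Omega_open Omega_bounded) => // z zQ; rewrite patchE memNset.
have [mg ig] := Hg i.
by apply: (L12_QT Omega_open Omega_bounded) => // z zQ; rewrite patchE memNset.
Qed.

Let L12B (F G : 'rV[R]_n * RR -> R) : L12 mu T F -> L12 mu T G -> L12 mu T (fun z => F z - G z).
Proof.
move=> [iF iF2 FT] [iG iG2 GT]; have iB := integrableB measurableT iF iG; split.
- exact: iB.
- have i2 := @integrableZl _ _ _ m setT measurableT 2 _ (integrableD measurableT iF2 iG2).
  apply: (le_integrable _ _ _ i2) => //.
    by apply/measurable_EFinP; apply: measurable_funX; apply/measurable_EFinP; exact: measurable_int iB.
  move=> z _; rewrite /= lee_fin ger0_norm ?sqr_ge0// (le_trans _ (ler_norm _))//.
  by have := sqr_ge0 (F z + G z); nra.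
- move=> z FG; have [F0|/FT//] := eqVneq (F z) 0.
  by apply: GT; apply: contra_neq FG => ->; rewrite F0 subrr.
Qed.

Let integrable_flux (G : 'I_n -> 'rV[R]_n * RR -> R) : (forall i, L12 mu T (G i)) ->
  m.-integrable setT (EFin \o flux G Bf).
Proof.
move=> hG; rewrite (_ : _ \o _ = fun z => (\sum_(i < n) (Bf i z * G i z)%:E)%E); last first.
  by apply/funext => z; rewrite /= sumEFin.
have mesL F : L12 mu T F -> measurable_fun setT F.
  by case=> iF _ _; apply/measurable_EFinP; exact: measurable_int iF.
apply: integrable_sum => // i _; have [_ B2 _] := Bf_L12 i; have [_ G2 _] := hG i.
by apply: integrable_mul_sq => //; exact: mesL.
Qed.

Let measurable_test (phi : 'rV[R]_n -> R) (gamma : R -> R) : test_function Omega phi ->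
  Ck 0 gamma -> measurable_fun setT (fun x => gamma (phi x)).
Proof.
move=> [/smoothP sphi _ _] Cg.
apply: continuous_measurable_rV; exact: (Ck_comp Cg (sphi 0%N)).
Qed.

Let measurable_dtest (phi : 'rV[R]_n -> R) (gamma : R -> R) i : test_function Omega phi ->
  Ck 0 gamma -> measurable_fun setT (fun x => gamma (phi x) * grad phi x ord0 i).
Proof.
move=> tphi Cg; apply: measurable_funM; first exact: measurable_test.
by apply: continuous_measurable_rV; apply: smooth_grad_continuous; case: tphi.
Qed.

Variables (u0 : 'rV[R]_n -> R) (f : 'rV[R]_n * R -> R).

Definition satisfies_weak_form (u : 'rV[R]_n * R -> R) (g : 'rV[R]_n * R -> 'rV[R]_n) : Prop :=
  forall eta, test_function (Omega `*` `[0, T[) eta ->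
      \int[lebesgue_xt n]_(z in Q)
          (- u z * deriv_t eta z + nu * dot (g z) (grad_x eta z)) +
      \int[lebesgue_xt n]_(z in Q) (dot (b z) (g z) * eta z) =
      \int[lebesgue_rV n]_(x in Omega) (u0 x * eta (x, 0)) +
      \int[lebesgue_xt n]_(z in Q) (f z * eta z).

(** The test function softsgn(phi(x)) psi(t).  The right-hand side depends on
    the data only, and cancels between two solutions. *)
Let weak_solution_tensor u g (phi D : 'rV[R]_n -> R) (psi psi' : R -> R) (C s : R) :
  in_L2_W12_0 Omega T u g ->
  satisfies_weak_form u g -> test_function Omega phi -> mu.-integrable setT (EFin \o D) ->
  {ae mu, forall x, Omega x -> forall i, grad phi x ord0 i ^+ 2 <= D x} ->
  (forall k, Ck k psi') -> (forall t, is_derive t (1 : R) psi (psi' t)) ->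
  (forall t, `|psi t| <= C /\ `|psi' t| <= C) -> s < T -> (forall t, s <= t -> psi t = 0) ->
  let G i : 'rV[R]_n * RR -> R := (fun z => g z ord0 i) \_ Q in
  let wf := weak_form psi psi' nu (fun x => softsgn (phi x))
    (fun i x => softsgn' (phi x) * grad phi x ord0 i) (u \_ Q) G (flux G Bf) in
  m.-integrable setT (EFin \o wf) /\
  \int[m]_z wf z =
  \int[lebesgue_rV n]_(x in Omega) (u0 x * (softsgn (phi x) * psi 0)) +
  \int[lebesgue_xt n]_(z in Q) (f z * (softsgn (phi z.1) * psi z.2)).
Proof.
move=> hu ueq tphi iD gD Cpsi' dpsi psiC sT psi0 G wf.
have [hU hG] := L12_gradient hu.
have Cpsi k : Ck k psi by apply: CkS; exact: Ck1 dpsi (Cpsi' k).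
have mpsi : measurable_fun [set: RR] (psi : RR -> R).
  by apply: continuous_measurable_fun; exact: Ck_continuous (Cpsi 0%N).
have mpsi' : measurable_fun [set: RR] (psi' : RR -> R).
  by apply: continuous_measurable_fun; exact: Ck_continuous (Cpsi' 0%N).
have mc := measurable_test tphi (Ck_softsgn 0%N).
have mdc i := measurable_dtest i tphi (Ck_softsgn' 0%N).
have c1 (x : 'rV[R]_n) : `|softsgn (phi x)| <= 1 by exact: softsgn_le1.
have dcD : {ae mu, forall x, Omega x -> forall i, (softsgn' (phi x) * grad phi x ord0 i) ^+ 2 <= D x}.
  apply: filterS gD => x gDx Ox i; apply: le_trans (gDx Ox i).
  rewrite exprMn ler_piMl ?sqr_ge0//.
  by rewrite expr_le1 ?softsgn'_le1 ?softsgn'_ge0.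
have L0 : L12 mu T (fun _ => 0 : R).
  by split=> [||z]; rewrite ?eqxx//; [|under eq_fun do rewrite expr0n]; exact: integrable0.
have i0 : m.-integrable setT (EFin \o (fun _ : 'rV[R]_n * RR => 0 : R)) by exact: integrable0.
have nu0' := ltW nu0.
have Q0 z (F : 'rV[R]_n * RR -> R) : ~ (Omega z.1 /\ 0 < z.2 < T) -> (F \_ Q) z = 0.
  by move=> /Q_of zQ; rewrite patchE memNset.
have iA := integrable_weak_form nu0' hU hG i0
  (fun z zO => And3 (Q0 z u zO) (fun i => Q0 z _ zO) erefl) iD mpsi mpsi' psiC mc mdc c1 dcD.
have hB0 z : ~ (Omega z.1 /\ 0 < z.2 < T) -> flux G Bf z = 0.
  by move=> zO; rewrite /flux big1// => i _; rewrite /Bf Q0// mul0r.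
have iB := integrable_weak_form nu0' L0 (fun _ : 'I_n => L0) (integrable_flux hG)
  (fun z zO => And3 erefl (fun i => erefl) (hB0 z zO)) iD mpsi mpsi' psiC mc mdc c1 dcD.
have wfE : wf = fun z =>
  weak_form psi psi' nu (fun x => softsgn (phi x))
    (fun i x => softsgn' (phi x) * grad phi x ord0 i) (u \_ Q) G (fun _ => 0) z +
  weak_form psi psi' nu (fun x => softsgn (phi x))
    (fun i x => softsgn' (phi x) * grad phi x ord0 i) (fun _ => 0) (fun _ _ => 0) (flux G Bf) z.
  apply/funext => z; rewrite /wf /weak_form.
  by rewrite [X in _ = _ + (_ + _ * (X + _))]big1 => [|i _]; [ring|rewrite mul0r].
rewrite wfE; split; first exact: (integrableD measurableT iA iB).
rewrite RintegralD//.
have teta : test_function (Omega `*` `[0, T[) (fun z => softsgn (phi z.1) * psi z.2).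
  apply: (@test_function_tensor _ _ _ _ _ _ _ `[0, s]%classic) => //.
  - by move=> k; exact: Ck_softsgn.
  - exact: softsgn0.
  - exact: segment_compact.
  - by move=> t /=; rewrite !in_itv/= => /andP[-> ts]; exact: le_lt_trans sT.
  - move=> t /=; rewrite !in_itv/= => /andP[-> tT] pt /=.
    by rewrite leNgt; apply: contraNN pt => /ltW/psi0 ->.
rewrite -(ueq _ teta); congr (_ + _).
  rewrite [RHS]Rintegral_mkcond; apply: eq_Rintegral => z _.
  rewrite patchE; case: ifPn => [/set_mem zQ|/negP zQ].
    rewrite (deriv_t_tensor _ _ _ dpsi) /weak_form /dot mul0r addr0.
    rewrite !patchE mem_set//; congr (_ + _).
      by rewrite mulNr mulNr; congr (- _); ring.
    rewrite mulr_sumr mulr_sumr; apply: eq_bigr => i _.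
    rewrite (grad_x_tensor _ _ _ (@is_derive_softsgn R))//; last by case: tphi.
    by rewrite /G patchE mem_set//; ring.
  have zQ' : ~ Q z by move=> zQ'; apply: zQ; rewrite mem_set.
  rewrite /weak_form patchE memNset//= !mul0r mulr0 addr0 add0r big1 ?mulr0// => i _.
  by rewrite /G patchE memNset// mul0r.
rewrite [RHS]Rintegral_mkcond; apply: eq_Rintegral => z _.
rewrite /weak_form !mul0r mulr0 add0r big1 => [|i _]; last by rewrite mul0r.
rewrite add0r patchE; case: ifPn => zQ.
  rewrite /flux /dot mulrCA; congr (_ * _); last exact: mulrC.
  by apply: eq_bigr => i _; rewrite /Bf /G !patchE zQ.
rewrite /flux big1 ?mul0r ?mulr0// => i _.
by rewrite /Bf patchE (negbTE zQ) mul0r.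
Qed.

Section two_solutions.
Variables (u1 u2 : 'rV[R]_n * R -> R) (g1 g2 : 'rV[R]_n * R -> 'rV[R]_n).
Hypotheses (hu1 : in_L2_W12_0 Omega T u1 g1) (hu2 : in_L2_W12_0 Omega T u2 g2).

Hypotheses (eq1 : satisfies_weak_form u1 g1) (eq2 : satisfies_weak_form u2 g2).

Let W (z : 'rV[R]_n * RR) : R := (u1 \_ Q) z - (u2 \_ Q) z.
Let Gr i (z : 'rV[R]_n * RR) : R :=
  ((fun z => g1 z ord0 i) \_ Q) z - ((fun z => g2 z ord0 i) \_ Q) z.

Let hW : L12 mu T W.
Proof. by apply: L12B; [case: (L12_gradient hu1)|case: (L12_gradient hu2)]. Qed.

Let hGr i : L12 mu T (Gr i).
Proof. by apply: L12B; [case: (L12_gradient hu1)|case: (L12_gradient hu2)]. Qed.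

Let Q0 z (F : 'rV[R]_n * RR -> R) : ~ (Omega z.1 /\ 0 < z.2 < T) -> (F \_ Q) z = 0.
Proof. by move=> /Q_of zQ; rewrite patchE memNset. Qed.

Let slice_measurable (F : 'rV[R]_n * RR -> R) s : L12 mu T F ->
  measurable_fun setT (fun x => F (x, s)).
Proof.
case=> /measurable_int/measurable_EFinP mF _ _.
exact: (measurableT_comp mF (measurable_pair2 s)).
Qed.

(** At almost every time s both solutions are in W12_0, and so the difference
    is approximable there. *)
Let slices : {ae leb, forall s : RR, 0 < s < T ->
  exists (phi : nat -> 'rV[R]_n -> R) (D : 'rV[R]_n -> R),
  [/\ forall k, test_function Omega (phi k),
      mu.-integrable setT (EFin \o D),
      {ae mu, forall x, Omega x -> phi k x @[k --> \oo] --> W (x, s) /\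
        forall i, grad (phi k) x ord0 i @[k --> \oo] --> Gr i (x, s)} &
      {ae mu, forall x, Omega x -> forall k i, grad (phi k) x ord0 i ^+ 2 <= D x}]}.
Proof.
have [_ _ ae1 _] := hu1; have [_ _ ae2 _] := hu2.
have FF := ae_filter_ringOfSetsType leb.
apply: filterS2 ae1 ae2 => s a1 a2 sT.
have sI : `]0, T[%classic s by rewrite /= in_itv.
have ap1 := in_W12_0_approximable Omega_open (a1 sI).
have ap2 := in_W12_0_approximable Omega_open (a2 sI).
have [phi [D [tphi iD cv dom]]] := ae_approximableB ap1 ap2.
exists phi, D; split => //.
apply: filterS cv => x cv Ox; have [cphi cg] := cv Ox.
rewrite /W /Gr !patchE (mem_set (_ : Q (x, s)))//; split=> // i.
by rewrite !patchE (mem_set (_ : Q (x, s)))//; have := cg i; rewrite mxE [X in _ + X]mxE.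
Qed.

Let softsgn_continuous : continuous (@softsgn R).
Proof. exact: Ck_continuous (Ck_softsgn 0%N). Qed.

Let softsgn'_continuous : continuous (@softsgn' R).
Proof. exact: Ck_continuous (Ck_softsgn' 0%N). Qed.

Let slice_comp (gamma : R -> R) F s : continuous gamma -> L12 mu T F ->
  measurable_fun setT (fun x => gamma (F (x, s))).
Proof.
move=> cg hF; apply: (measurableT_comp _ (slice_measurable s hF)).
exact: continuous_measurable_fun.
Qed.

(** The identity for softsgn(phi_k(x)) psi(t) passes to the limit as phi_k
    tends to W(., s): softsgn keeps the values bounded, which the convection
    term needs, and the gradients are dominated. *)
Lemma difference_slice_equation : {ae leb, forall s : RR, 0 < s < T ->
  forall (psi psi' : R -> R) (C : R), (forall k, Ck k psi') ->
    (forall x, is_derive x (1 : R) psi (psi' x)) ->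
    (forall t, `|psi t| <= C /\ `|psi' t| <= C) -> (forall t, s <= t -> psi t = 0) ->
  \int[m]_z (- psi' z.2 * (W z * softsgn (W (z.1, s))) +
     psi z.2 * (\sum_i Gr i z * (nu * (softsgn' (W (z.1, s)) * Gr i (z.1, s))) +
       flux Gr Bf z * softsgn (W (z.1, s)))) = 0}.
Proof.
apply: filterS slices => s sl sT psi psi' C Cpsi' dpsi psiC psi0.
have [phi [D [tphi iD cv dom]]] := sl sT; have sT' : s < T by case/andP: sT.
have mpsi : measurable_fun [set: RR] (psi : RR -> R).
  apply: continuous_measurable_fun; apply: (@Ck_continuous _ _ 1%N); exact: Ck1 dpsi (Cpsi' 0%N).
have mpsi' : measurable_fun [set: RR] (psi' : RR -> R).
  by apply: continuous_measurable_fun; exact: Ck_continuous (Cpsi' 0%N).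
pose c_ k x := softsgn (phi k x).
pose dc_ k (i : 'I_n) x := softsgn' (phi k x) * grad (phi k) x ord0 i.
have dom1 k : {ae mu, forall x, Omega x -> forall i, grad (phi k) x ord0 i ^+ 2 <= D x}.
  by apply: filterS dom => x dx Ox i; exact: dx.
have zero k : \int[m]_z weak_form psi psi' nu (c_ k) (dc_ k) W Gr (flux Gr Bf) z = 0.
  have [i1 e1] := weak_solution_tensor hu1 eq1 (tphi k) iD (dom1 k) Cpsi' dpsi psiC sT' psi0.
  have [i2 e2] := weak_solution_tensor hu2 eq2 (tphi k) iD (dom1 k) Cpsi' dpsi psiC sT' psi0.
  have e12 := etrans e1 (esym e2); move/eqP: e12; rewrite -subr_eq0 -RintegralB// => /eqP e12.
  rewrite -[RHS]e12; apply: eq_Rintegral => z _; rewrite /weak_form /flux -/(c_ k _) -/(W z).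
  rewrite (eq_bigr (fun i => ((fun z => g1 z ord0 i) \_ Q) z * (nu * dc_ k i z.1) -
    ((fun z => g2 z ord0 i) \_ Q) z * (nu * dc_ k i z.1))) => [|i _]; last exact: mulrBl.
  rewrite [X in _ + _ * (_ + X * _)](eq_bigr (fun i => Bf i z * ((fun z => g1 z ord0 i) \_ Q) z -
    Bf i z * ((fun z => g2 z ord0 i) \_ Q) z)) => [|i _]; last exact: mulrBr.
  by rewrite /W !big_split/= !sumrN; ring.
have supp0 z : ~ (Omega z.1 /\ 0 < z.2 < T) ->
    [/\ W z = 0, forall i, Gr i z = 0 & flux Gr Bf z = 0].
  move=> zO; split=> [|i|]; first by rewrite /W !Q0// subr0.
    by rewrite /Gr !Q0// subr0.
  by rewrite /flux big1// => i _; rewrite /Bf Q0// mul0r.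
have cvg : \int[m]_z weak_form psi psi' nu (c_ k) (dc_ k) W Gr (flux Gr Bf) z @[k --> \oo] -->
    \int[m]_z weak_form psi psi' nu (fun x => softsgn (W (x, s)))
      (fun i x => softsgn' (W (x, s)) * Gr i (x, s)) W Gr (flux Gr Bf) z.
  apply: (cvg_weak_form (ltW nu0) hW hGr (integrable_flux hGr) supp0 iD mpsi mpsi' psiC).
  - by move=> k; exact: measurable_test (Ck_softsgn 0%N).
  - by move=> k i; exact: measurable_dtest (Ck_softsgn' 0%N).
  - exact: slice_comp.
  - by move=> i; apply: measurable_funM; [exact: slice_comp|exact: slice_measurable].
  - by move=> k x; exact: softsgn_le1.
  - apply: filterS cv => x cv Ox; have [cphi cg] := cv Ox; split=> [|i].
      exact: (continuous_cvg _ (@softsgn_continuous _) cphi).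
    by apply: cvgM; [exact: (continuous_cvg _ (@softsgn'_continuous _) cphi)|exact: cg].
  - apply: filterS dom => x dx Ox k i; apply: le_trans (dx Ox k i).
    by rewrite exprMn ler_piMl ?sqr_ge0// expr_le1 ?softsgn'_le1 ?softsgn'_ge0.
rewrite (_ : (fun k => _) = fun _ : nat => (0 : R)) in cvg; last exact/funext.
by rewrite [LHS](esym (cvg_lim (@Rhausdorff R) cvg)) lim_cst.
Qed.

(** softabs(phi_k(x)) psi(t) is an admissible nonnegative test function for the
    divergence condition, and its gradient is softsgn(phi_k) grad phi_k psi. *)
Lemma difference_slice_divergence : div_le0 Omega T b -> {ae leb, forall s : RR, 0 < s < T ->
  forall (psi : R -> R) (a C : R), (forall k, Ck k psi) ->
    (forall t, 0 <= psi t <= C) -> 0 < a -> (forall t, t <= a \/ s <= t -> psi t = 0) ->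
  0 <= \int[m]_z (psi z.2 * \sum_i Bf i z * (softsgn (W (z.1, s)) * Gr i (z.1, s)))}.
Proof.
move=> b_div; apply: filterS slices => s sl sT psi a C Cpsi psiC a0 psi0.
have [phi [D [tphi iD cv dom]]] := sl sT; have sT' : s < T by case/andP: sT.
have mpsi : measurable_fun [set: RR] (psi : RR -> R).
  by apply: continuous_measurable_fun; exact: Ck_continuous (Cpsi 0%N).
have L0 : L12 mu T (fun _ => 0 : R).
  by split=> [||z]; rewrite ?eqxx//; [|under eq_fun do rewrite expr0n]; exact: integrable0.
have i0 : m.-integrable setT (EFin \o (fun _ : 'rV[R]_n * RR => 0 : R)) by exact: integrable0.
have psiC' t : `|psi t| <= C /\ `|(0 : R)| <= C.
  have /andP[p0 pC] := psiC t; rewrite ger0_norm// normr0; split => //; exact: le_trans pC.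
have supp0 z : ~ (Omega z.1 /\ 0 < z.2 < T) ->
    [/\ 0 = 0 :> R, forall i, Bf i z = 0 & 0 = 0 :> R].
  by move=> zO; split=> // i; rewrite /Bf Q0.
pose dc_ k (i : 'I_n) x := softsgn (phi k x) * grad (phi k) x ord0 i.
have wfE (dc : 'I_n -> 'rV[R]_n -> R) z :
    weak_form psi (fun _ => 0) 1 (fun _ => 0) dc (fun _ => 0) Bf (fun _ => 0) z =
    psi z.2 * \sum_i Bf i z * dc i z.1.
  rewrite /weak_form !mul0r mulr0 add0r addr0; congr (_ * _).
  by apply: eq_bigr => i _; rewrite mul1r.
have cvg : \int[m]_z weak_form psi (fun _ => 0) 1 (fun _ => 0) (dc_ k) (fun _ => 0) Bf (fun _ => 0) z
    @[k --> \oo] --> \int[m]_z weak_form psi (fun _ => 0) 1 (fun _ => 0)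
      (fun i x => softsgn (W (x, s)) * Gr i (x, s)) (fun _ => 0) Bf (fun _ => 0) z.
  apply: (cvg_weak_form ler01 L0 Bf_L12 i0 supp0 iD mpsi (@measurable_cst _ _ _ _ _ _) psiC').
  - by move=> k.
  - by move=> k i; exact: measurable_dtest (Ck_softsgn 0%N).
  - by [].
  - by move=> i; apply: measurable_funM; [exact: slice_comp|exact: slice_measurable].
  - by move=> k x; rewrite normr0.
  - apply: filterS cv => x cv Ox; have [cphi cg] := cv Ox; split=> [|i]; first exact: cvg_cst.
    by apply: cvgM; [exact: (continuous_cvg _ (@softsgn_continuous _) cphi)|exact: cg].
  - apply: filterS dom => x dx Ox k i; apply: le_trans (dx Ox k i).
    rewrite exprMn ler_piMl ?sqr_ge0// -(real_normK (num_real (softsgn _))).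
    by rewrite expr_le1 ?softsgn_le1.
under eq_Rintegral do rewrite -(wfE (fun i x => softsgn (W (x, s)) * Gr i (x, s))).
rewrite -(cvg_lim _ cvg)//; apply: limr_ge; first by apply/cvg_ex; eexists; exact: cvg.
apply: nearW => k; under eq_Rintegral do rewrite wfE.
have teta : test_function Q (fun z => softabs (phi k z.1) * psi z.2).
  apply: (@test_function_tensor _ _ _ _ _ _ _ `[a, s]%classic) => //.
  - by move=> j; exact: Ck_softabs.
  - exact: softabs0.
  - exact: segment_compact.
  - by move=> t /=; rewrite !in_itv/= => /andP[at_ ts]; rewrite (lt_le_trans a0)//= (le_lt_trans ts).
  - move=> t /= _ pt; rewrite in_itv/= leNgt; apply/andP; split.
      by apply: contraNN pt => /ltW ta; apply/eqP/psi0; left.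
    by rewrite leNgt; apply: contraNN pt => /ltW ta; apply/eqP/psi0; right.
have := b_div _ teta; rewrite Rintegral_mkcond => /(_ _)/le_trans; apply.
  by move=> z _; apply: mulr_ge0; [exact: softabs_ge0|case/andP: (psiC z.2)].
rewrite le_eqVlt; apply/orP; left; apply/eqP; apply: eq_Rintegral => z _.
rewrite patchE; case: ifPn => zQ; last first.
  by rewrite big1 ?mulr0// => i _; rewrite /Bf patchE (negbTE zQ) mul0r.
rewrite /dot mulr_sumr; apply: eq_bigr => i _.
rewrite (grad_x_tensor _ _ _ (@is_derive_softabs R))//; last by case: (tphi k).
by rewrite /Bf patchE zQ /dc_; ring.
Qed.

Lemma difference_ae0 : div_le0 Omega T b -> {ae m, forall z, Q z -> u1 z = u2 z}.
Proof.
move=> b_div.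
have W0 := energy_uniqueness T0 nu0 hW hGr Bf_L12 difference_slice_equation
  (difference_slice_divergence b_div).
apply: filterS W0 => z + zQ; rewrite /W !patchE mem_set// => /eqP.
by rewrite subr_eq0 => /eqP.
Qed.

End two_solutions.

End difference_of_weak_solutions.

Theorem theorem1p3 (R : realType) (n : nat) (hn : (2 <= n)%N)
    (Omega : set 'rV[R]_n)
    (Omega_bounded : bounded_set Omega) (Omega_lip : lipschitz_domain Omega)
    (T nu : R) (T_gt0 : 0 < T) (nu_gt0 : 0 < nu)
    (b : 'rV[R]_n * R -> 'rV[R]_n)
    (b_L2 : in_Lp_rV (lebesgue_xt n) (QT Omega T) 2%:E b)
    (b_div : div_le0 Omega T b)
    (u0 : 'rV[R]_n -> R) (u0_L2 : in_Lp (lebesgue_rV n) Omega 2%:E u0)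
    (f : 'rV[R]_n * R -> R)
    (f_L1 : in_Lp (lebesgue_xt n) (QT Omega T) 1%:E f)
    (u1 u2 : 'rV[R]_n * R -> R) :
  weak_solution Omega T nu b u0 f u1 ->
  weak_solution Omega T nu b u0 f u2 ->
  {ae lebesgue_xt n, forall z, QT Omega T z -> u1 z = u2 z}.
Proof.
move=> [_ [g1 [hu1 eq1]]] [_ [g2 [hu2 eq2]]].
have oO : open Omega by case: Omega_lip.
exact: (difference_ae0 oO Omega_bounded T_gt0 nu_gt0 b_L2 hu1 hu2 eq1 eq2 b_div).
Qed.
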